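(* Let $\mathcal{G}$ be a second countable locally compact étale groupoid and let $\varphi$ be a state on $C^*(\mathcal{G})$ with centralizer containing $C_0(\mathcal{G}^{(0)})$. Let $(\mu,\{\varphi_x\}_{x\in\mathcal{G}^{(0)}})$ be the pair associated with $\varphi$. Then $\varphi$ factors through $C^*_r(\mathcal{G})$ if and only if the state $\varphi_x$ factors through $C^*_e(\mathcal{G}^x_x)$ for $\mu$-almost all $x$.
   Context: Locally compact étale groupoids (not necessarily Hausdorff): groupoids $\mathcal{G}$, with unit space $\mathcal{G}^{(0)}$, range $r(g)=gg^{-1}$ and source $s(g)=g^{-1}g$, endowed with a topology such that the groupoid operations are continuous, $\mathcal{G}^{(0)}$ is locally compact Hausdorff in the relative topology, and $r$ is a local homeomorphism. Put $\mathcal{G}_x=s^{-1}(x)$, $\mathcal{G}^x=r^{-1}(x)$, $\mathcal{G}^x_x=\mathcal{G}^x\cap\mathcal{G}_x$ (the isotropy group, a discrete group with identity $x$). Algebras: $C_c(\mathcal{G})$ is the linear span of the spaces $C_c(U)$ of continuous compactly supported functions on open Hausdorff sets $U\subset\mathcal{G}$, extended by zero to $\mathcal{G}$. It is a $*$-algebra with $(f_1*f_2)(g)=\sum_{h\in\mathcal{G}^{r(g)}}f_1(h)f_2(h^{-1}g)$ and $f^*(g)=\overline{f(g^{-1})}$. $C^*(\mathcal{G})$ is its completion in the norm $\sup_\rho\lVert\rho(f)\rVert$ over all representations by bounded operators on Hilbert spaces. $C^*_r(\mathcal{G})$ is its completion in the reduced norm $\lVert f\rVert_r=\sup_{y\in\mathcal{G}^{(0)}}\lVert\rho_y(f)\rVert$,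 where $\rho_y(f)\delta_g=\sum_{h\in\mathcal{G}_{r(g)}}f(h)\delta_{hg}$ on $\ell^2(\mathcal{G}_y)$. The algebra $C_0(\mathcal{G}^{(0)})$ is a subalgebra of $C^*(\mathcal{G})$ and of $C^*_r(\mathcal{G})$ ($\mathcal{G}^{(0)}$ is open in $\mathcal{G}$, and functions are extended by zero). Induction: let $\rho\colon C^*(\mathcal{G}^x_x)\to B(H)$ be a representation of the full group C$^*$-algebra with canonical unitaries $u_g$. Let $L$ be the Hilbert space of functions $\xi\colon\mathcal{G}_x\to H$ with $\xi(gh)=\rho(u_h^* )\xi(g)$ for $g\in\mathcal{G}_x$, $h\in\mathcal{G}^x_x$, and $\sum_{g\in\mathcal{G}_x/\mathcal{G}^x_x}\lVert\xi(g)\rVert^2<\infty$. Then $\operatorname{Ind}\rho\colon C^*(\mathcal{G})\to B(L)$ is given by $((\operatorname{Ind}\rho)(f)\xi)(g)=\sum_{h\in\mathcal{G}^{r(g)}}f(h)\xi(h^{-1}g)$ for $f\in C_c(\mathcal{G})$. Exotic norm on the group algebra $\mathbb{C}\mathcal{G}^x_x=C_c(\mathcal{G}^x_x)$: $\lVert h\rVert_e=\sup_\rho\lVert\rho(h)\rVert$, the supremum over all representations $\rho$ of $C^*(\mathcal{G}^x_x)$ such that $\operatorname{Ind}\rho$ factors through $C^*_r(\mathcal{G})$ (this is a C$^*$-norm). $C^*_e(\mathcal{G}^x_x)$ is the completion of $\mathbb{C}\mathcal{G}^x_x$ in $\lVert\cdot\rVert_e$. A representation or state factors through a quotient if it vanishes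 on the kernel of the canonical surjection ($C^*(\mathcal{G})\to C^*_r(\mathcal{G})$, resp. $C^*(\mathcal{G}^x_x)\to C^*_e(\mathcal{G}^x_x)$). States and pairs: the centralizer of a state $\varphi$ on $A$ is $\{a\in A:\varphi(ab)=\varphi(ba)\ \forall b\in A\}$. For a Radon measure $\mu$ on $\mathcal{G}^{(0)}$, a $\mu$-measurable field of states is a collection $\{\varphi_x\}_{x\in\mathcal{G}^{(0)}}$ with $\varphi_x$ a state on $C^*(\mathcal{G}^x_x)$ such that $x\mapsto\sum_{g\in\mathcal{G}^x_x}f(g)\varphi_x(u_g)$ is $\mu$-measurable for all $f\in C_c(\mathcal{G})$. By a known theorem (Neshveyev), for second countable $\mathcal{G}$ the states $\varphi$ on $C^*(\mathcal{G})$ with $C_0(\mathcal{G}^{(0)})$ in their centralizer are in bijection with pairs $(\mu,\{\varphi_x\}_x)$ consisting of a regular Borel probability measure $\mu$ on $\mathcal{G}^{(0)}$ and a $\mu$-measurable field of states (fields being identified if they agree $\mu$-a.e.), via $\varphi(f)=\int_{\mathcal{G}^{(0)}}\sum_{g\in\mathcal{G}^x_x}f(g)\varphi_x(u_g)\,d\mu(x)$ for $f\in C_c(\mathcal{G})$; this is the pair associated with $\varphi$. *)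

(* Defs.v *)
From HB Require Import structures.
From mathcomp Require Import all_boot all_order all_algebra.
From mathcomp Require Import all_classical all_reals all_analysis.
From mathcomp Require Import measurable_realfun complex.

Set Implicit Arguments.
Unset Strict Implicit.
Unset Printing Implicit Defensive.
Import Order.TTheory GRing.Theory Num.Theory.
Import numFieldNormedType.Exports.

Local Open Scope classical_set_scope.
Local Open Scope ring_scope.

(* The complex numbers R[i], given as a numClosedFieldType so that they inherit
   the topology and the norm that MathComp-Analysis puts on numeric fields. *)
Definition CC (R : realType) : numClosedFieldType := R[i].

(* A norm over R[i] takes its values in R[i]; normR is the same norm read in R. *)
Definition normR (R : realType) (V : normedZmodType (CC R)) (v : V) : R :=
  complex.Re (`|v| : R[i]).

Definition lin_span (K : pzRingType) (V : lmodType K) (S : set V) : set V :=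
  [set v | exists n (c : 'I_n -> K) (w : 'I_n -> V),
     (forall i, S (w i)) /\ v = \sum_(i < n) c i *: w i].

(** Hilbert spaces, C*-algebras, representations *)

(* The inner product is linear in the first variable. *)
Record hilbertSpace (R : realType) := HilbertSpace {
  hs_space :> completeNormedModType (CC R);
  hs_dot : hs_space -> hs_space -> CC R;
  hs_dot_linear : forall c x y z,
    hs_dot (c *: x + y) z = c * hs_dot x z + hs_dot y z;
  hs_dotC : forall x y, hs_dot y x = (hs_dot x y)^*;
  hs_dot_norm : forall x, hs_dot x x = `|x| ^+ 2 }.

(* Not necessarily unital. *)
Record cstarAlgebra (R : realType) := CstarAlgebra {
  cs_space :> completeNormedModType (CC R);
  cs_mul : cs_space -> cs_space -> cs_space;
  cs_star : cs_space -> cs_space;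
  cs_mulA : associative cs_mul;
  cs_mul_linearl : forall c a b d,
    cs_mul (c *: a + b) d = c *: cs_mul a d + cs_mul b d;
  cs_mul_linearr : forall c a b d,
    cs_mul d (c *: a + b) = c *: cs_mul d a + cs_mul d b;
  cs_starK : involutive cs_star;
  cs_star_antilinear : forall c a b,
    cs_star (c *: a + b) = c^* *: cs_star a + cs_star b;
  cs_starM : forall a b, cs_star (cs_mul a b) = cs_mul (cs_star b) (cs_star a);
  cs_normM : forall a b, `|cs_mul a b| <= `|a| * `|b|;
  cs_normC : forall a, `|cs_mul (cs_star a) a| = `|a| ^+ 2 }.

(* The data of a *-algebra, carried by a subset of a vector space: both the
   function algebras C_c (as subsets of G -> C) and the C*-algebras are of this
   form, so that representations are defined once. *)
Record starOps (R : realType) := StarOps {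
  so_space :> lmodType (CC R);
  so_dom : set so_space;
  so_mul : so_space -> so_space -> so_space;
  so_star : so_space -> so_space }.

Definition cstar_ops (R : realType) (A : cstarAlgebra R) : starOps R :=
  @StarOps R A setT (@cs_mul R A) (@cs_star R A).

(* A continuous linear map between normed spaces is the same as a bounded one.
   Representations may be degenerate. *)
Record is_rep (R : realType) (A : starOps R) (H : hilbertSpace R)
    (pi : A -> H -> H) : Prop := IsRep {
  rep_bounded : forall a, so_dom a -> linear (pi a) /\ continuous (pi a);
  rep_linear : forall c a b xi, so_dom a -> so_dom b ->
    pi (c *: a + b) xi = c *: pi a xi + pi b xi;
  rep_mul : forall a b xi, so_dom a -> so_dom b ->
    pi (so_mul a b) xi = pi a (pi b xi);
  rep_star : forall a xi eta, so_dom a ->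
    hs_dot (pi a xi) eta = hs_dot xi (pi (so_star a) eta) }.

Definition opnorm (R : realType) (H : hilbertSpace R) (T : H -> H) : \bar R :=
  ereal_sup [set (normR (T xi))%:E | xi in [set xi : H | normR xi <= 1]].

Definition universal_norm (R : realType) (A : starOps R) (a : A) : \bar R :=
  ereal_sup [set t | exists (H : hilbertSpace R) (pi : A -> H -> H),
    is_rep pi /\ t = opnorm (pi a)].

(* A C*-completion of A in the norm p. It is unique up to a unique isomorphism. *)
Record completion (R : realType) (A : starOps R) (p : A -> \bar R) := Completion {
  cpl_alg :> cstarAlgebra R;
  cpl_in : A -> cpl_alg;
  cpl_linear : forall c a b, so_dom a -> so_dom b ->
    cpl_in (c *: a + b) = c *: cpl_in a + cpl_in b;
  cpl_mul : forall a b, so_dom a -> so_dom b ->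
    cpl_in (so_mul a b) = cs_mul (cpl_in a) (cpl_in b);
  cpl_star : forall a, so_dom a -> cpl_in (so_star a) = cs_star (cpl_in a);
  cpl_norm : forall a, so_dom a -> (normR (cpl_in a))%:E = p a;
  cpl_dense : dense (cpl_in @` @so_dom R A) }.

(* The filter on A of the elements whose image in the completion tends to a. *)
Definition cpl_near (R : realType) (A : starOps R) (p : A -> \bar R)
    (M : completion p) (a : M) : set_system A :=
  filter_from (nbhs a) (fun U => [set f : A | so_dom f /\ U (cpl_in M f)]).

(* Extension by continuity to the completion of a map j defined on A. *)
Definition cpl_ext (R : realType) (A : starOps R) (p : A -> \bar R)
    (M : completion p) (T : normedModType (CC R)) (j : A -> T) (a : M) : T :=
  lim (j @ cpl_near a).

(* The canonical surjection, when p2 <= p1, between two completions of A. *)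
Definition cpl_surj (R : realType) (A : starOps R) (p1 p2 : A -> \bar R)
    (M1 : completion p1) (M2 : completion p2) : M1 -> M2 :=
  cpl_ext (cpl_in M2).
Arguments cpl_surj {R A p1 p2} M1 M2.

Record is_state (R : realType) (A : cstarAlgebra R) (phi : A -> CC R) : Prop :=
  IsState {
  state_linear : forall c a b, phi (c *: a + b) = c * phi a + phi b;
  state_pos : forall a, 0 <= phi (cs_mul (cs_star a) a);
  state_norm :
    ereal_sup [set (normR (phi a))%:E | a in [set a : A | normR a <= 1]] = 1%E }.

Definition centralizer (R : realType) (A : cstarAlgebra R) (phi : A -> CC R) :
    set A :=
  [set a | forall b, phi (cs_mul a b) = phi (cs_mul b a)].

Definition state_factors (R : realType) (A B : cstarAlgebra R) (q : A -> B)
    (phi : A -> CC R) : Prop :=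
  forall a, q a = 0 -> phi a = 0.

(** Etale groupoids *)

(* The product is a total function whose value is irrelevant off the pairs
   (g, h) with s(g) = g^-1 g = h h^-1 = r(h). *)
Record groupoidOps (G : Type) := GroupoidOps {
  gmul : G -> G -> G;
  ginv : G -> G;
  ginvK : involutive ginv;
  gmulA : forall g h k,
    gmul (ginv g) g = gmul h (ginv h) -> gmul (ginv h) h = gmul k (ginv k) ->
    gmul (gmul g h) k = gmul g (gmul h k);
  gsrcM : forall g h, gmul (ginv g) g = gmul h (ginv h) ->
    gmul (ginv (gmul g h)) (gmul g h) = gmul (ginv h) h;
  grngM : forall g h, gmul (ginv g) g = gmul h (ginv h) ->
    gmul (gmul g h) (ginv (gmul g h)) = gmul g (ginv g);
  gmul_src : forall g, gmul g (gmul (ginv g) g) = g;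
  gmul_rng : forall g, gmul (gmul g (ginv g)) g = g }.

Definition grng (G : Type) (S : groupoidOps G) (g : G) : G := gmul S g (ginv S g).
Definition gsrc (G : Type) (S : groupoidOps G) (g : G) : G := gmul S (ginv S g) g.

Definition gunits (G : Type) (S : groupoidOps G) : set G := range (grng S).

Definition grng_unit (G : Type) (S : groupoidOps G) (g : G) : gunits S :=
  SigSub (mem_set (imageT (grng S) g)).

Definition local_homeo (X Y : topologicalType) (f : X -> Y) : Prop :=
  forall x, exists U : set X, [/\ open U, U x, {in U &, injective f},
    {within U, continuous f} &
    forall V, open V -> V `<=` U -> open (f @` V)].

(* The unit space carries the relative topology (that of set_type). A pointed
   type is needed only because measurable types are pointed in the library; a
   groupoid whose C*-algebra has a state is not empty. *)
Record etaleGroupoid := EtaleGroupoid {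
  eg_space :> ptopologicalType;
  eg_ops : groupoidOps eg_space;
  eg_inv_cont : continuous (ginv eg_ops);
  eg_mul_cont :
    {within [set p : eg_space * eg_space | gsrc eg_ops p.1 = grng eg_ops p.2],
      continuous (fun p => gmul eg_ops p.1 p.2)};
  eg_units_lc : locally_compact [set: gunits eg_ops];
  eg_units_hausdorff : hausdorff_space (gunits eg_ops);
  eg_rng_local_homeo : local_homeo (grng_unit eg_ops) }.

Notation "g *_G h" := (gmul (eg_ops _) g h)
  (at level 40, left associativity, format "g  *_G  h").
Notation "g ^-1_G" := (ginv (eg_ops _) g) (at level 3, left associativity, format "g ^-1_G").

Definition rng (G : etaleGroupoid) : G -> G := grng (eg_ops G).
Definition src (G : etaleGroupoid) : G -> G := gsrc (eg_ops G).

Definition unit_space (G : etaleGroupoid) : Type := gunits (eg_ops G).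
HB.instance Definition _ (G : etaleGroupoid) := Topological.copy (unit_space G) (set_type (gunits (eg_ops G))).
HB.instance Definition _ (G : etaleGroupoid) :=
  isPointed.Build (unit_space G) (grng_unit (eg_ops G) point).

Definition unit_val (G : etaleGroupoid) (x : unit_space G) : G := \val x.
Coercion unit_val : unit_space >-> PointedTopological.sort.

Definition rfiber (G : etaleGroupoid) (x : G) : set G := [set g | rng g = x].
Definition sfiber (G : etaleGroupoid) (x : G) : set G := [set g | src g = x].
Definition isotropy (G : etaleGroupoid) (x : G) : set G := rfiber x `&` sfiber x.

(** Convolution algebras *)

Definition conv (R : realType) (G : etaleGroupoid) (f1 f2 : G -> CC R) :
    G -> CC R :=
  fun g => \sum_(h \in rfiber (rng g)) f1 h * f2 (h^-1_G *_G g).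

Definition fstar (R : realType) (G : etaleGroupoid) (f : G -> CC R) : G -> CC R :=
  fun g => (f g^-1_G)^*.

Definition delta (R : realType) (G : etaleGroupoid) (g : G) : G -> CC R :=
  fun h => (h == g)%:R.

Definition Cc_on (R : realType) (G : etaleGroupoid) (U : set G) :
    set (G -> CC R) :=
  [set f | [/\ {within U, continuous f}, (forall g, ~ U g -> f g = 0) &
     exists K : set G, [/\ compact K, K `<=` U & forall g, ~ K g -> f g = 0]]].

Definition Cc (R : realType) (G : etaleGroupoid) : set (G -> CC R) :=
  lin_span [set f | exists U : set G,
    [/\ open U, hausdorff_space U & Cc_on U f]].

Definition Cc_ops (R : realType) (G : etaleGroupoid) : starOps R :=
  @StarOps R (G -> CC R) (@Cc R G) (@conv R G) (@fstar R G).

(* The group algebra of the isotropy group at x, as the finitely supported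
   functions on G that vanish off the isotropy group; on these the convolution
   and the involution of G restrict to those of the group. *)
Definition group_alg_ops (R : realType) (G : etaleGroupoid) (x : G) : starOps R :=
  @StarOps R (G -> CC R)
    [set f : G -> CC R | finite_set [set g | f g != 0] /\
       [set g | f g != 0] `<=` isotropy x]
    (@conv R G) (@fstar R G).

Definition fullCstar (R : realType) (G : etaleGroupoid) : Type :=
  completion (@universal_norm R (Cc_ops R G)).

Definition groupCstar (R : realType) (G : etaleGroupoid) (x : G) : Type :=
  completion (@universal_norm R (group_alg_ops R x)).

(** The reduced norm *)

Definition fin_l2norm (R : realType) (G : etaleGroupoid) (xi : G -> CC R) : R :=
  Num.sqrt (\sum_(g \in [set: G]) normR (xi g) ^+ 2).

(* rho_y(f) applied to the finitely supported xi = \sum_g xi(g) delta_g. *)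
Definition regular_rep (R : realType) (G : etaleGroupoid) (y : G)
    (f xi : G -> CC R) : G -> CC R :=
  \sum_(g \in sfiber y)
     xi g *: \sum_(h \in sfiber (rng g)) f h *: delta R (h *_G g).

(* The operator norm of rho_y(f) on l^2(G_y) is computed on the dense subspace
   of the finitely supported vectors; rho_y(f) maps this subspace to itself. *)
Definition reduced_norm (R : realType) (G : etaleGroupoid) (f : Cc_ops R G) :
    \bar R :=
  ereal_sup [set t | exists (y : unit_space G) (xi : G -> CC R),
    [/\ finite_set [set g | xi g != 0], [set g | xi g != 0] `<=` sfiber y,
        fin_l2norm xi <= 1 &
        t = (fin_l2norm (regular_rep y f xi))%:E]].

Definition reducedCstar (R : realType) (G : etaleGroupoid) : Type :=
  completion (@reduced_norm R G).

(** Induction and the exotic norm *)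

Definition cosets (G : etaleGroupoid) (x : G) : set (set G) :=
  [set [set g *_G h | h in isotropy x] | g in sfiber x].

(* The space L of Ind rho. Only the values of xi on G_x matter. By equivariance
   |xi| is constant on the cosets, so the supremum over a coset is its value. *)
Definition ind_space (R : realType) (G : etaleGroupoid) (x : G)
    (B : groupCstar R x) (H : hilbertSpace R) (rho : B -> H -> H) :
    set (G -> H) :=
  [set xi |
    (forall g h, sfiber x g -> isotropy x h ->
       xi (g *_G h) = rho (cs_star (cpl_in B (delta R h))) (xi g)) /\
    (\esum_(c in cosets x)
       ereal_sup [set (normR (xi g) ^+ 2)%:E | g in c] < +oo)%E].

Definition ind_Cc (R : realType) (G : etaleGroupoid) (H : hilbertSpace R)
    (xi : G -> H) (g : G) (f : Cc_ops R G) : H :=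
  \sum_(h \in rfiber (rng g)) f h *: xi (h^-1_G *_G g).

(* The vector ((Ind rho)(a) xi)(g), for a in C*(G), xi in L and g in G_x. The
   evaluation L -> H at g is continuous, so this is the limit of the values
   ((Ind rho)(f) xi)(g) as f in C_c(G) tends to a. *)
Definition ind_rep (R : realType) (G : etaleGroupoid) (A : fullCstar R G)
    (H : hilbertSpace R) (a : A) (xi : G -> H) (g : G) : H :=
  cpl_ext (ind_Cc xi g) a.

Definition ind_factors (R : realType) (G : etaleGroupoid) (A : fullCstar R G)
    (Ar : reducedCstar R G) (x : G) (B : groupCstar R x) (H : hilbertSpace R)
    (rho : B -> H -> H) : Prop :=
  forall a : A, cpl_surj A Ar a = 0 ->
  forall xi, ind_space rho xi -> forall g, sfiber x g -> ind_rep a xi g = 0.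

Definition exotic_norm (R : realType) (G : etaleGroupoid) (A : fullCstar R G)
    (Ar : reducedCstar R G) (x : G) (B : groupCstar R x)
    (h : group_alg_ops R x) : \bar R :=
  ereal_sup [set t | exists (H : hilbertSpace R) (rho : B -> H -> H),
    [/\ @is_rep R (cstar_ops B) H rho, ind_factors A Ar rho &
        t = opnorm (rho (cpl_in B h))]].

Definition exoticCstar (R : realType) (G : etaleGroupoid) (A : fullCstar R G)
    (Ar : reducedCstar R G) (x : G) (B : groupCstar R x) : Type :=
  completion (exotic_norm A Ar B).

(** The subalgebra C_0 of the unit space *)

Definition C0_units (R : realType) (G : etaleGroupoid) : set (G -> CC R) :=
  [set f | [/\ {within gunits (eg_ops G), continuous f},
     (forall g, ~ gunits (eg_ops G) g -> f g = 0) &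
     forall e : R, 0 < e -> exists K : set G,
       [/\ compact K, K `<=` gunits (eg_ops G) &
           forall g, ~ K g -> normR (f g) <= e]]].

(* The element of C*(G) defined by f in C_0 of the unit space: the limit of the
   elements of C_c of the unit space (a subspace of C_c(G)) tending uniformly
   to f. *)
Definition C0_in (R : realType) (G : etaleGroupoid) (A : fullCstar R G)
    (f : G -> CC R) : A :=
  lim (cpl_in A @ filter_from [set e : R | 0 < e]
    (fun e => [set h : Cc_ops R G | Cc_on (gunits (eg_ops G)) h /\
                 forall g, normR (h g - f g) <= e])).

(** Measures on the unit space and fields of states *)

Definition borel_units (G : etaleGroupoid) :=
  g_sigma_algebraType (@open (unit_space G)).

Definition regular_measure (R : realType) (G : etaleGroupoid)
    (mu : probability (borel_units G) R) : Prop :=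
  forall A : set (unit_space G), measurable (A : set (borel_units G)) ->
    mu A = ereal_inf [set mu U | U in [set U : set (unit_space G) |
             open U /\ A `<=` U]] /\
    mu A = ereal_sup [set mu K | K in [set K : set (unit_space G) |
             compact K /\ K `<=` A]].

(* Measurability for the completion of the Borel sigma-algebra. *)
Definition mu_measurable (R : realType) (G : etaleGroupoid)
    (mu : probability (borel_units G) R) (F : unit_space G -> R) : Prop :=
  measurable_fun setT (F : g_sigma_algebraType (completed_algebra_gen mu) -> R).

Definition field_sum (R : realType) (G : etaleGroupoid)
    (B : forall x : unit_space G, groupCstar R x)
    (phix : forall x, B x -> CC R) (f : G -> CC R) (x : unit_space G) : R[i] :=
  \sum_(g \in isotropy x) f g * phix x (cpl_in (B x) (delta R g)).

Definition measurable_field (R : realType) (G : etaleGroupoid)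
    (mu : probability (borel_units G) R)
    (B : forall x : unit_space G, groupCstar R x)
    (phix : forall x, B x -> CC R) : Prop :=
  (forall x, is_state (phix x)) /\
  (forall f, Cc f ->
     mu_measurable mu (fun x => complex.Re (field_sum phix f x)) /\
     mu_measurable mu (fun x => complex.Im (field_sum phix f x))).

(* The integrand is bounded and equal a.e. to a Borel function; the library's
   integral, a supremum over the simple functions below the integrand, does not
   see the difference. *)
Definition associated_pair (R : realType) (G : etaleGroupoid)
    (A : fullCstar R G) (phi : A -> CC R)
    (B : forall x : unit_space G, groupCstar R x)
    (mu : probability (borel_units G) R) (phix : forall x, B x -> CC R) : Prop :=
  [/\ regular_measure mu, measurable_field mu phix &
      forall f, Cc f -> phi (cpl_in A f) =
        Complex (Rintegral mu setT (fun x => complex.Re (field_sum phix f x)))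
                (Rintegral mu setT (fun x => complex.Im (field_sum phix f x)))].

(* Main.v *)
Require Import Defs.
From HB Require Import structures.
From mathcomp Require Import all_boot all_order all_algebra.
From mathcomp Require Import all_classical all_reals all_analysis.
From mathcomp Require Import measurable_realfun complex ring lra.

(** Let I be the kernel of C*(G) -> C*_r(G) and write f|x for the restriction of
    f in C_c(G) to the isotropy group at x, so that the pair (mu, phi_x) gives
    phi(f) as the integral of phi_x(f|x).

    If phi_x factors through C*_e, take a in I. The representations rho whose
    induction kills I satisfy |rho(f|x)| <= |a - f|, as one sees on the vectors of
    Ind rho supported on the isotropy group; hence |phi_x(f|x)| <= |a - f|. If
    this holds for almost all x, integrating gives |phi(f)| <= 2 |a - f|, and
    phi(a) = 0 follows by letting f tend to a.

    Conversely let phi vanish on I, let rho be the GNS representation of phi_x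
    with vector v, and put beta_x(f) = |(Ind rho)(f) xi|, where xi is the vector v
    placed at the unit x; then beta_x(f)^2 = phi_x((f^* f)|x). If c is in I and
    f_n -> c, the integral of beta_x(f_n)^2 is phi(f_n^* f_n) -> phi(c^* c) = 0, so
    beta_x(f) <= |c - f| for almost all x. Second countability provides countably
    many pairs (f, c) that suffice to make the exceptional null set independent of
    f and c. At the remaining points Ind rho kills I: translating xi by functions
    that isolate an arrow of G_x, and using that v is cyclic, one gets a total set
    of vectors. Thus rho takes part in the supremum that defines |.|_e, so that
    |phi_x(h)| <= |h|_e. *)

Set Implicit Arguments.
Unset Strict Implicit.
Unset Printing Implicit Defensive.
Import Order.TTheory GRing.Theory Num.Theory.
Import numFieldNormedType.Exports.
(* Imported again because MathComp-Analysis has its own [conv]. *)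
Import Defs.

Local Open Scope classical_set_scope.
Local Open Scope ring_scope.

(** * Norms with values in R[i] *)

(** The algebras are arbitrary completions and Ind rho is given through limits, so everything is
    reduced to estimates on C_c(G): an element a of C*(G) enters only through the numbers |a - f|.
    All Hilbert spaces (GNS, induced, regular) come from a positive definite kernel on a set with a
    formal action of the algebra; for Ind rho the set is G x H0, the pair (g, w) standing for w
    placed at g, and the link with the functions of L is made afterwards. Three obstacles shape the
    rest. G need not be Hausdorff, so functions in C_c(G) need not be continuous, and every argument
    passes through open sets on which the range is injective. The bound by |a - f| has a constant
    that depends on the vector of Ind rho, so a total set of vectors does not suffice without an
    additional small error term. Finally, no countable dense subset of I is at hand: at each
    precision every f lies in one of countably many classes whose members are close to f on source
    fibres, and a rational bound for |c - f| replaces the choice of c. *)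

Section complex_norm.
Variable R : realType.
Local Notation C := (CC R).
Implicit Types V : normedModType C.

Definition RtoC (r : R) : C := (r%:C)%C.

Lemma RtoCD r s : RtoC (r + s) = RtoC r + RtoC s.
Proof. by rewrite /RtoC rmorphD. Qed.

Lemma RtoCM r s : RtoC (r * s) = RtoC r * RtoC s.
Proof. by rewrite /RtoC rmorphM. Qed.

Lemma RtoC_le r s : (RtoC r <= RtoC s) = (r <= s).
Proof. exact: lecR. Qed.

Lemma RtoC_lt r s : (RtoC r < RtoC s) = (r < s).
Proof. exact: ltcR. Qed.

Lemma RtoC_Re (z : C) : 0 <= z -> RtoC (complex.Re z) = z.
Proof. by move=> z0; apply/RRe_real/ger0_real. Qed.

Lemma normRE V (v : V) : `|v| = RtoC (normR v).
Proof. by rewrite RtoC_Re. Qed.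

Lemma normR_ge0 V (v : V) : 0 <= normR v.
Proof. by rewrite -RtoC_le -normRE normr_ge0. Qed.

Lemma normR0 V : normR (0 : V) = 0.
Proof. by rewrite /normR normr0. Qed.

Lemma normR_eq0 V (v : V) : normR v = 0 -> v = 0.
Proof. by move=> v0; apply/normr0_eq0; rewrite normRE v0. Qed.

Lemma normRN V (v : V) : normR (- v) = normR v.
Proof. by rewrite /normR normrN. Qed.

Lemma normRD V (v w : V) : normR (v + w) <= normR v + normR w.
Proof. by rewrite -RtoC_le RtoCD -!normRE ler_normD. Qed.

Lemma normRB V (v w : V) : normR (v - w) <= normR v + normR w.
Proof. by rewrite -(normRN w); exact: normRD. Qed.

Lemma normR_tri V (u v w : V) : normR (v - w) <= normR (u - v) + normR (u - w).
Proof.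
have -> : v - w = (u - w) - (u - v) by rewrite opprB [RHS]addrC addrA subrK.
by apply: le_trans (normRB _ _) _; rewrite addrC.
Qed.

Lemma normR_dist V (v w : V) : `|normR v - normR w| <= normR (v - w).
Proof.
rewrite ler_norml; have := normRD (v - w) w; have := normRD (w - v) v.
by rewrite !subrK -(normRN (w - v)) opprB; lra.
Qed.

Lemma normR_sum V I (s : seq I) (P : pred I) (F : I -> V) :
  normR (\sum_(i <- s | P i) F i) <= \sum_(i <- s | P i) normR (F i).
Proof.
elim/big_rec2: _ => [|i x y _ h]; first by rewrite normR0.
by rewrite (le_trans (normRD _ _))// lerD2l.
Qed.

Lemma normRZ V (c : C) (v : V) : normR (c *: v) = normR c * normR v.
Proof.
have : `|c *: v| = `|c| * `|v| by rewrite normrZ.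
by rewrite !normRE -RtoCM => /complexI.
Qed.

Lemma normRM (c d : C) : normR (c * d) = normR c * normR d.
Proof. exact: normRZ. Qed.

Lemma normRJ (c : C) : normR (c^*) = normR c.
Proof. by rewrite /normR norm_conjC. Qed.

Lemma normR_RtoC (r : R) : normR (RtoC r) = `|r|.
Proof. by rewrite /normR normc_def /= expr0n/= addr0 sqrtr_sqr. Qed.

Lemma normR1 : normR (1 : C) = 1.
Proof. by rewrite /normR normr1. Qed.

Lemma mulCJ (c : C) : c * c^* = RtoC (normR c ^+ 2).
Proof. by rewrite -normCK normRE expr2 -RtoCM. Qed.

Lemma Re_le_normR (c : C) : complex.Re c <= normR c.
Proof.
case: c => a b; rewrite /normR normc_def /=.
by rewrite (le_trans (ler_norm _))// -sqrtr_sqr ler_wsqrtr// lerDl sqr_ge0.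
Qed.

Lemma Im_le_normR (c : C) : complex.Im c <= normR c.
Proof.
case: c => a b; rewrite /normR normc_def /=.
by rewrite (le_trans (ler_norm _))// -sqrtr_sqr ler_wsqrtr// lerDr sqr_ge0.
Qed.

Lemma ReN (c : C) : complex.Re (- c) = - complex.Re c.
Proof. by case: c. Qed.
Lemma ImN (c : C) : complex.Im (- c) = - complex.Im c.
Proof. by case: c. Qed.
Lemma ReD (c d : C) : complex.Re (c + d) = complex.Re c + complex.Re d.
Proof. by case: c d => ? ? []. Qed.
Lemma ImD (c d : C) : complex.Im (c + d) = complex.Im c + complex.Im d.
Proof. by case: c d => ? ? []. Qed.

Lemma normRe_le (c : C) : `|complex.Re c| <= normR c.
Proof.
rewrite ler_norml Re_le_normR andbT lerNl -ReN -(normRN c).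
exact: Re_le_normR.
Qed.

Lemma normIm_le (c : C) : `|complex.Im c| <= normR c.
Proof.
rewrite ler_norml Im_le_normR andbT lerNl -ImN -(normRN c).
exact: Im_le_normR.
Qed.

Lemma normR_le_ReIm (c : C) : normR c <= `|complex.Re c| + `|complex.Im c|.
Proof.
case: c => a b.
have -> : normR (Complex a b : C) = normR (RtoC a + Complex 0 1 * RtoC b).
  by congr normR; rewrite {1}[Complex a b]complexE.
rewrite (le_trans (normRD _ _))// normRM !normR_RtoC.
have -> : normR (Complex 0 1 : C) = 1.
  by rewrite /normR normc_def /= expr0n/= add0r expr1n sqrtr1.
by rewrite mul1r.
Qed.

Lemma nearP_normR V T (F : set_system T) {FF : Filter F} (f : T -> V) (a : V) :
  f @ F --> a <-> forall e : R, 0 < e -> \forall x \near F, normR (a - f x) < e.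
Proof.
split=> [/cvgrPdist_lt h e e0|h].
  have /h : 0 < RtoC e by rewrite RtoC_lt.
  by apply: filterS => x; rewrite normRE RtoC_lt.
apply/cvgrPdist_lt => e e0.
have e1 := RtoC_Re (ltW e0).
have /h : 0 < complex.Re e by rewrite -RtoC_lt e1.
by apply: filterS => x; rewrite normRE -e1 RtoC_lt.
Qed.

Lemma nbhs_normR V (a : V) (A : set V) :
  nbhs a A <-> exists2 e : R, 0 < e & forall b, normR (a - b) < e -> A b.
Proof.
split=> [/nbhs_normP[e e0 h]|[e e0 h]].
  have e1 := RtoC_Re (ltW e0).
  exists (complex.Re e); first by rewrite -RtoC_lt e1.
  by move=> b ab; apply: h => /=; rewrite normRE -e1 RtoC_lt.
apply/nbhs_normP; exists (RtoC e); first by rewrite /= RtoC_lt.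
by move=> b /=; rewrite normRE RtoC_lt; exact: h.
Qed.

Lemma lipschitz_continuous V (W : normedModType C) (T : V -> W) (B : R) : 0 <= B ->
  (forall x y, normR (T x - T y) <= B * normR (x - y)) -> continuous T.
Proof.
move=> B0 hB x; apply/nearP_normR => e e0.
have B1 : 0 < B + 1 by lra.
apply/nbhs_normR; exists (e / (B + 1)); first by rewrite divr_gt0.
move=> y; rewrite ltr_pdivlMr//; apply: le_lt_trans.
by apply: le_trans (hB _ _) _; have := normR_ge0 (x - y); nra.
Qed.

Lemma cauchy_normR V (F : set_system V) {FF : Filter F} :
  cauchy F <-> forall e : R, 0 < e -> exists2 A, F A &
    forall a b, A a -> A b -> normR (a - b) < e.
Proof.
split=> [/cauchy_ballP h e e0|h].
  have e2 : 0 < RtoC (e / 2) by rewrite RtoC_lt divr_gt0.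
  have [[P Q] /= [FP FQ] PQ] := h _ e2.
  exists (P `&` Q); first exact: filterI.
  move=> a b [Pa Qa] [Pb Qb].
  by have /(_ (a, b)) := PQ; move=> /(_ (conj Pa Qb)) /=; rewrite -ball_normE /= normRE RtoC_lt; lra.
apply/cauchy_ballP => e e0.
have e1 := RtoC_Re (ltW e0).
have /h[A FA hA] : 0 < complex.Re e by rewrite -RtoC_lt e1.
exists (A, A) => // -[a b] /= [Aa Ab].
by rewrite -ball_normE /= normRE -e1 RtoC_lt; exact: hA.
Qed.

(** Real and imaginary parts are 1-Lipschitz, so both images of a Cauchy filter converge in R;
    conversely |c| <= |Re c| + |Im c|. *)
Lemma CC_complete (F : set_system C) : ProperFilter F -> cauchy F -> cvg F.
Proof.
move=> FF /cauchy_normR cF.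
have key (p : C -> R) : (forall c d, `|p c - p d| <= normR (c - d)) ->
    cvg (p @ F).
  move=> hp; apply: cauchy_cvg; apply/cauchy_ballP => e e0.
  have [A FA hA] := cF e e0.
  exists (p @` A, p @` A) => /=.
    have FpA : F (p @^-1` (p @` A)) by apply: filterS FA => x Ax; exists x.
    by split.
  move=> -[_ _] /= [[a Aa <-] [b Ab <-]].
  by apply: le_lt_trans (hp _ _) _; exact: hA.
have /cvg_ex[/= a /cvgrPdist_lt ha] : cvg (@complex.Re R @ F).
  by apply: key => c d; rewrite -ReN -ReD normRe_le.
have /cvg_ex[/= b /cvgrPdist_lt hb] : cvg (@complex.Im R @ F).
  by apply: key => c d; rewrite -ImN -ImD normIm_le.
suff h : F --> (Complex a b : C) by apply: cvgP h.
apply/(@nearP_normR C _ F _ id) => e e0.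
have e2 : 0 < e / 2 by rewrite divr_gt0.
near=> z; apply: le_lt_trans (normR_le_ReIm _) _.
have h1 : `|a - complex.Re z| < e / 2 by near: z; exact: ha.
have h2 : `|b - complex.Im z| < e / 2 by near: z; exact: hb.
rewrite ReD ImD ReN ImN /=; lra.
Unshelve. all: by end_near. Qed.

End complex_norm.

(** * Positive definite kernels and their Hilbert spaces *)

(** With m = |<x, y>|^2 the hypothesis is positivity of |x - r <x, y> y|^2, and the conclusion is
    the Cauchy-Schwarz inequality. For b > 0 take r = 1/b; for b = 0 the expression is affine in r
    and becomes negative unless m = 0. *)
Lemma discriminant_le (R : realType) (a b m : R) : 0 <= m -> 0 <= b ->
  (forall r, 0 <= a - 2 * r * m + r ^+ 2 * m * b) -> m <= a * b.
Proof.
move=> m0 b0 h; have [b1|] := ltP 0 b.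
  have := h b^-1; have -> : a - 2 * b^-1 * m + b^-1 ^+ 2 * m * b = a - m / b.
    by field; rewrite gt_eqF.
  by rewrite subr_ge0 ler_pdivrMr.
move=> b2; have -> : b = 0 by apply/eqP; rewrite eq_le b2 b0.
rewrite mulr0 leNgt; apply/negP => m1.
have := h ((a + 1) / (2 * m)); have b3 : b = 0 by apply/eqP; rewrite eq_le b2 b0.
rewrite b3 mulr0 addr0.
have -> : 2 * ((a + 1) / (2 * m)) * m = a + 1 by field; rewrite gt_eqF.
lra.
Qed.

Section formal_sums.
Variables (R : realType) (X : Type).
Local Notation C := (CC R).
Implicit Types (F G : X -> C) (s t : seq (C * X)).

(** A list of pairs (c, x) is the formal sum of the c x. The conjugates make this the inner product
    of F with such a sum, antilinear in the second variable. *)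
Definition fsum_eval F t : C := \sum_(p <- t) (p.1)^* * F p.2.

Definition fsum_scale (c : C) t : seq (C * X) := [seq (c * p.1, p.2) | p <- t].

Lemma fsum_eval_nil F : fsum_eval F [::] = 0.
Proof. exact: big_nil. Qed.

Lemma fsum_eval_cat F s t : fsum_eval F (s ++ t) = fsum_eval F s + fsum_eval F t.
Proof. exact: big_cat. Qed.

Lemma fsum_eval_cons F p t :
  fsum_eval F (p :: t) = p.1^* * F p.2 + fsum_eval F t.
Proof. exact: big_cons. Qed.

Lemma fsum_eval_scale F c t : fsum_eval F (fsum_scale c t) = c^* * fsum_eval F t.
Proof.
rewrite /fsum_eval big_map mulr_sumr; apply: eq_bigr => p _ /=.
by rewrite rmorphM mulrA.
Qed.

Lemma fsum_eval_sub F s t : fsum_eval F (s ++ fsum_scale (-1) t) =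
  fsum_eval F s - fsum_eval F t.
Proof. by rewrite fsum_eval_cat fsum_eval_scale rmorphN1 mulN1r. Qed.

Lemma fsum_eval_linear c F G t :
  fsum_eval (c *: F + G) t = c * fsum_eval F t + fsum_eval G t.
Proof.
rewrite /fsum_eval mulr_sumr -big_split; apply: eq_bigr => p _ /=.
by rewrite mulrDr mulrCA.
Qed.

Lemma fsum_evalD F G t : fsum_eval (F + G) t = fsum_eval F t + fsum_eval G t.
Proof. by rewrite -{1}[F]scale1r fsum_eval_linear mul1r. Qed.

Lemma fsum_evalZ c F t : fsum_eval (c *: F) t = c * fsum_eval F t.
Proof.
rewrite /fsum_eval mulr_sumr; apply: eq_bigr => p _ /=.
by rewrite mulrCA.
Qed.

Lemma fsum_evalN F t : fsum_eval (- F) t = - fsum_eval F t.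
Proof. by rewrite -scaleN1r fsum_evalZ mulN1r. Qed.

Lemma fsum_evalB F G t : fsum_eval (F - G) t = fsum_eval F t - fsum_eval G t.
Proof. by rewrite fsum_evalD fsum_evalN. Qed.

Lemma fsum_eval0 t : fsum_eval (0 : X -> C) t = 0.
Proof. by rewrite -(subrr (0 : X -> C)) fsum_evalB subrr. Qed.

Lemma fsum_eval1 F x : fsum_eval F [:: (1, x)] = F x.
Proof. by rewrite /fsum_eval big_seq1 /= conjC1 mul1r. Qed.

Record psdKernel := PsdKernel {
  kfun :> X -> X -> C;
  kfunC : forall x y, kfun y x = (kfun x y)^*;
  kfun_psd : forall s,
    0 <= \sum_(q <- s) (q.1)^* * \sum_(p <- s) p.1 * kfun p.2 q.2 }.

Variable K : psdKernel.

(** If K(x, y) = <e_x, e_y>, this is y -> <u, e_y> for the vector u = sum of the c e_x: vectors are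
    identified with their inner products against the e_y. *)
Definition ksec s : X -> C := fun y => \sum_(p <- s) p.1 * K p.2 y.

Definition kform s t : C := fsum_eval (ksec s) t.

Lemma ksec_nil : ksec [::] = 0.
Proof. by apply/funext => y; rewrite /ksec big_nil. Qed.

Lemma ksec_cat s t : ksec (s ++ t) = ksec s + ksec t.
Proof. by apply/funext => y; rewrite /ksec big_cat. Qed.

Lemma ksec_scale c t : ksec (fsum_scale c t) = c *: ksec t.
Proof.
apply/funext => y; transitivity (c * ksec t y) => //; rewrite /ksec big_map mulr_sumr.
by apply: eq_bigr => p _ /=; rewrite -mulrA.
Qed.

Lemma kformC s t : kform t s = (kform s t)^*.
Proof.
rewrite /kform /fsum_eval /ksec rmorph_sum /=.
under eq_bigr do rewrite mulr_sumr.
under [RHS]eq_bigr do rewrite mulr_sumr rmorph_sum /=.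
rewrite exchange_big /=; apply: eq_bigr => p _; apply: eq_bigr => q _.
by rewrite !rmorphM /= conjCK -kfunC mulrCA.
Qed.

Lemma kform_ge0 s : 0 <= kform s s.
Proof. exact: kfun_psd. Qed.

Lemma kform_catl s t u : kform (s ++ t) u = kform s u + kform t u.
Proof. by rewrite /kform ksec_cat fsum_evalD. Qed.

Lemma kform_catr s t u : kform u (s ++ t) = kform u s + kform u t.
Proof. exact: fsum_eval_cat. Qed.

Lemma kform_scalel c s t : kform (fsum_scale c s) t = c * kform s t.
Proof. by rewrite /kform ksec_scale fsum_evalZ. Qed.

Lemma kform_scaler c s t : kform s (fsum_scale c t) = c^* * kform s t.
Proof. exact: fsum_eval_scale. Qed.

Definition knorm s : R := Num.sqrt (complex.Re (kform s s)).

Lemma knorm_ge0 s : 0 <= knorm s.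
Proof. exact: sqrtr_ge0. Qed.

Lemma kform_norm s : kform s s = RtoC (knorm s ^+ 2).
Proof.
by rewrite sqr_sqrtr ?RtoC_Re ?kform_ge0// -RtoC_le RtoC_Re kform_ge0.
Qed.

Lemma knorm_scale c s : knorm (fsum_scale c s) = normR c * knorm s.
Proof.
apply/eqP; rewrite -(eqrXn2 (_ : 0 < 2)%N) ?mulr_ge0 ?knorm_ge0 ?normR_ge0//.
apply/eqP/complexI; rewrite -!/(RtoC _) -kform_norm kform_scalel kform_scaler.
by rewrite kform_norm mulrA mulCJ -RtoCM exprMn.
Qed.

Lemma kform_CS s t : normR (kform s t) <= knorm s * knorm t.
Proof.
rewrite -(@ler_pXn2r _ 2)// ?nnegrE ?mulr_ge0 ?knorm_ge0 ?normR_ge0//.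
rewrite exprMn; apply: discriminant_le; rewrite ?sqr_ge0// => r.
have := kform_ge0 (s ++ fsum_scale (- RtoC r * kform s t) t).
rewrite !(kform_catl, kform_catr, kform_scalel, kform_scaler).
rewrite (kformC s t) !kform_norm.
set z := kform s t; rewrite rmorphM rmorphN /= !mulNr -/z.
have -> : (RtoC r)^* = RtoC r :> C by rewrite conj_Creal// complex_real.
have hz := mulCJ z; move: hz; set w := z^*; set m := normR z => hz h.
rewrite -RtoC_le; apply: le_trans h _; rewrite le_eqVlt; apply/orP; left; apply/eqP.
transitivity (RtoC (knorm s ^+ 2) - 2 * RtoC r * (z * w)
    + RtoC r ^+ 2 * (z * w) * RtoC (knorm t ^+ 2)); first by ring.
rewrite hz /RtoC !(rmorphM, rmorphB, rmorphD, rmorphXn, rmorph_nat)/=.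
by rewrite expr2.
Qed.

End formal_sums.

(** * The reproducing kernel Hilbert space *)

Section rkhs_def.
Variables (R : realType) (X : Type) (K : psdKernel R X).
Local Notation C := (CC R).
Implicit Types (F G : X -> C) (s t : seq (C * X)) (e : R).

(* |sum_i c_i F(x_i)| <= e |sum_i c_i K(., x_i)|: evaluation at formal sums is
   bounded by e for the seminorm given by the kernel. *)
Definition kbounded F e := forall t, normR (fsum_eval F t) <= e * knorm K t.

(** The completion is realised inside the functions on X. There is no quotient by null vectors and
    there are no classes of Cauchy sequences, since a null vector is already the zero function. *)
Definition rkhs_set : set (X -> C) :=
  [set F | forall e, 0 < e -> exists s, kbounded (F - ksec K s) e].

Lemma kbounded0 e : 0 <= e -> kbounded 0 e.
Proof.
move=> e0 t; rewrite -(scale0r 0) fsum_evalZ mul0r normR0.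
by rewrite mulr_ge0// knorm_ge0.
Qed.

Lemma kboundedD F G e e' :
  kbounded F e -> kbounded G e' -> kbounded (F + G) (e + e').
Proof.
move=> hF hG t; rewrite fsum_evalD mulrDl.
by apply: le_trans (normRD _ _) _; exact: lerD.
Qed.

Lemma kboundedZ c F e : kbounded F e -> kbounded (c *: F) (normR c * e).
Proof.
by move=> hF t; rewrite fsum_evalZ normRM -mulrA ler_wpM2l ?normR_ge0.
Qed.

Lemma kboundedN F e : kbounded F e -> kbounded (- F) e.
Proof. by move=> hF t; rewrite fsum_evalN normRN. Qed.

Lemma kboundedW F e e' : e <= e' -> kbounded F e -> kbounded F e'.
Proof.
by move=> ee hF t; apply: le_trans (hF t) _; rewrite ler_wpM2r ?knorm_ge0.
Qed.

Lemma kbounded_ksec s : kbounded (ksec K s) (knorm K s).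
Proof. by move=> t; exact: kform_CS. Qed.

Lemma rkhs_ksec s : rkhs_set (ksec K s).
Proof. by move=> e e0; exists s; rewrite subrr; apply/kbounded0/ltW. Qed.

Definition rkhs_pred : {pred X -> C} := fun F => `[< rkhs_set F >].

Lemma rkhs_submod : submod_closed rkhs_pred.
Proof.
split=> [|c F G /asboolP hF /asboolP hG].
  by apply/asboolP; rewrite -(ksec_nil K); exact: rkhs_ksec.
apply/asboolP => e e0.
have c1 : 0 < normR c + 1 by have := normR_ge0 c; lra.
have [|s hs] := hF (e / (2 * (normR c + 1))); first by rewrite divr_gt0 ?mulr_gt0.
have [|t ht] := hG (e / 2); first by rewrite divr_gt0.
exists (fsum_scale c s ++ t); rewrite ksec_cat ksec_scale.
have -> : c *: F + G - (c *: ksec K s + ksec K t) =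
    c *: (F - ksec K s) + (G - ksec K t).
  by rewrite scalerBr opprD addrACA.
apply: kboundedW (kboundedD (kboundedZ c hs) ht).
have -> : normR c * (e / (2 * (normR c + 1))) = e / 2 * (normR c / (normR c + 1)).
  by field; rewrite gt_eqF.
rewrite [leRHS](splitr e) lerD2r ler_piMr ?divr_ge0 ?ltW//.
by rewrite ltr_pdivrMr// mul1r ltrDl.
Qed.

HB.instance Definition _ := GRing.isSubmodClosed.Build C (X -> C)
  rkhs_pred (GRing.submod_closed_semi rkhs_submod).

Record rkhs := Rkhs { rkhs_val :> X -> C;
  rkhs_valP : rkhs_val \in rkhs_pred }.

HB.instance Definition _ := [isSub for rkhs_val].
HB.instance Definition _ := [Choice of rkhs by <:].
HB.instance Definition _ := [SubChoice_isSubLmodule of rkhs by <:].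

End rkhs_def.

Section rkhs_norm.
Variables (R : realType) (X : Type) (K : psdKernel R X).
Local Notation C := (CC R).
Implicit Types (F G : X -> C) (f g : rkhs K) (s t : seq (C * X)) (e : R).

(** The norm of F as an antilinear functional on formal sums. A real [sup] is 0 on unbounded sets,
    so this bounds F only once some bound is known. *)
Definition kdual F : R :=
  sup [set normR (fsum_eval F t) | t in [set t | knorm K t <= 1]].

Lemma rkhsP f : rkhs_set K f.
Proof. by apply/asboolP; exact: rkhs_valP. Qed.

Lemma rkhs_valD f g : rkhs_val (f + g) = rkhs_val f + rkhs_val g.
Proof. by []. Qed.

Lemma rkhs_valB f g : rkhs_val (f - g) = rkhs_val f - rkhs_val g.
Proof. by []. Qed.

Lemma rkhs_valZ c f : rkhs_val (c *: f) = c *: rkhs_val f.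
Proof. by []. Qed.

Lemma rkhs_ext f g : (forall x, f x = g x) -> f = g.
Proof. by move=> fg; apply/val_inj/funext. Qed.

Lemma knorm_nil : knorm K [::] = 0.
Proof. by rewrite /knorm /kform fsum_eval_nil sqrtr0. Qed.

Let kdual_set0 F :
  [set normR (fsum_eval F t) | t in [set t | knorm K t <= 1]] !=set0.
Proof. by exists (normR (fsum_eval F [::])), [::] => //=; rewrite knorm_nil. Qed.

Lemma kdual_le F e : 0 <= e -> kbounded K F e -> kdual F <= e.
Proof.
move=> e0 hF; apply: ge_sup; first exact: kdual_set0.
by move=> _ [t /= t1 <-]; apply: le_trans (hF t) _; rewrite ler_piMr.
Qed.

Lemma kdual_bounded F e : kbounded K F e -> kbounded K F (kdual F).
Proof.
move=> hF t; have [t0|t0] := ltP 0 (knorm K t); last first.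
  have -> : knorm K t = 0 by apply/eqP; rewrite eq_le t0 knorm_ge0.
  rewrite mulr0; apply: le_trans (hF t) _.
  suff -> : knorm K t = 0 by rewrite mulr0.
  by apply/eqP; rewrite eq_le t0 knorm_ge0.
rewrite -ler_pdivrMr//; apply: ub_le_sup.
  exists `|e|; move=> _ [u /= u1 <-]; apply: le_trans (hF u) _.
  apply: le_trans (_ : `|e| * knorm K u <= _); last by rewrite ler_piMr.
  by rewrite ler_wpM2r ?knorm_ge0// ler_norm.
have tV : normR (RtoC (knorm K t)^-1) = (knorm K t)^-1.
  by rewrite normR_RtoC ger0_norm// invr_ge0 ltW.
exists (fsum_scale (RtoC (knorm K t)^-1) t) => /=.
  by rewrite knorm_scale tV mulVf// gt_eqF.
by rewrite fsum_eval_scale normRM normRJ tV mulrC.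
Qed.

Lemma kdual_ge0 F : 0 <= kdual F.
Proof.
have [h|h] := pselect (has_sup
    [set normR (fsum_eval F t) | t in [set t | knorm K t <= 1]]); last first.
  by rewrite /kdual sup_out.
apply: le_trans (ub_le_sup h.2 _); last first.
  by exists [::] => //=; rewrite knorm_nil.
exact: normR_ge0.
Qed.

Lemma rkhs_kbounded f : kbounded K f (kdual f).
Proof.
have [s hs] := rkhsP f ltr01; apply: (@kdual_bounded _ (1 + knorm K s)).
by rewrite -(subrK (ksec K s) (rkhs_val f)); apply: kboundedD => //; exact: kbounded_ksec.
Qed.

Lemma kdual_ksec s : kdual (ksec K s) = knorm K s.
Proof.
apply/eqP; rewrite eq_le kdual_le ?knorm_ge0//=; last exact: kbounded_ksec.
have := @kdual_bounded (ksec K s) _ (@kbounded_ksec _ _ _ _) s.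
rewrite -/(kform K s s) kform_norm normR_RtoC ger0_norm ?sqr_ge0// expr2.
have [s0|s0] := ltP 0 (knorm K s); first by rewrite ler_pM2r.
by move=> _; apply: le_trans s0 (kdual_ge0 _).
Qed.

Lemma rkhs_eval_le f x : normR (f x) <= kdual f * knorm K [:: (1, x)].
Proof. by rewrite -(fsum_eval1 f x); exact: rkhs_kbounded. Qed.

Definition rkhs_norm f : C := RtoC (kdual f).

Lemma ler_rkhs_normD f g : rkhs_norm (f + g) <= rkhs_norm f + rkhs_norm g.
Proof.
rewrite /rkhs_norm -RtoCD RtoC_le kdual_le ?addr_ge0 ?kdual_ge0//.
by apply: kboundedD; exact: rkhs_kbounded.
Qed.

Lemma rkhs_normZ c f : rkhs_norm (c *: f) = `|c| * rkhs_norm f.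
Proof.
rewrite normRE -RtoCM; congr RtoC; apply/eqP; rewrite eq_le.
rewrite kdual_le ?mulr_ge0 ?normR_ge0 ?kdual_ge0//=; last first.
  by apply: kboundedZ; exact: rkhs_kbounded.
have [->|c0] := eqVneq c 0; first by rewrite normR0 mul0r kdual_ge0.
have c1 : 0 < normR c.
  rewrite lt_neqAle normR_ge0 andbT eq_sym; apply: contra_neq c0.
  exact: (@normR_eq0 _ C).
rewrite mulrC -ler_pdivlMr// mulrC.
have -> : (normR c)^-1 = normR (c^-1).
  by apply: (mulfI (lt0r_neq0 c1)); rewrite mulfV ?gt_eqF// -normRM mulfV// normR1.
apply: kdual_le; first by rewrite mulr_ge0 ?normR_ge0 ?kdual_ge0.
have {1}-> : rkhs_val f = c^-1 *: rkhs_val (c *: f).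
  by rewrite rkhs_valZ scalerA mulVf// scale1r.
by apply: kboundedZ; exact: rkhs_kbounded.
Qed.

Lemma rkhs_norm0_eq0 f : rkhs_norm f = 0 -> f = 0.
Proof.
move=> /(@complexI _ _ 0) f0; apply: rkhs_ext => x.
apply: (@normR_eq0 _ C); apply/eqP; rewrite eq_le normR_ge0 andbT.
by apply: le_trans (rkhs_eval_le _ _) _; rewrite f0 mul0r.
Qed.

HB.instance Definition _ := Lmodule_isNormed.Build C (rkhs K)
  ler_rkhs_normD rkhs_normZ rkhs_norm0_eq0.

(** The limit is pointwise, evaluations being bounded by [rkhs_eval_le]. For each formal sum the
    Cauchy estimate survives the limit, so convergence also holds in the dual norm and the limit is
    again approximated by kernel sections. *)
Lemma rkhs_complete (F : set_system (rkhs K)) :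
  ProperFilter F -> cauchy F -> cvg F.
Proof.
move=> FF /cauchy_normR cF.
pose ev x : rkhs K -> C := fun f => f x.
have /choice[h hh] x : exists z : C, ev x @ F --> z.
  suff /CC_complete/cvg_ex[z hz] : cauchy (ev x @ F) by exists z.
  apply/cauchy_normR => e e0.
  have n0 : 0 < knorm K [:: (1, x)] + 1 by have := knorm_ge0 K [:: (1, x)]; lra.
  have [A FA hA] := cF (e / (knorm K [:: (1, x)] + 1)) (divr_gt0 e0 n0).
  have FevA : F (ev x @^-1` (ev x @` A)) by apply: filterS FA => f Af; exists f.
  exists (ev x @` A) => //.
  move=> _ _ [f Af <-] [g Ag <-].
  apply: (@le_lt_trans _ _ (normR (f - g) * knorm K [:: (1, x)])).
    exact: (rkhs_eval_le (f - g)).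
  have := hA _ _ Af Ag; rewrite ltr_pdivlMr//; apply: le_lt_trans.
  by rewrite ler_wpM2l ?normR_ge0// lerDl.
have ht t : (fun f : rkhs K => fsum_eval f t) @ F --> fsum_eval h t.
  rewrite /fsum_eval; elim: t => [|p t ih].
    by rewrite big_nil; under eq_fun do rewrite big_nil; exact: cvg_cst.
  rewrite big_cons; under eq_fun do rewrite big_cons.
  have h1 : (fun f : rkhs K => (p.1)^*) @ F --> (p.1)^* by exact: cvg_cst.
  exact: (cvgD (cvgM h1 (hh p.2)) ih).
have key e A : 0 < e -> (forall f g, A f -> A g -> normR (f - g) < e) -> F A ->
    forall f, A f -> kbounded K (rkhs_val f - h) e.
  move=> e0 hA FA f Af t; apply/ler_addgt0Pr => d d0.
  have /nearP_normR/(_ _ d0) := ht t => hd.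
  have [g [Ag hg]] := filter_ex (filterI FA hd).
  have -> : fsum_eval (rkhs_val f - h) t =
      fsum_eval (rkhs_val (f - g)) t - (fsum_eval h t - fsum_eval g t).
    by rewrite rkhs_valB !fsum_evalB opprB addrA subrK.
  apply: le_trans (normRB _ _) _; apply: lerD; last exact: ltW.
  apply: le_trans (rkhs_kbounded _ _) _; rewrite ler_wpM2r ?knorm_ge0//.
  by apply: ltW; exact: hA.
have hH : rkhs_set K h.
  move=> e e0; have e2 : 0 < e / 2 by rewrite divr_gt0.
  have [A FA hA] := cF _ e2; have [f Af] := filter_ex FA.
  have [s hs] := rkhsP f e2; exists s.
  have -> : h - ksec K s = - (rkhs_val f - h) + (rkhs_val f - ksec K s).
    by rewrite opprB addrA subrK.
  rewrite (splitr e); apply: kboundedD => //; apply: kboundedN.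
  exact: key FA _ Af.
pose h' : rkhs K := Rkhs (asboolT hH).
suff : F --> h' by apply: cvgP.
apply/(@nearP_normR _ _ _ F _ id) => e e0.
have e2 : 0 < e / 2 by rewrite divr_gt0.
have [A FA hA] := cF _ e2.
apply: (filterS _ FA) => f Af; apply: (@le_lt_trans _ _ (e / 2)); last lra.
rewrite -normRN opprB; apply: kdual_le; first exact: ltW.
exact: key FA _ Af.
Qed.

HB.instance Definition _ := Uniform_isComplete.Build (rkhs K) rkhs_complete.

End rkhs_norm.

(** The standard way below to prove that a norm vanishes; the clause e <= 1 allows terms in e^2 to
    be absorbed. *)
Lemma le_mul_small (R : realType) (a c : R) : 0 <= c ->
  (forall e, 0 < e -> e <= 1 -> a <= e * c) -> a <= 0.
Proof.
move=> c0 h; rewrite leNgt; apply/negP => a0.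
have c1 : 0 < c + 1 by lra.
have := h (Num.min 1 (a / 2 / (c + 1))).
rewrite lt_min ltr01 !divr_gt0// ge_min lexx => /(_ isT isT).
apply/negP; rewrite -ltNge.
apply: (@le_lt_trans _ _ (a / 2 / (c + 1) * (c + 1))).
  apply: ler_pM => //; last lra.
    by rewrite le_min ler01 ltW// !divr_gt0.
  by rewrite ge_min lexx orbT.
by rewrite divfK ?gt_eqF//; lra.
Qed.

Section rkhs_dot.
Variables (R : realType) (X : Type) (K : psdKernel R X).
Local Notation C := (CC R).
Implicit Types (f g h : rkhs K) (s t : seq (C * X)) (e : R).

Definition rkhs_sec s : rkhs K := Rkhs (asboolT (@rkhs_ksec R X K s)).

Lemma rkhs_sec_cat s t : rkhs_sec (s ++ t) = rkhs_sec s + rkhs_sec t.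
Proof. by apply: val_inj; exact: ksec_cat. Qed.

Lemma rkhs_sec_scale c s : rkhs_sec (fsum_scale c s) = c *: rkhs_sec s.
Proof. by apply: val_inj; exact: ksec_scale. Qed.

Lemma normR_rkhs_sec s : normR (rkhs_sec s) = knorm K s.
Proof. exact: kdual_ksec. Qed.

Lemma rkhs_dense f e : 0 < e -> exists s, normR (f - rkhs_sec s) <= e.
Proof.
move=> e0; have [s hs] := rkhsP f e0; exists s; apply: kdual_le => //.
exact: ltW.
Qed.

Lemma normR_fsum_eval f t : normR (fsum_eval f t) <= normR f * knorm K t.
Proof. exact: rkhs_kbounded. Qed.

Lemma knorm_sub s t : knorm K (s ++ fsum_scale (-1) t) =
  normR (rkhs_sec s - rkhs_sec t).
Proof.
by rewrite -normR_rkhs_sec rkhs_sec_cat rkhs_sec_scale scaleN1r.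
Qed.

Definition rkhs_app g n : seq (C * X) :=
  projT1 (cid (rkhs_dense g (ltac:(by rewrite invr_gt0 ltr0n) : 0 < n.+1%:R^-1))).

Lemma rkhs_appP g n : normR (g - rkhs_sec (rkhs_app g n)) <= n.+1%:R^-1.
Proof. by rewrite /rkhs_app; case: cid. Qed.

(** Only g is approximated while f is evaluated exactly, so linearity in f is immediate; symmetry
    and the norm identity follow by approximating both arguments and comparing with [kform]. *)
Definition rkhs_dot f g : C := lim ((fun n => fsum_eval f (rkhs_app g n)) @ \oo).

Lemma fsum_eval_dist f s t :
  normR (fsum_eval f s - fsum_eval f t) <=
  normR f * normR (rkhs_sec s - rkhs_sec t).
Proof. by rewrite -fsum_eval_sub -knorm_sub; exact: normR_fsum_eval. Qed.

Lemma rkhs_app_dist f g t n :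
  normR (fsum_eval f (rkhs_app g n) - fsum_eval f t) <=
  normR f * (n.+1%:R^-1 + normR (g - rkhs_sec t)).
Proof.
apply: le_trans (fsum_eval_dist _ _ _) _; rewrite ler_wpM2l ?normR_ge0//.
rewrite -(subrK g (rkhs_sec (rkhs_app g n))) -addrA.
apply: le_trans (normRD _ _) _; rewrite lerD2r -normRN opprB.
exact: rkhs_appP.
Qed.

Lemma near_invn_lt e : 0 < e -> \forall n \near \oo, n.+1%:R^-1 < e.
Proof.
move=> e0; have /cvgrPdist_lt/(_ _ e0) := @cvg_harmonic R.
by apply: filterS => n; rewrite sub0r normrN (ger0_norm (harmonic_ge0 _)).
Qed.

Lemma rkhs_dot_cvg f g : (fun n => fsum_eval f (rkhs_app g n)) @ \oo --> rkhs_dot f g.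
Proof.
apply: CC_complete.
apply/cauchy_normR => e e0.
pose e' := e / 4 / (normR f + 1).
have f1 : 0 < normR f + 1 by have := normR_ge0 f; lra.
have e'0 : 0 < e' by rewrite !divr_gt0.
have [N _ hN] := near_invn_lt e'0.
exists [set fsum_eval f (rkhs_app g n) | n in [set n | (N <= n)%N]].
  by exists N => // n /= Nn; exists n.
move=> _ _ [n /= Nn <-] [m /= Nm <-].
apply: le_lt_trans (rkhs_app_dist _ _ _ _) _.
apply: (@le_lt_trans _ _ (normR f * (e' + e'))).
  rewrite ler_wpM2l ?normR_ge0//; apply: lerD; first exact/ltW/hN.
  by apply: le_trans (rkhs_appP g m) _; exact/ltW/hN.
have : normR f * e' <= e / 4.
  by rewrite /e' mulrCA ler_piMr ?divr_ge0 ?ltW// ltr_pdivrMr// mul1r ltrDl.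
lra.
Qed.

Lemma rkhs_dot_approx f g t :
  normR (rkhs_dot f g - fsum_eval f t) <= normR f * normR (g - rkhs_sec t).
Proof.
suff h e : 0 < e -> e <= 1 -> normR (rkhs_dot f g - fsum_eval f t) -
    normR f * normR (g - rkhs_sec t) <= e * (normR f + 1).
  rewrite -subr_le0; apply: le_mul_small h.
  by rewrite addr_ge0 ?normR_ge0.
move=> e0 _.
have /nearP_normR/(_ _ e0) h1 := @rkhs_dot_cvg f g.
have [n [hn1 hn2]] := filter_ex (filterI h1 (near_invn_lt e0)).
rewrite lerBlDl -(subrK (fsum_eval f (rkhs_app g n)) (rkhs_dot f g)) -addrA.
apply: le_trans (normRD _ _) _.
have h3 := rkhs_app_dist f g t n.
apply: le_trans (lerD (ltW hn1) h3) _; move: n.+1%:R^-1 hn2 {h3} => i hn2.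
have : normR f * i <= normR f * e by rewrite ler_wpM2l ?normR_ge0// ltW.
lra.
Qed.

Lemma rkhs_dot_kform f g s t e : 0 <= e -> normR (f - rkhs_sec s) <= e ->
  normR (g - rkhs_sec t) <= e ->
  normR (rkhs_dot f g - kform K s t) <= e * (normR f + normR g + e).
Proof.
move=> e0 hs ht.
rewrite -(subrK (fsum_eval f t) (rkhs_dot f g)) -addrA.
apply: le_trans (normRD _ _) _.
rewrite -addrA mulrDr; apply: lerD.
  apply: le_trans (rkhs_dot_approx _ _ _) _; rewrite mulrC.
  by rewrite ler_wpM2r ?normR_ge0.
have -> : fsum_eval f t - kform K s t = fsum_eval (f - rkhs_sec s) t.
  by rewrite rkhs_valB fsum_evalB.
apply: le_trans (normR_fsum_eval _ _) _.
apply: ler_pM; rewrite ?normR_ge0 ?knorm_ge0//.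
rewrite -normR_rkhs_sec -[rkhs_sec t](subKr g).
by apply: le_trans (normRB _ _) _; rewrite lerD2l.
Qed.

Lemma rkhs_dot_linear c f g h :
  rkhs_dot (c *: f + g) h = c * rkhs_dot f h + rkhs_dot g h.
Proof.
apply: cvg_lim; first exact: norm_hausdorff.
under eq_fun do rewrite rkhs_valD rkhs_valZ fsum_eval_linear.
apply: cvgD; last exact: rkhs_dot_cvg.
by apply: cvgM; [exact: cvg_cst|exact: rkhs_dot_cvg].
Qed.

Lemma rkhs_dotC f g : rkhs_dot g f = (rkhs_dot f g)^*.
Proof.
apply/eqP; rewrite -subr_eq0; apply/eqP/normR_eq0/eqP.
rewrite eq_le normR_ge0 andbT.
apply: (@le_mul_small _ _ (2 * (normR f + normR g + 1))) => [|e e0 e1].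
  by rewrite mulr_ge0// !addr_ge0 ?normR_ge0.
have [s hs] := rkhs_dense f e0; have [t ht] := rkhs_dense g e0.
have h1 := rkhs_dot_kform (ltW e0) hs ht.
have h2 := rkhs_dot_kform (ltW e0) ht hs.
have -> : rkhs_dot g f - (rkhs_dot f g)^* =
  (rkhs_dot g f - kform K t s) - (rkhs_dot f g - kform K s t)^*.
  by rewrite rmorphB/= -kformC opprB addrA subrK.
apply: le_trans (normRB _ _) _; rewrite normRJ.
apply: le_trans (lerD h2 h1) _.
have := normR_ge0 f; have := normR_ge0 g; nra.
Qed.

Lemma rkhs_dot_norm f : rkhs_dot f f = `|f| ^+ 2.
Proof.
rewrite normRE expr2 -RtoCM -expr2.
apply/eqP; rewrite -subr_eq0; apply/eqP/normR_eq0/eqP.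
rewrite eq_le normR_ge0 andbT.
apply: (@le_mul_small _ _ (4 * (normR f + 1))) => [|e e0 e1].
  by rewrite mulr_ge0// !addr_ge0 ?normR_ge0.
have [s hs] := rkhs_dense f e0.
have h1 := rkhs_dot_kform (ltW e0) hs hs.
rewrite -(subrK (kform K s s) (rkhs_dot f f)) -addrA.
apply: le_trans (normRD _ _) _; rewrite kform_norm -raddfB normR_RtoC.
have h2 := normR_dist f (rkhs_sec s).
have h3 := le_trans h2 hs; rewrite normR_rkhs_sec in h3.
have n0 := normR_ge0 f.
have h4 : `|knorm K s ^+ 2 - normR f ^+ 2| <= e * (2 * normR f + e).
  rewrite subr_sqr normrM distrC ler_pM ?normr_ge0//.
  rewrite ger0_norm ?addr_ge0 ?knorm_ge0//.
  by move: h3; rewrite ler_norml; lra.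
rewrite kform_norm in h1; apply: le_trans (lerD h1 h4) _; nra.
Qed.

Definition rkhs_hilbert : hilbertSpace R :=
  @HilbertSpace R (rkhs K) rkhs_dot rkhs_dot_linear rkhs_dotC rkhs_dot_norm.

Lemma rkhs_dot_sec s t : rkhs_dot (rkhs_sec s) (rkhs_sec t) = kform K s t.
Proof.
apply/eqP; rewrite -subr_eq0; apply/eqP/normR_eq0/eqP.
rewrite eq_le normR_ge0 andbT.
apply: le_trans (rkhs_dot_approx _ _ _) _.
by rewrite subrr normR0 mulr0.
Qed.

Lemma rkhs_dot_secr f t : rkhs_dot f (rkhs_sec t) = fsum_eval f t.
Proof.
apply/eqP; rewrite -subr_eq0; apply/eqP/normR_eq0/eqP.
rewrite eq_le normR_ge0 andbT.
apply: le_trans (rkhs_dot_approx _ _ _) _.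
by rewrite subrr normR0 mulr0.
Qed.

End rkhs_dot.

Section hilbert.
Variables (R : realType) (H : hilbertSpace R).
Implicit Types (x y z : H) (c : CC R).

Lemma hs_dotDl x y z : hs_dot (x + y) z = hs_dot x z + hs_dot y z.
Proof. by rewrite -{1}[x]scale1r hs_dot_linear mul1r. Qed.

Lemma hs_dot0l z : hs_dot 0 z = 0.
Proof. by apply: (addrI (hs_dot 0 z)); rewrite -hs_dotDl !addr0. Qed.

Lemma hs_dotZl c x z : hs_dot (c *: x) z = c * hs_dot x z.
Proof. by rewrite -[c *: x]addr0 hs_dot_linear hs_dot0l addr0. Qed.

Lemma hs_dotNl x z : hs_dot (- x) z = - hs_dot x z.
Proof. by rewrite -scaleN1r hs_dotZl mulN1r. Qed.

Lemma hs_dotBl x y z : hs_dot (x - y) z = hs_dot x z - hs_dot y z.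
Proof. by rewrite hs_dotDl hs_dotNl. Qed.

Lemma hs_dotDr x y z : hs_dot z (x + y) = hs_dot z x + hs_dot z y.
Proof. by rewrite hs_dotC hs_dotDl rmorphD /= -!hs_dotC. Qed.

Lemma hs_dot0r z : hs_dot z 0 = 0.
Proof. by rewrite hs_dotC hs_dot0l rmorph0. Qed.

Lemma hs_dotZr c x z : hs_dot z (c *: x) = c^* * hs_dot z x.
Proof. by rewrite hs_dotC hs_dotZl rmorphM /= -hs_dotC. Qed.

Lemma hs_dotNr x z : hs_dot z (- x) = - hs_dot z x.
Proof. by rewrite -scaleN1r hs_dotZr rmorphN1 mulN1r. Qed.

Lemma hs_dotBr x y z : hs_dot z (x - y) = hs_dot z x - hs_dot z y.
Proof. by rewrite hs_dotDr hs_dotNr. Qed.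

Lemma hs_dot_suml I (s : seq I) (P : pred I) (F : I -> H) z :
  hs_dot (\sum_(i <- s | P i) F i) z = \sum_(i <- s | P i) hs_dot (F i) z.
Proof.
by elim/big_rec2: _ => [|i a b _ <-]; rewrite ?hs_dot0l// hs_dotDl.
Qed.

Lemma hs_dot_sumr I (s : seq I) (P : pred I) (F : I -> H) z :
  hs_dot z (\sum_(i <- s | P i) F i) = \sum_(i <- s | P i) hs_dot z (F i).
Proof.
by elim/big_rec2: _ => [|i a b _ <-]; rewrite ?hs_dot0r// hs_dotDr.
Qed.

Lemma hs_dot_normR x : hs_dot x x = RtoC (normR x ^+ 2).
Proof. by rewrite hs_dot_norm normRE !expr2 RtoCM. Qed.

Lemma normR_hs_dot x : normR (hs_dot x x) = normR x ^+ 2.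
Proof. by rewrite hs_dot_normR normR_RtoC ger0_norm ?sqr_ge0. Qed.

Lemma hs_CS x y : normR (hs_dot x y) <= normR x * normR y.
Proof.
rewrite -(@ler_pXn2r _ 2)// ?nnegrE ?mulr_ge0 ?normR_ge0//.
rewrite exprMn; apply: discriminant_le; rewrite ?sqr_ge0// => r.
set z := hs_dot x y; pose c := - RtoC r * z.
have : 0 <= hs_dot (x + c *: y) (x + c *: y).
  by rewrite hs_dot_normR (RtoC_le 0) sqr_ge0.
rewrite !(hs_dotDl, hs_dotDr, hs_dotZl, hs_dotZr) (hs_dotC x y) !hs_dot_normR.
rewrite -/z /c rmorphM rmorphN /=.
have -> : (RtoC r)^* = RtoC r :> CC R by rewrite conj_Creal// complex_real.
have hz := mulCJ z; move: hz; set w := z^*; set m := normR z => hz h.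
rewrite -RtoC_le; apply: le_trans h _; rewrite le_eqVlt; apply/orP; left; apply/eqP.
transitivity (RtoC (normR x ^+ 2) - 2 * RtoC r * (z * w)
    + RtoC r ^+ 2 * (z * w) * RtoC (normR y ^+ 2)); first by ring.
rewrite hz /RtoC !(rmorphM, rmorphB, rmorphD, rmorphXn, rmorph_nat)/=.
by rewrite expr2.
Qed.

Lemma hs_dot_eq0 x : (forall y, hs_dot x y = 0) -> x = 0.
Proof.
move=> /(_ x); rewrite hs_dot_norm => /eqP; rewrite sqrf_eq0 normr_eq0.
by move/eqP.
Qed.

End hilbert.

Lemma rkhs_dotBr (R : realType) X (K : psdKernel R X) (f g h : rkhs K) :
  rkhs_dot h (f - g) = rkhs_dot h f - rkhs_dot h g.
Proof. exact: (@hs_dotBr R (rkhs_hilbert K)). Qed.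

Lemma rkhs_CS (R : realType) X (K : psdKernel R X) (f g : rkhs K) :
  normR (rkhs_dot f g) <= normR f * normR g.
Proof. exact: (@hs_CS R (rkhs_hilbert K)). Qed.

(** * Representations defined by kernels *)

Lemma bernoulli_le (R : realType) (y : R) n : 0 <= y -> 1 + n%:R * y <= (1 + y) ^+ n.
Proof.
move=> y0; elim: n => [|n ih]; first by rewrite mul0r addr0 expr0.
rewrite exprS; apply: le_trans (ler_wpM2l _ ih); last lra.
by have : 0 <= n%:R :> R by []; rewrite -natr1; nra.
Qed.

(** By Bernoulli, (1 + y)^(2^n) >= 1 + 2^n y is unbounded for y > 0. Exponents that are powers of
    two are what iterated Cauchy-Schwarz produces. *)
Lemma bounded_pow_le1 (R : realType) (x M : R) :
  (forall n, x ^+ (2 ^ n) <= M) -> x <= 1.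
Proof.
move=> h; rewrite leNgt; apply/negP => x1.
have y0 : 0 < x - 1 by lra.
pose n := (Num.truncn (M / (x - 1))).+1; have := h n.
apply/negP; rewrite -ltNge -(subrK 1 x) addrC.
apply: lt_le_trans (bernoulli_le (2 ^ n) (ltW y0)).
have n1 : M < n%:R * (x - 1) by rewrite -ltr_pdivrMr//; exact: truncnS_gt.
have n2 : n%:R * (x - 1) <= (2 ^ n)%:R * (x - 1).
  by rewrite ler_wpM2r ?(ltW y0)// ler_nat ltnW// ltn_expl.
by apply: lt_le_trans n1 (le_trans n2 _); rewrite lerDr.
Qed.

Section kernel_representation.
Variables (R : realType) (A : starOps R) (X : Type) (K : psdKernel R X).
Local Notation C := (CC R).
(** [act a x] is the formal sum that pi(a) e_x shall be. Its laws are required only after pairing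
    with the kernel, that is, up to null vectors. [N] is a weight dominating the kernel, for which
    the action has a bound of l^1 type; the Hilbert space bound is deduced from it. *)
Variables (act : A -> X -> seq (C * X)) (N : X -> R).
Hypothesis dom_star : forall a : A,
  so_dom a -> so_dom (so_star a) /\ so_star (so_star a) = a.
Hypothesis dom_linear : forall c (a b : A),
  so_dom a -> so_dom b -> so_dom (c *: a + b).
Hypothesis dom_mul : forall a b : A, so_dom a -> so_dom b -> so_dom (so_mul a b).
Hypothesis act_adj : forall (a : A) x y, so_dom a ->
  ksec K (act a x) y = fsum_eval (K x) (act (so_star a) y).
Hypothesis act_linear : forall c (a b : A) x y, so_dom a -> so_dom b ->
  fsum_eval (K x) (act (so_star (c *: a + b)) y) =
  c * fsum_eval (K x) (act (so_star a) y) + fsum_eval (K x) (act (so_star b) y).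
Hypothesis act_mul : forall (a b : A) x y, so_dom a -> so_dom b ->
  fsum_eval (K x) (act (so_star (so_mul a b)) y) =
  fsum_eval (fun z => fsum_eval (K x) (act (so_star b) z)) (act (so_star a) y).
Hypothesis N_ge0 : forall x, 0 <= N x.
Hypothesis K_le : forall x y, normR (K x y) <= N x * N y.
Hypothesis act_bounded : forall a : A, so_dom a -> exists2 B : R, 0 <= B &
  forall x, \sum_(p <- act a x) normR p.1 * N p.2 <= B * N x.
Implicit Types (s t : seq (C * X)) (F : X -> C).

Definition fsum_act (a : A) s : seq (C * X) :=
  flatten [seq fsum_scale p.1 (act a p.2) | p <- s].

Lemma fsum_act_cons a p s :
  fsum_act a (p :: s) = fsum_scale p.1 (act a p.2) ++ fsum_act a s.
Proof. by []. Qed.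

(** Forced by <pi(a) F, e_y> = <F, pi(a') e_y>, where a' is the adjoint of a. *)
Definition fun_act (a : A) F : X -> C :=
  fun y => fsum_eval F (act (so_star a) y).

Lemma fun_act_linear a c F G :
  fun_act a (c *: F + G) = c *: fun_act a F + fun_act a G.
Proof. by apply/funext => y; rewrite /fun_act fsum_eval_linear. Qed.

Lemma fsum_eval_act a F t :
  fsum_eval (fun_act a F) t = fsum_eval F (fsum_act (so_star a) t).
Proof.
elim: t => [|p t ih]; first by rewrite !fsum_eval_nil.
by rewrite fsum_act_cons fsum_eval_cat fsum_eval_cons fsum_eval_scale ih.
Qed.

Lemma ksec_cons p s : ksec K (p :: s) = p.1 *: K p.2 + ksec K s.
Proof. by apply/funext => y; rewrite /ksec big_cons. Qed.

Lemma fun_act_ksec a s : so_dom a ->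
  fun_act a (ksec K s) = ksec K (fsum_act a s).
Proof.
move=> ha; elim: s => [|p s ih].
  by apply/funext => y; rewrite /fun_act ksec_nil fsum_eval0.
rewrite fsum_act_cons ksec_cat ksec_scale ksec_cons fun_act_linear ih.
by congr (_ *: _ + _); apply/funext => y; rewrite act_adj.
Qed.

Lemma kform_act a s t : so_dom a ->
  kform K (fsum_act a s) t = kform K s (fsum_act (so_star a) t).
Proof. by move=> ha; rewrite /kform -fun_act_ksec// fsum_eval_act. Qed.

Definition fsum_mass s : R := \sum_(p <- s) normR p.1 * N p.2.

Lemma fsum_mass_cat s t : fsum_mass (s ++ t) = fsum_mass s + fsum_mass t.
Proof. exact: big_cat. Qed.

Lemma fsum_mass_scale c s : fsum_mass (fsum_scale c s) = normR c * fsum_mass s.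
Proof.
rewrite /fsum_mass big_map mulr_sumr; apply: eq_bigr => p _.
by rewrite normRM mulrA.
Qed.

Lemma fsum_mass_ge0 s : 0 <= fsum_mass s.
Proof. by apply: sumr_ge0 => p _; rewrite mulr_ge0 ?normR_ge0. Qed.

Lemma knorm_le_mass s : knorm K s <= fsum_mass s.
Proof.
rewrite -(@ler_pXn2r _ 2)// ?nnegrE ?knorm_ge0 ?fsum_mass_ge0//.
have -> : knorm K s ^+ 2 = normR (kform K s s).
  by rewrite kform_norm normR_RtoC ger0_norm ?sqr_ge0.
rewrite /kform /fsum_eval; apply: le_trans (normR_sum _ _ _) _.
rewrite expr2 {2}/fsum_mass mulr_sumr; apply: ler_sum => q _.
rewrite normRM normRJ mulrCA ler_wpM2l ?normR_ge0// /ksec.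
apply: le_trans (normR_sum _ _ _) _; rewrite /fsum_mass mulr_suml.
apply: ler_sum => p _; rewrite normRM -mulrA ler_wpM2l ?normR_ge0//.
Qed.

Lemma fsum_mass_act a : so_dom a -> exists2 B : R, 0 <= B &
  forall s, fsum_mass (fsum_act a s) <= B * fsum_mass s.
Proof.
move=> /act_bounded[B B0 hB]; exists B => //; elim=> [|p s ih].
  by rewrite /fsum_mass big_nil mulr0.
rewrite fsum_act_cons fsum_mass_cat fsum_mass_scale {3}/fsum_mass big_cons.
rewrite mulrDr; apply: lerD; last exact: ih.
by rewrite mulrCA ler_wpM2l ?normR_ge0//; exact: hB.
Qed.

(* Iterated Cauchy-Schwarz: T = a^* a is symmetric, so that |T s|^(2^n) is at
   most |T^(2^n) s| |s|^(2^n - 1), while |T^m s| is at most B^m times the mass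
   of s. *)
Lemma fsum_act_bounded a : so_dom a -> exists2 B : R, 0 <= B &
  forall s, knorm K (fsum_act a s) <= B * knorm K s.
Proof.
move=> ha; have [ha' aK] := dom_star ha.
have [B1 B10 h1] := fsum_mass_act ha; have [B2 B20 h2] := fsum_mass_act ha'.
pose T s := fsum_act (so_star a) (fsum_act a s).
(* The summand 1 gives B > 0 and, in the last lines, B <= B^2, so that the bound B for T serves as a
   bound for a as well. *)
pose B := B1 * B2 + 1.
have B0 : 0 < B by rewrite ltr_wpDl// mulr_ge0.
have Tsym s t : kform K (T s) t = kform K s (T t).
  by rewrite /T !kform_act// aK.
have Tmass s : fsum_mass (T s) <= B * fsum_mass s.
  apply: le_trans (h2 _) _; apply: le_trans (ler_wpM2l B20 (h1 _)) _.
  by rewrite mulrA ler_wpM2r ?fsum_mass_ge0// mulrC lerDl.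
have Tmassn n s : fsum_mass (iter n T s) <= B ^+ n * fsum_mass s.
  elim: n => [|n ih]; first by rewrite expr0 mul1r.
  apply: le_trans (Tmass _) _; rewrite exprS -mulrA.
  by rewrite ler_wpM2l// ltW.
have Tsymn n s t : kform K (iter n T s) t = kform K s (iter n T t).
  by elim: n s t => [|n ih] s t //; rewrite iterSr ih Tsym -iterS.
have Tsq n s : knorm K (iter n T s) ^+ 2 <= knorm K (iter (n + n) T s) * knorm K s.
  have -> : knorm K (iter n T s) ^+ 2 = normR (kform K (iter n T s) (iter n T s)).
    by rewrite kform_norm normR_RtoC ger0_norm ?sqr_ge0.
  by rewrite -Tsymn -iterD; exact: kform_CS.
have key s : knorm K (T s) <= B * knorm K s.
  have [s0|s0] := ltP 0 (knorm K s); last first.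
    have s1 : knorm K s = 0 by apply/eqP; rewrite eq_le s0 knorm_ge0.
    have := Tsq 1%N s; rewrite s1 !mulr0 => h.
    by rewrite -(@ler_pXn2r _ 2)// ?nnegrE ?knorm_ge0// expr0n.
  pose q n := knorm K (iter (2 ^ n) T s) / knorm K s.
  have hq n : q 0%N ^+ (2 ^ n) <= q n.
    elim: n => [|n ih]; first by rewrite expr1.
    rewrite expnSr exprM; apply: (@le_trans _ _ (q n ^+ 2)).
      by rewrite lerXn2r// nnegrE ?exprn_ge0// divr_ge0 ?knorm_ge0.
    rewrite /q expr_div_n ler_pdivrMr ?exprn_gt0// expr2 mulrA divfK ?gt_eqF//.
    by rewrite expnSr muln2 -addnn; exact: Tsq.
  (* Dividing by B removes the growth B^(2^n) of the mass: the powers of |T s| / (B |s|) stay below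
     mass(s) / |s|. *)
  rewrite -ler_pdivrMr// -[leRHS]mul1r -ler_pdivrMr//.
  apply: (@bounded_pow_le1 _ _ (fsum_mass s / knorm K s)) => n.
  rewrite expr_div_n ler_pdivrMr ?exprn_gt0//.
  apply: le_trans (hq n) _; rewrite /q mulrAC ler_pM2r ?invr_gt0//.
  by apply: le_trans (knorm_le_mass _) _; rewrite mulrC; exact: Tmassn.
exists B; first exact: ltW.
move=> s; rewrite -(@ler_pXn2r _ 2)// ?nnegrE ?mulr_ge0 ?knorm_ge0 ?(ltW B0)//.
have -> : knorm K (fsum_act a s) ^+ 2 = normR (kform K s (T s)).
  rewrite /T -kform_act//.
  by rewrite kform_norm normR_RtoC ger0_norm ?sqr_ge0.
apply: le_trans (kform_CS _ _ _) _.
apply: le_trans (ler_wpM2l (knorm_ge0 _ _) (key s)) _.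
have b1 : 1 <= B by rewrite lerDr mulr_ge0.
rewrite exprMn mulrCA -expr2 ler_wpM2r ?sqr_ge0//.
by rewrite expr2 ler_peMr// ltW.
Qed.

(** The difference of s and t is orthogonal to all kernel sections, its own included, so it is a
    null vector, and elements of the space vanish on null vectors. This is why the laws of [act] are
    needed only against K. *)
Lemma rkhs_eval_ext s t :
  (forall x, fsum_eval (K x) s = fsum_eval (K x) t) ->
  forall f : rkhs K, fsum_eval f s = fsum_eval f t.
Proof.
move=> h f; apply/eqP; rewrite -subr_eq0 -fsum_eval_sub.
set w := s ++ _; suff w0 : knorm K w = 0.
  apply/eqP/normR_eq0/eqP; rewrite eq_le normR_ge0 andbT.
  by apply: le_trans (normR_fsum_eval _ _) _; rewrite w0 mulr0.
have hw u : fsum_eval (ksec K u) w = 0.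
  rewrite /w fsum_eval_sub; apply/eqP; rewrite subr_eq0; apply/eqP.
  elim: u => [|p u ih]; first by rewrite ksec_nil !fsum_eval0.
  by rewrite ksec_cons !fsum_eval_linear h ih.
have : kform K w w = 0 by exact: hw.
rewrite kform_norm => /(@complexI _ _ 0)/eqP.
by rewrite sqrf_eq0 => /eqP.
Qed.

Lemma fun_act_kbounded a B F e : 0 <= e ->
  (forall s, knorm K (fsum_act (so_star a) s) <= B * knorm K s) ->
  kbounded K F e -> kbounded K (fun_act a F) (e * B).
Proof.
move=> e0 hB hF t; rewrite fsum_eval_act.
by apply: le_trans (hF _) _; rewrite -mulrA ler_wpM2l.
Qed.

Lemma fun_actB a F G : fun_act a (F - G) = fun_act a F - fun_act a G.
Proof.
by rewrite -scaleN1r addrC fun_act_linear scaleN1r addrC.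
Qed.

Lemma fun_act_rkhs a (f : rkhs K) : so_dom a -> rkhs_set K (fun_act a f).
Proof.
move=> ha e e0; have [B B0 hB] := fsum_act_bounded (dom_star ha).1.
have B1 : 0 < B + 1 by lra.
have [s hs] := rkhsP f (divr_gt0 e0 B1).
exists (fsum_act a s); rewrite -fun_act_ksec// -fun_actB.
apply: kboundedW (fun_act_kbounded _ hB hs); last by rewrite divr_ge0 ?ltW.
by rewrite mulrAC ler_pdivrMr// ler_wpM2l ?ltW//; lra.
Qed.

Definition rkhs_act (a : A) (f : rkhs K) : rkhs K :=
  match pselect (so_dom a) with
  | left ha => Rkhs (asboolT (@fun_act_rkhs a f ha))
  | right _ => 0
  end.

Lemma rkhs_actE a f : so_dom a -> rkhs_val (rkhs_act a f) = fun_act a f.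
Proof. by move=> ha; rewrite /rkhs_act; case: pselect. Qed.

Lemma rkhs_act_sec a s : so_dom a ->
  rkhs_act a (rkhs_sec K s) = rkhs_sec K (fsum_act a s).
Proof. by move=> ha; apply: val_inj => /=; rewrite rkhs_actE// fun_act_ksec. Qed.

Lemma rkhs_act_linear a : so_dom a -> linear (rkhs_act a).
Proof.
move=> ha c f g; apply: val_inj.
by rewrite /= !rkhs_actE// -fun_act_linear -rkhs_valZ -rkhs_valD.
Qed.

Lemma rkhs_actB a f g : so_dom a ->
  rkhs_act a (f - g) = rkhs_act a f - rkhs_act a g.
Proof.
move=> ha; rewrite -scaleN1r addrC rkhs_act_linear//.
by rewrite scaleN1r addrC.
Qed.

Lemma rkhs_act_bounded a : so_dom a -> exists2 B : R, 0 <= B &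
  forall f, normR (rkhs_act a f) <= B * normR f.
Proof.
move=> ha; have [B B0 hB] := fsum_act_bounded (dom_star ha).1.
exists B => // f; apply: kdual_le; first by rewrite mulr_ge0 ?normR_ge0.
rewrite rkhs_actE// mulrC.
by apply: fun_act_kbounded => //; [exact: normR_ge0|exact: rkhs_kbounded].
Qed.

Lemma rkhs_act_adj a f g : so_dom a ->
  rkhs_dot (rkhs_act a f) g = rkhs_dot f (rkhs_act (so_star a) g).
Proof.
move=> ha; have [ha' aK] := dom_star ha.
have sec t : rkhs_dot (rkhs_act a f) (rkhs_sec K t) =
    rkhs_dot f (rkhs_act (so_star a) (rkhs_sec K t)).
  by rewrite (rkhs_act_sec t ha') !rkhs_dot_secr (rkhs_actE f ha) fsum_eval_act.
have [B B0 hB] := rkhs_act_bounded ha'.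
apply/eqP; rewrite -subr_eq0; apply/eqP/normR_eq0/eqP.
rewrite eq_le normR_ge0 andbT.
apply: (@le_mul_small _ _ (normR (rkhs_act a f) + normR f * B)).
  by rewrite addr_ge0 ?mulr_ge0 ?normR_ge0.
move=> e e0 _; have [t ht] := rkhs_dense g e0.
have -> : rkhs_dot (rkhs_act a f) g - rkhs_dot f (rkhs_act (so_star a) g) =
    rkhs_dot (rkhs_act a f) (g - rkhs_sec K t) -
    rkhs_dot f (rkhs_act (so_star a) (g - rkhs_sec K t)).
  rewrite (rkhs_actB _ _ ha') 2!rkhs_dotBr sec.
  by rewrite opprB addrA subrK.
apply: le_trans (normRB _ _) _; rewrite mulrDr; apply: lerD.
  apply: le_trans (rkhs_CS _ _) _.
  by rewrite mulrC ler_wpM2r ?normR_ge0.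
apply: le_trans (rkhs_CS _ _) _.
rewrite mulrCA ler_wpM2l ?normR_ge0//.
by apply: le_trans (hB _) _; rewrite mulrC ler_wpM2r.
Qed.

Lemma rkhs_act_rep : @is_rep R A (rkhs_hilbert K) rkhs_act.
Proof.
split=> [a ha|c a b f ha hb|a b f ha hb|a f g ha]; last exact: rkhs_act_adj.
- split; first exact: rkhs_act_linear.
  have [B B0 hB] := rkhs_act_bounded ha.
  apply: (@lipschitz_continuous R (rkhs K) (rkhs K) _ B) => [|f g]; first exact: B0.
  by rewrite -(rkhs_actB _ _ ha); exact: hB.
- apply: rkhs_ext => y; rewrite rkhs_actE; last exact: dom_linear.
  rewrite rkhs_valD rkhs_valZ !rkhs_actE//.
  rewrite /fun_act; transitivity (fsum_eval f
      (fsum_scale c^* (act (so_star a) y) ++ act (so_star b) y)).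
    apply: rkhs_eval_ext => x.
    by rewrite fsum_eval_cat fsum_eval_scale conjCK act_linear.
  by rewrite fsum_eval_cat fsum_eval_scale conjCK.
- apply: rkhs_ext => y; rewrite rkhs_actE; last exact: dom_mul.
  rewrite !rkhs_actE// /fun_act.
  have h F : fsum_eval (fun z => fsum_eval F (act (so_star b) z)) (act (so_star a) y)
      = fsum_eval F (fsum_act (so_star b) (act (so_star a) y)).
    exact: fsum_eval_act.
  rewrite h; apply: rkhs_eval_ext => x; rewrite act_mul//; exact: h.
Qed.

Lemma rkhs_secE s :
  rkhs_sec K s = \sum_(p <- s) p.1 *: rkhs_sec K [:: (1, p.2)].
Proof.
elim: s => [|p s ih]; first by rewrite big_nil; apply: val_inj; exact: ksec_nil.
rewrite big_cons -ih -rkhs_sec_scale -rkhs_sec_cat.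
by congr (rkhs_sec K _); case: p => c x; rewrite /fsum_scale /= mulr1.
Qed.

(** The GNS space, the induced and the regular representations are all obtained from this by a
    choice of X, K and [act]. *)
Theorem kernel_rep : exists (H : hilbertSpace R) (pi : A -> H -> H) (e : X -> H),
  [/\ is_rep pi,
      forall x y, hs_dot (e x) (e y) = K x y,
      forall a x, so_dom a -> pi a (e x) = \sum_(p <- act a x) p.1 *: e p.2 &
      forall (xi : H) (d : R), 0 < d ->
        exists s, normR (xi - \sum_(p <- s) p.1 *: e p.2) <= d].
Proof.
exists (rkhs_hilbert K), rkhs_act, (fun x => rkhs_sec K [:: (1, x)]); split.
- exact: rkhs_act_rep.
- move=> x y /=; rewrite rkhs_dot_sec /kform fsum_eval1 /ksec big_seq1.
  by rewrite mul1r.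
- move=> a x ha; rewrite rkhs_act_sec// -rkhs_secE; congr (rkhs_sec K _).
  rewrite /fsum_act /= cats0 /fsum_scale; elim: (act a x) => //= p s ->.
  by rewrite mul1r; case: p.
- by move=> f d d0; have [s hs] := rkhs_dense f d0; exists s; rewrite -rkhs_secE.
Qed.

End kernel_representation.

(** * States and the GNS construction *)

Section cstar.
Variables (R : realType) (A : cstarAlgebra R).
Implicit Types (a b c d : A) (z : CC R).

Lemma cs_mulDl a b d : cs_mul (a + b) d = cs_mul a d + cs_mul b d.
Proof. by rewrite -{1}[a]scale1r cs_mul_linearl scale1r. Qed.
Lemma cs_mulDr a b d : cs_mul d (a + b) = cs_mul d a + cs_mul d b.
Proof. by rewrite -{1}[a]scale1r cs_mul_linearr scale1r. Qed.
Lemma cs_mul0l d : cs_mul 0 d = 0.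
Proof. by apply: (addrI (cs_mul 0 d)); rewrite -cs_mulDl !addr0. Qed.
Lemma cs_mul0r d : cs_mul d 0 = 0.
Proof. by apply: (addrI (cs_mul d 0)); rewrite -cs_mulDr !addr0. Qed.
Lemma cs_mulZl z a d : cs_mul (z *: a) d = z *: cs_mul a d.
Proof. by rewrite -[z *: a]addr0 cs_mul_linearl cs_mul0l addr0. Qed.
Lemma cs_mulZr z a d : cs_mul d (z *: a) = z *: cs_mul d a.
Proof. by rewrite -[z *: a]addr0 cs_mul_linearr cs_mul0r addr0. Qed.
Lemma cs_mulBl a b d : cs_mul (a - b) d = cs_mul a d - cs_mul b d.
Proof. by rewrite cs_mulDl -scaleN1r cs_mulZl scaleN1r. Qed.
Lemma cs_mulBr a b d : cs_mul d (a - b) = cs_mul d a - cs_mul d b.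
Proof. by rewrite cs_mulDr -scaleN1r cs_mulZr scaleN1r. Qed.
Lemma cs_starD a b : cs_star (a + b) = cs_star a + cs_star b.
Proof. by rewrite -{1}[a]scale1r cs_star_antilinear rmorph1 scale1r. Qed.
Lemma cs_star0 : cs_star (0 : A) = 0.
Proof. by apply: (addrI (cs_star (0 : A))); rewrite -cs_starD !addr0. Qed.
Lemma cs_starZ z a : cs_star (z *: a) = z^* *: cs_star a.
Proof. by rewrite -[z *: a]addr0 cs_star_antilinear cs_star0 addr0. Qed.
Lemma cs_starB a b : cs_star (a - b) = cs_star a - cs_star b.
Proof. by rewrite cs_starD -scaleN1r cs_starZ rmorphN1 scaleN1r. Qed.

Lemma normR_mul a b : normR (cs_mul a b) <= normR a * normR b.
Proof. by rewrite -RtoC_le RtoCM -!normRE cs_normM. Qed.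

Lemma normR_starM a : normR (cs_mul (cs_star a) a) = normR a ^+ 2.
Proof.
by apply: complexI; rewrite -/(RtoC _) -normRE cs_normC normRE !expr2 -RtoCM.
Qed.

Let normR_star_le a : normR a <= normR (cs_star a).
Proof.
have := normR_mul (cs_star a) a; rewrite normR_starM expr2.
have [a0 | a0] := ltP 0 (normR a); first by rewrite ler_pM2r.
by move=> _; apply: le_trans a0 (normR_ge0 _).
Qed.

Lemma normR_star a : normR (cs_star a) = normR a.
Proof.
apply/eqP; rewrite eq_le normR_star_le andbT.
by rewrite -{2}(cs_starK a) normR_star_le.
Qed.

Section states.
Variables (phi : A -> CC R) (phi_state : is_state phi).

Lemma stateD a b : phi (a + b) = phi a + phi b.
Proof. by rewrite -{1}[a]scale1r (state_linear phi_state) mul1r. Qed.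
Lemma state0 : phi 0 = 0.
Proof. by apply: (addrI (phi 0)); rewrite -stateD !addr0. Qed.
Lemma stateZ z a : phi (z *: a) = z * phi a.
Proof. by rewrite -[z *: a]addr0 (state_linear phi_state) state0 addr0. Qed.
Lemma stateB a b : phi (a - b) = phi a - phi b.
Proof. by rewrite stateD -scaleN1r stateZ mulN1r. Qed.

Lemma state_le a : normR (phi a) <= normR a.
Proof.
have key b : normR b <= 1 -> normR (phi b) <= 1.
  move=> b1; rewrite -lee_fin -(state_norm phi_state).
  by apply: ereal_sup_ubound; exists b.
have [a0|a0] := ltP 0 (normR a); last first.
  have -> : a = 0 by apply/normR_eq0/eqP; rewrite eq_le a0 normR_ge0.
  by rewrite state0 !normR0.
have aV : normR (RtoC (normR a)^-1) = (normR a)^-1.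
  by rewrite normR_RtoC ger0_norm// invr_ge0 ltW.
have := key (RtoC (normR a)^-1 *: a); rewrite stateZ normRZ normRM aV.
rewrite mulVf ?gt_eqF// => /(_ (lexx _)).
by rewrite mulrC ler_pdivrMr// mul1r.
Qed.

(** Positivity at a + c b makes c w + conj(c) z real for every c, and c = 1 and c = i give the
    claim. Products are used because A need not have a unit. *)
Lemma state_starM a b :
  phi (cs_mul (cs_star a) b) = (phi (cs_mul (cs_star b) a))^*.
Proof.
set w := phi _; set z := phi _.
have h (c : CC R) : complex.Im (c * w + c^* * z) = 0.
  have := state_pos phi_state (a + c *: b).
  rewrite cs_starD cs_starZ !(cs_mulDl, cs_mulDr, cs_mulZl, cs_mulZr).
  rewrite !(stateD, stateZ) -/w -/z mulrA ?(mulrC (c^*) c) mulCJ.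
  have /RtoC_Re <- := state_pos phi_state a.
  have /RtoC_Re <- := state_pos phi_state b.
  rewrite -RtoCM => /ger0_Im; rewrite !ImD /=; lra.
have := h 1; have := h (Complex 0 1); rewrite conjC1 !mul1r.
have -> : (Complex 0 1 : CC R)^* = Complex 0 (-1) by [].
case: (w) (z) => [u v] [u' v'] /=; rewrite !mul0r !mul1r => h1 h2.
have -> : (Complex u' v' : CC R)^* = Complex u' (- v') by [].
by congr Complex; move: h1 h2; rewrite /=; lra.
Qed.

Lemma state_psd s : 0 <= \sum_(q <- s) (q.1)^* *
  \sum_(p <- s) p.1 * phi (cs_mul (cs_star q.2) p.2).
Proof.
have : 0 <= phi (cs_mul (cs_star (\sum_(q <- s) q.1 *: q.2)) (\sum_(p <- s) p.1 *: p.2)).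
  exact: state_pos.
have hr (d : A) t : phi (cs_mul d (\sum_(p <- t) p.1 *: p.2)) =
    \sum_(p <- t) p.1 * phi (cs_mul d p.2).
  elim: t => [|p t ih]; first by rewrite !big_nil cs_mul0r state0.
  by rewrite !big_cons cs_mulDr cs_mulZr stateD stateZ ih.
have hl (d : A) t : phi (cs_mul (cs_star (\sum_(q <- t) q.1 *: q.2)) d) =
    \sum_(q <- t) (q.1)^* * phi (cs_mul (cs_star q.2) d).
  elim: t => [|p t ih]; first by rewrite !big_nil cs_star0 cs_mul0l state0.
  by rewrite !big_cons cs_starD cs_starZ cs_mulDl cs_mulZl stateD stateZ ih.
by rewrite hl; under eq_bigr do rewrite hr.
Qed.

Definition state_kernel : psdKernel R A :=
  @PsdKernel R A (fun a b => phi (cs_mul (cs_star b) a))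
    (fun a b => state_starM a b) state_psd.

(** The kernel is phi(b^* a), the action is left multiplication and the weight is the norm of A.
    Without a unit there is a vector for each element of A instead of a cyclic one. *)
Theorem gns : exists (H : hilbertSpace R) (pi : A -> H -> H) (e : A -> H),
  [/\ @is_rep R (cstar_ops A) H pi,
      forall a b, hs_dot (e a) (e b) = phi (cs_mul (cs_star b) a),
      forall a b, pi a (e b) = e (cs_mul a b) &
      forall (xi : H) (d : R), 0 < d ->
        exists s, normR (xi - \sum_(p <- s) p.1 *: e p.2) <= d].
Proof.
have [|||||||||H [pi [e [h1 h2 h3 h4]]]] := @kernel_rep R (cstar_ops A) A state_kernel
    (fun a b => [:: (1, cs_mul a b)]) (@normR R A); last first.
- exists H, pi, e; split; [exact: h1|exact: h2| |exact: h4].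
  by move=> a b; rewrite h3// big_seq1 /= scale1r.
- move=> a _; exists (normR a); rewrite ?normR_ge0// => x.
  by rewrite big_seq1 /= normR1 mul1r; exact: normR_mul.
- move=> x y; apply: le_trans (state_le _) _; apply: le_trans (normR_mul _ _) _.
  by rewrite normR_star mulrC.
- exact: normR_ge0.
- move=> a b x y _ _; rewrite !fsum_eval1 /=.
  by rewrite (cs_starM a b) cs_mulA.
- move=> c a b x y _ _; rewrite !fsum_eval1 /=.
  rewrite cs_star_antilinear cs_mul_linearl.
  by rewrite cs_star_antilinear conjCK cs_mul_linearl stateD stateZ.
- move=> a x y _; rewrite fsum_eval1 /ksec big_seq1 /= mul1r.
  by rewrite cs_starM cs_starK cs_mulA.
- by [].
- by [].
- by move=> a _; split => //; exact: cs_starK.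
Qed.

End states.
End cstar.

(** * Etale groupoids *)

Section groupoid_algebra.
Variable G : etaleGroupoid.
Implicit Types (g h k : G).

Lemma eg_invK g : g^-1_G^-1_G = g. Proof. exact: ginvK. Qed.

Lemma rng_inv g : rng g^-1_G = src g.
Proof. by rewrite /rng /grng ginvK. Qed.

Lemma src_inv g : src g^-1_G = rng g.
Proof. by rewrite /src /gsrc ginvK. Qed.

Lemma srcM g h : src g = rng h -> src (g *_G h) = src h.
Proof. exact: gsrcM. Qed.

Lemma rngM g h : src g = rng h -> rng (g *_G h) = rng g.
Proof. exact: grngM. Qed.

Lemma eg_mulA g h k : src g = rng h -> src h = rng k ->
  g *_G h *_G k = g *_G (h *_G k).
Proof. exact: gmulA. Qed.

Lemma eg_mul_src g : g *_G src g = g.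
Proof. exact: gmul_src. Qed.

Lemma eg_mul_rng g : rng g *_G g = g.
Proof. exact: gmul_rng. Qed.

Lemma eg_mulV g : g *_G g^-1_G = rng g. Proof. by []. Qed.

Lemma eg_mulVg g : g^-1_G *_G g = src g. Proof. by []. Qed.

Lemma eg_mulKg g h : src g = rng h -> g^-1_G *_G (g *_G h) = h.
Proof.
by move=> gh; rewrite -eg_mulA ?src_inv//; rewrite eg_mulVg gh eg_mul_rng.
Qed.

Lemma eg_mulVKg g h : rng g = rng h -> g *_G (g^-1_G *_G h) = h.
Proof. by move=> gh; rewrite -[X in X *_G _ = _]eg_invK eg_mulKg// src_inv. Qed.

Lemma eg_invM g h : src g = rng h -> (g *_G h)^-1_G = h^-1_G *_G g^-1_G.
Proof.
move=> gh; have c1 : src h^-1_G = rng g^-1_G by rewrite src_inv rng_inv.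
have c2 : src (g *_G h) = rng (h^-1_G *_G g^-1_G).
  by rewrite srcM// rngM// rng_inv.
rewrite -[RHS](eg_mulKg c2) eg_mulA// ?rngM// ?rng_inv//.
rewrite eg_mulVKg; last by rewrite rng_inv.
rewrite eg_mulV -(rngM gh) -src_inv.
by rewrite eg_mul_src.
Qed.

Lemma rng_rng g : rng (rng g) = rng g.
Proof. by rewrite -{1}(eg_mulV g) rngM ?rng_inv. Qed.

Lemma src_rng g : src (rng g) = rng g.
Proof. by rewrite -{1}(eg_mulV g) srcM ?src_inv ?rng_inv. Qed.

Lemma unit_rng (x : unit_space G) : rng x = x :> G.
Proof.
by case: x => x xu; rewrite /unit_val /=; have /set_mem[g _ <-] := xu; exact: rng_rng.
Qed.

Lemma unit_src (x : unit_space G) : src x = x :> G.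
Proof. by rewrite -(unit_rng x) src_rng. Qed.

Lemma inv_unit (x : unit_space G) : (x : G)^-1_G = x.
Proof.
by rewrite -[LHS]eg_mul_rng rng_inv unit_src eg_mulV unit_rng.
Qed.

End groupoid_algebra.

(** * Sets on which the range is injective, and separation *)

Section etale_topology.
Variable G : etaleGroupoid.
Implicit Types (g h k : G) (U V : set G).

Definition runit g : unit_space G := grng_unit (eg_ops G) g.

Lemma val_runit g : runit g = rng g :> G. Proof. by []. Qed.

Lemma unit_valI : injective (@unit_val G).
Proof. exact: val_inj. Qed.

Lemma runit_eq g h : (runit g = runit h) <-> (rng g = rng h).
Proof. by split=> [e|e]; [rewrite -!val_runit e|exact: unit_valI]. Qed.

Lemma runit_continuous : continuous runit.
Proof.
move=> g; have [U [oU Ug _ cU _]] := eg_rng_local_homeo g.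
have := cU; rewrite continuous_open_subspace// => /(_ g).
by rewrite inE => /(_ Ug).
Qed.

Lemma eg_inv_continuous : continuous (fun g : G => g^-1_G).
Proof. exact: eg_inv_cont. Qed.

Lemma mul_cvg T (F : set_system T) {FF : Filter F} (a b : T -> G) g h :
  src g = rng h -> a @ F --> g -> b @ F --> h ->
  (\forall t \near F, src (a t) = rng (b t)) ->
  (fun t => a t *_G b t) @ F --> g *_G h.
Proof.
move=> gh ha hb hab W hW.
have /subspace_continuousP/(_ (g, h) gh W hW) := @eg_mul_cont G.
rewrite nbhs_simpl /= withinE /= => -[S hS SW].
have hp : (fun t => (a t, b t)) @ F --> (nbhs g, nbhs h) by exact: cvg_pair.
have hS' : \forall t \near F, S (a t, b t) by exact: (hp S hS).
suff : \forall t \near F, W (a t *_G b t) by [].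
apply: filterS2 hab hS' => t tab tS.
have : (S `&` [set p : G * G | gsrc (eg_ops G) p.1 = grng (eg_ops G) p.2]) (a t, b t).
  by split.
by rewrite -SW => -[].
Qed.

(** Open sets of this kind form a basis and are Hausdorff even if G is not. The source may fail to
    be injective, so inversion leads out of this class. *)
Definition rsection V := forall g h, V g -> V h -> rng g = rng h -> g = h.

Lemma rsection_nbhs g U : open U -> U g ->
  exists V, [/\ open V, V g, V `<=` U & rsection V].
Proof.
move=> oU Ug; have [W [oW Wg iW _ _]] := eg_rng_local_homeo g.
exists (U `&` W); split; [exact: openI|by []|by move=> h []|].
move=> h k hUW kUW /runit_eq; have [_ Wh] := hUW; have [_ Wk] := kUW.
by apply: iW; exact: mem_set.
Qed.

Lemma runit_open V : open V -> open (runit @` V).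
Proof.
move=> oV; rewrite openE => _ [g Vg <-].
have [W [oW Wg _ _ hW]] := eg_rng_local_homeo g.
have o1 : open (runit @` (V `&` W)) by apply: hW; [exact: openI|move=> h []].
apply: (@filterS _ _ _ (runit @` (V `&` W))).
  by move=> _ [h [Vh _] <-]; exists h.
by apply: open_nbhs_nbhs; split => //; exists g.
Qed.

(** The inverse of the range map of V; [get] supplies a default value at units that are not ranges
    of elements of V. *)
Definition section_of V (y : G) : G := get [set h | V h /\ rng h = y].

Lemma section_ofE V h : rsection V -> V h -> section_of V (rng h) = h.
Proof.
move=> rV Vh; have [] : [set k | V k /\ rng k = rng h] (section_of V (rng h)).
  by apply: getPex; exists h.
by move=> Vk e; exact: rV.
Qed.

Lemma section_of_cvg V h : rsection V -> open V -> V h ->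
  (fun y : unit_space G => section_of V y) @ runit h --> h.
Proof.
move=> rV oV Vh W; rewrite nbhsE => -[W' [oW' W'h W'W]].
have o1 : open (runit @` (V `&` W')) by apply: runit_open; exact: openI.
rewrite nbhs_simpl /=.
apply: (@filterS _ _ _ (runit @` (V `&` W'))).
  move=> _ [k [Vk W'k] <-] /=; rewrite val_runit section_ofE//; exact: W'W.
by apply: open_nbhs_nbhs; split => //; exists h.
Qed.

(** A continuous injection into the Hausdorff unit space separates points. It is applied to the
    range and to the source. *)
Lemma hausdorff_of_injective V (psi : G -> unit_space G) : continuous psi ->
  (forall g h, V g -> V h -> psi g = psi h -> g = h) -> hausdorff_space V.
Proof.
move=> cpsi ipsi p q pq.
have Vp : V (set_val p) by case: p {pq} => p pV; exact: set_mem.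
have Vq : V (set_val q) by case: q {pq} => q qV; exact: set_mem.
suff e : psi (set_val p) = psi (set_val q).
  by apply: val_inj; exact: ipsi.
apply: (@eg_units_hausdorff G) => A B hA hB.
have cp : continuous (fun v : V => psi (set_val v)).
  move=> v; apply: (@continuous_comp _ _ _ (set_val : V -> G) psi).
    exact: initial_continuous.
  exact: cpsi.
have [v [Av Bv]] := pq _ _ (cp p _ hA) (cp q _ hB).
by exists (psi (set_val v)).
Qed.

Lemma rsection_hausdorff V : rsection V -> hausdorff_space V.
Proof.
move=> rV; apply: (hausdorff_of_injective runit_continuous) => g h Vg Vh.
by move=> /runit_eq; exact: rV.
Qed.

(** Compact subsets of G need not be closed, but inside an open Hausdorff U they are relatively
    closed: otherwise the trace on K of the neighbourhoods of u would have a cluster point in K that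
    cannot be separated from u. *)
Lemma near_notin_compact U K u : open U -> hausdorff_space U -> compact K ->
  K `<=` U -> U u -> ~ K u -> \forall v \near u, ~ K v.
Proof.
move=> oU hU cK KU Uu nKu; apply: contrapT => h.
have PF : ProperFilter (within K (nbhs u)).
  apply: Build_ProperFilter_ex => A; rewrite /within /= => hA.
  apply: contrapT => nA; apply: h; apply: filterS hA => v KA Kv.
  by apply: nA; exists v; exact: KA.
have [q [Kq clq]] := cK _ PF (withinT _ _).
have Uq := KU _ Kq.
suff e : SigSub (mem_set Uu) = SigSub (mem_set Uq) :> U.
  by apply: nKu; have := congr1 set_val e; rewrite !set_valE /= => ->.
apply: hU => A B.
move=> [_ [/= [A' oA' <-] A'u /= A'A]] [_ [/= [B' oB' <-] B'q /= B'B]].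
have nA' : nbhs u A' by apply: open_nbhs_nbhs; split.
have nB' : nbhs q (B' `&` U) by apply: open_nbhs_nbhs; split => //; exact: openI.
have [v [A'v [B'v Uv]]] : (A' `&` (B' `&` U)) !=set0.
  have wA' : within K (nbhs u) A' by rewrite /within /=; apply: filterS nA' => v + _.
  exact: clq wA' nB'.
exists (SigSub (mem_set Uv)); split; [exact: A'A|exact: B'B].
Qed.

End etale_topology.

Lemma locally_compact_bump (R : realType) (X : topologicalType) (y : X)
    (O : set X) : locally_compact [set: X] -> hausdorff_space X ->
  open O -> O y -> exists (f : X -> R) (K : set X),
    [/\ continuous f, forall x, 0 <= f x <= 1, \forall x \near y, f x = 1,
        compact K /\ K `<=` O & forall x, ~ K x -> f x = 0].
Proof.
move=> lcX hX oO Oy.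
have [W nW [cW clW]] := lcX y I.
have nWy : nbhs y W by move: nW; rewrite /within /=; apply: filterS => x; exact.
pose B := ~` (O `&` W°).
have clB : closed B by apply: open_closedC; apply: openI => //; exact: open_interior.
have nBy : ~ B y by move=> /=; apply; split => //; exact: nWy.
have := locally_compact_completely_regular (R := R) lcX hX clB nBy.
move=> /(@uniform_separatorP X R)[f [cf f01 fy fB]].
have fy0 : f y = 0 by apply: fy; exists y.
have fB1 x : B x -> f x = 1 by move=> Bx; apply: fB; exists x.
have f0 x : 0 <= f x <= 1 by have := f01 (f x); rewrite /= in_itv /=; apply; exists x.
(* f is 0 at y and 1 off the intersection of O with the interior of W. The cut-off is 1 where f <=
   1/3, hence near y, and 0 where f >= 2/3; the set f <= 2/3 is compact because it is closed and
   lies in W. *)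
pose g x : R := Num.min 1 (Num.max 0 (2 - 3 * f x)).
pose K := [set x | f x <= 2 / 3].
have KO : K `<=` O `&` W°.
  move=> x Kx; apply: contrapT => /fB1 h; move: Kx; rewrite /K /= h; lra.
exists g, K; split.
- move=> x; have c0 (r : R) : {for x, continuous (fun _ : X => r : R^o)} by exact: cvg_cst.
  have c3 : {for x, continuous (fun x => 2 - 3 * f x : R^o)}.
    by apply: cvgB; [exact: c0|apply: cvgM; [exact: c0|exact: cf]].
  exact: (continuous_min (c0 1) (continuous_max (c0 0) c3)).
- by move=> x; rewrite /g le_min ge_min ler01 le_max !lexx.
- have /cvgrPdist_lt/(_ (1/3)) := cf y; rewrite fy0 => /(_ ltac:(lra)).
  apply: filterS => x; rewrite sub0r normrN => h.
  have h' : f x < 1 / 3 by apply: le_lt_trans h; exact: ler_norm.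
  by rewrite /g; apply/min_idPl; rewrite le_max; apply/orP; right; lra.
- split; last by move=> x /KO[].
  apply: (subclosed_compact _ cW); last by move=> x /KO[_] /interior_subset.
  by apply: (@closed_comp _ _ f [set r | r <= 2/3]) => [x _|]; [exact: cf|exact: closed_le].
- move=> x /= /negP; rewrite -ltNge => h; rewrite /g.
  rewrite (max_idPl _); last lra.
  by apply/min_idPr.
Qed.

(** * The algebra of functions of compact support *)

Section Cc_topology.
Variables (R : realType) (G : etaleGroupoid).
Local Notation C := (CC R).
Implicit Types (g h k : G) (U V K : set G) (f e : G -> C).

Lemma RtoC_continuous : continuous (@RtoC R : R -> C).
Proof.
move=> r; apply/nearP_normR => e e0.
have /cvgrPdist_lt/(_ _ e0) : (id : R -> R) @ r --> r by exact: cvg_id.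
by apply: filterS => s; rewrite -raddfB normR_RtoC.
Qed.

Lemma Cc_onE U f : open U -> Cc_on U f <->
  [/\ forall g, U g -> {for g, continuous f}, (forall g, ~ U g -> f g = 0) &
     exists K : set G, [/\ compact K, K `<=` U & forall g, ~ K g -> f g = 0]].
Proof.
move=> oU; rewrite /Cc_on /mkset continuous_open_subspace//.
split=> -[h1 h2 h3]; split=> // g.
  by move=> Ug; apply: h1; exact: mem_set.
by rewrite inE; exact: h1.
Qed.

(** A bump function of the unit space is pulled back along the range, which is a homeomorphism of V
    onto an open set. Extended by zero it is continuous at the points of V; elsewhere it may jump
    because G need not be Hausdorff. *)
Lemma rsection_bump U g : open U -> U g -> exists V K e,
  [/\ open V /\ V `<=` U, rsection V /\ V g, compact K /\ K `<=` V,
      \forall h \near g, e h = 1 &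
      (forall h, V h -> {for h, continuous e}) /\ (forall h, ~ K h -> e h = 0)].
Proof.
move=> oU Ug; have [V [oV Vg VU rV]] := rsection_nbhs oU Ug.
have oO := runit_open oV.
have Oy : (@runit G @` V) (runit g) by exists g.
have [f [L [cf f01 f1 [cL LO] fL]]] :=
  locally_compact_bump R (@eg_units_lc G) (@eg_units_hausdorff G) oO Oy.
pose e h : C := if h \in V then RtoC (f (runit h)) else 0.
have eV h : V h -> \forall k \near h, e k = RtoC (f (runit k)).
  move=> Vh; have : nbhs h V by apply: open_nbhs_nbhs.
  by apply: filterS => k Vk; rewrite /e mem_set.
pose K := (fun y : unit_space G => section_of V y) @` L.
exists V, K, e; split => //.
- split; last first.
    by move=> _ [y Ly <-]; have [h Vh <-] := LO y Ly; rewrite val_runit section_ofE.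
  apply: continuous_compact => //; apply/subspace_continuousP => y Ly.
  have [h Vh hy] := LO y Ly; rewrite -hy [X in _ --> X]section_ofE//.
  apply: cvg_trans (section_of_cvg rV oV Vh).
  by apply: cvg_fmap2; exact: cvg_within.
- have h1 : \forall h \near g, f (runit h) = 1 by exact: (@runit_continuous G g _ f1).
  by apply: filterS2 h1 (eV _ Vg) => h h1 ->; rewrite h1.
- split=> [h Vh|h nKh].
    have eh : e h = RtoC (f (runit h)) by rewrite /e mem_set.
    rewrite /prop_for /continuous_at eh.
    have h2 : {for h, continuous (@RtoC R \o f \o @runit G)}.
      apply: continuous_comp; first exact: runit_continuous.
      by apply: continuous_comp; [exact: cf|exact: RtoC_continuous].
    apply: cvg_trans h2; apply: near_eq_cvg.
    by apply: filterS (eV _ Vh) => k ->.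
  rewrite /e; case: ifPn => // /set_mem Vh; rewrite fL// => Lh.
  by apply: nKh; exists (runit h) => //; rewrite val_runit section_ofE.
Qed.

End Cc_topology.

Section lin_span.
Variables (K : pzRingType) (V : lmodType K).
Implicit Types (S P : set V) (u v : V).

Lemma lin_span_sub S P : P 0 -> (forall c u v, S u -> P v -> P (c *: u + v)) ->
  lin_span S `<=` P.
Proof.
move=> P0 hP _ [n [c [w [Sw ->]]]].
by elim: (index_enum _) => [|i s ih]; rewrite ?big_nil// big_cons; exact: hP.
Qed.

Lemma lin_spanD S u v : lin_span S u -> lin_span S v -> lin_span S (u + v).
Proof.
move=> [n [c [w [Sw ->]]]] [m [d [z [Sz ->]]]].
exists (n + m)%N, (fun i => match fintype.split i with inl j => c j | inr j => d j end),
  (fun i => match fintype.split i with inl j => w j | inr j => z j end).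
split=> [i|]; first by case: fintype.split.
rewrite big_split_ord /=; congr (_ + _); apply: eq_bigr => i _.
  by have := unsplitK (inl i : 'I_n + 'I_m); rewrite /unsplit => ->.
by have := unsplitK (inr i : 'I_n + 'I_m); rewrite /unsplit => ->.
Qed.

Lemma lin_spanZ S a u : lin_span S u -> lin_span S (a *: u).
Proof.
move=> [n [c [w [Sw ->]]]]; exists n, (fun i => a * c i), w; split => //.
by rewrite scaler_sumr; apply: eq_bigr => i _; rewrite scalerA.
Qed.

Lemma lin_span0 S : lin_span S 0.
Proof. by exists 0%N, (fun=> 0), (fun=> 0); split; [case|rewrite big_ord0]. Qed.

Lemma lin_span_incl S u : S u -> lin_span S u.
Proof.
by move=> Su; exists 1%N, (fun=> 1), (fun=> u); split => //; rewrite big_ord1 scale1r.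
Qed.

End lin_span.

(** * Reduction to functions on sections; the involution *)

Section Cc_algebra.
Variables (R : realType) (G : etaleGroupoid).
Local Notation C := (CC R).
Implicit Types (g h k : G) (U V K : set G) (f e : G -> C).

Definition Cc_section : set (G -> C) :=
  [set f | exists V, [/\ open V, rsection V & Cc_on V f]].

Lemma Cc_section_Cc f : Cc_section f -> Cc f.
Proof.
move=> [V [oV rV fV]]; apply: lin_span_incl; exists V; split => //.
exact: rsection_hausdorff.
Qed.

Lemma Cc0 : Cc (0 : G -> C). Proof. exact: lin_span0. Qed.
Lemma CcD f e : Cc f -> Cc e -> Cc (f + e). Proof. exact: lin_spanD. Qed.
Lemma CcZ c f : Cc f -> Cc (c *: f). Proof. exact: lin_spanZ. Qed.

(** A partition of unity, one bump at a time: f = f e_g + f (1 - e_g). The first summand is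
    supported in [V g]. The second vanishes where e_g = 1, so the remaining bumps suffice for it,
    and it is continuous on U by [near_notin_compact]. *)
Let Cc_on_span U (s : seq G) (V K : G -> set G) (e : G -> G -> C) :
  open U -> hausdorff_space U ->
  (forall g, g \in s -> [/\ open (V g) /\ V g `<=` U, rsection (V g),
      compact (K g) /\ K g `<=` V g,
      (forall h, V g h -> {for h, continuous (e g)}) &
      (forall h, ~ K g h -> e g h = 0)]) ->
  forall f, Cc_on U f -> (forall h, f h != 0 -> exists2 g, g \in s & e g h = 1) ->
  lin_span Cc_section f.
Proof.
move=> oU hU; elim: s => [_ f _ f0|g s ih he f fU f1].
  have -> : f = 0.
    by apply/funext => h; apply/eqP; apply: contrapT => /negP/f0[].
  exact: lin_span0.
have [[oV VU] rV [cK KV] ce e0] := he g (mem_head _ _).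
have -> : f = (fun h => f h * e g h) + (fun h => f h * (1 - e g h)).
  apply/funext => h; transitivity (f h * e g h + f h * (1 - e g h)) => //.
  by rewrite -mulrDr addrC subrK mulr1.
have [cf f0 [L [cL LU fL]]] := (Cc_onE f oU).1 fU.
apply: lin_spanD.
  apply: lin_span_incl; exists (V g); split; [exact: oV|exact: rV|].
  apply/(Cc_onE _ oV); split.
  - by move=> h Vh; apply: cvgM; [apply/cf/VU|exact: ce].
  - by move=> h nVh; rewrite e0 ?mulr0// => /KV.
  - by exists (K g); split => // h nKh; rewrite e0 ?mulr0.
apply: ih => [h hs||h].
- by apply: he; rewrite inE hs orbT.
- apply/(Cc_onE _ oU); split.
  + move=> h Uh; apply: cvgM; first exact: cf.
    apply: cvgB; first exact: cvg_cst.
    have [Vh|nVh] := pselect (V g h); first exact: ce.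
    have nKh : ~ K g h by move=> /KV.
    have KU : K g `<=` U by exact: subset_trans VU.
    have hn := near_notin_compact oU hU cK KU Uh nKh.
    rewrite (e0 _ nKh); apply: (@cvg_trans _ ((fun _ => 0 : C) @ h)); last exact: cvg_cst.
    by apply: near_eq_cvg; apply: filterS hn => k /e0 ->.
  + by move=> h nUh; rewrite f0// mul0r.
  + by exists L; split => // h nLh; rewrite fL// mul0r.
- rewrite mulf_eq0 negb_or => /andP[/f1[k ks ek]].
  move: ks; rewrite inE => /orP[/eqP kg|ks _]; last by exists k.
  by rewrite -kg ek subrr eqxx.
Qed.

(** Compactness of the support leaves finitely many bumps. From here on C_c(G) is handled by
    linearity from functions whose support meets each range fibre at most once. *)
Lemma Cc_spanE : @Cc R G = lin_span Cc_section.
Proof.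
apply/seteqP; split; last first.
  apply: lin_span_sub; first exact: Cc0.
  by move=> c u v /Cc_section_Cc hu hv; apply: CcD => //; exact: CcZ.
apply: lin_span_sub; first exact: lin_span0.
move=> c u v [U [oU hU uU]] hv; apply: lin_spanD => //; apply: lin_spanZ.
have /choice[p hp] g : exists p : set G * set G * (G -> C), U g ->
  [/\ open p.1.1 /\ p.1.1 `<=` U, rsection p.1.1,
      compact p.1.2 /\ p.1.2 `<=` p.1.1, \forall h \near g, p.2 h = 1 &
      (forall h, p.1.1 h -> {for h, continuous p.2}) /\
      (forall h, ~ p.1.2 h -> p.2 h = 0)].
  have [Ug|nUg] := pselect (U g); last by exists (set0, set0, fun=> 0).
  have [V [K [e [h1 [h2 _] h3 h4 h5]]]] := rsection_bump R oU Ug.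
  by exists (V, K, e).
have [_ _ [L [cL LU uL]]] := (Cc_onE u oU).1 uU.
have := cL; rewrite compact_cover => /(_ _ L (fun g => [set h | (p g).2 h = 1]°)).
move=> [g _|g Lg|D DL LD].
- exact: open_interior.
- by exists g => //; have [_ _ _ + _] := hp _ (LU _ Lg).
apply: (@Cc_on_span U (finmap.enum_fset D) (fun g => (p g).1.1)
  (fun g => (p g).1.2) (fun g => (p g).2)) => //.
- move=> g gD; have Ug : U g by apply/LU/set_mem/DL.
  by have [h1 h2 h3 h4 [h5 h6]] := hp _ Ug.
- move=> h uh; have Lh : L h by apply: contrapT => /uL; exact/eqP.
  have [g gD /interior_subset gh] := LD _ Lh.
  by exists g.
Qed.

Lemma fstar_linear c f e : fstar (c *: f + e) = c^* *: fstar f + fstar e.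
Proof. by apply/funext => g; rewrite /fstar rmorphD rmorphM. Qed.

Lemma fstarK f : fstar (fstar f) = f.
Proof. by apply/funext => g; rewrite /fstar eg_invK conjCK. Qed.

Lemma conj_continuous : continuous (fun z : C => z^*).
Proof.
apply: (@lipschitz_continuous R C C _ 1) => // x y.
by rewrite -rmorphB normRJ mul1r.
Qed.

Lemma Cc_fstar f : Cc f -> Cc (fstar f).
Proof.
move: f; suff : (@Cc R G) `<=` [set f | Cc (fstar f)] by [].
rewrite {1}Cc_spanE; apply: lin_span_sub => [|c u v [V [oV rV uV]] hv] /=.
  have -> : fstar (0 : G -> C) = 0 by apply/funext => g; rewrite /fstar rmorph0.
  exact: Cc0.
rewrite fstar_linear; apply: CcD => //; apply: CcZ; apply: lin_span_incl.
pose W : set G := (fun g => g^-1_G) @^-1` V.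
have oW : open W by apply: open_comp oV => g _; exact: eg_inv_continuous.
have [cu u0 [L [cL LV uL]]] := (Cc_onE u oV).1 uV.
exists W; split; first exact: oW.
  (* On W, the set of inverses of V, it is the source that is injective, so W is separated by the
     source. *)
  apply: (hausdorff_of_injective (psi := @runit G \o (fun g : G => g^-1_G))).
    by move=> g; apply: continuous_comp; [exact: eg_inv_continuous|exact: runit_continuous].
  by move=> g h Wg Wh /runit_eq /(rV _ _ Wg Wh) /(congr1 (@ginv _ (eg_ops G))); rewrite !ginvK.
apply/(Cc_onE _ oW); split.
- move=> g Wg; apply: (@continuous_comp _ _ _ (u \o (fun g : G => g^-1_G)) (fun z : C => z^*)).
    by apply: continuous_comp; [exact: eg_inv_continuous|exact: cu].
  exact: conj_continuous.
- by move=> g nWg; rewrite /fstar u0// rmorph0.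
- exists ((fun g => g^-1_G) @` L); split.
  + by apply: continuous_compact => //; apply/continuous_subspaceT/eg_inv_continuous.
  + by move=> _ [g Lg <-]; rewrite /W /= ginvK; exact: LV.
  + move=> g nLg; rewrite /fstar uL ?rmorph0// => Lg.
    by apply: nLg; exists g^-1_G => //; rewrite ginvK.
Qed.

End Cc_algebra.

(** * Finiteness and l^1 bounds on the fibres *)

Section fiber_bounds.
Variables (R : realType) (G : etaleGroupoid).
Local Notation C := (CC R).
Implicit Types (g h k : G) (U V K : set G) (f e : G -> C).

(** The least B is the supremum over the range fibres of the l^1 norm of f, one of the two suprema
    in the I-norm. *)
Definition rbounded f := exists2 B : R, 0 <= B &
  forall s : seq G, uniq s -> (forall g h, g \in s -> h \in s -> rng g = rng h) ->
    \sum_(h <- s) normR (f h) <= B.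

Lemma compact_normR_bounded K f : compact K ->
  (forall g, K g -> {for g, continuous f}) ->
  exists2 B : R, 0 <= B & forall g, K g -> normR (f g) <= B.
Proof.
move=> /compact_near_coveringP cK cf.
have hK g : K g -> \forall h \near g & M \near +oo, normR (f h) <= M.
  move=> Kg.
  have /nearP_normR/(_ _ ltr01) h1 := cf g Kg.
  near=> h M.
  have hM : normR (f g) + 1 <= M by near: M; apply: nbhs_pinfty_ge; rewrite num_real.
  apply: le_trans hM.
  rewrite -[f h](subrK (f g)) addrC; apply: le_trans (normRD _ _) _.
  rewrite lerD2l -normRN opprB; apply: ltW; near: h; exact: h1.
have h : \forall M \near (+oo : set_system R), K `<=` (fun g => normR (f g) <= M) by exact: cK.
have [B [B0 hB]] := filter_ex (filterI (nbhs_pinfty_ge (num_real (0 : R))) h).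
by exists B.
Unshelve. all: by end_near. Qed.

Lemma sum_uniq_le1 (s : seq G) (V : set G) f (B : R) : uniq s -> 0 <= B ->
  (forall g, normR (f g) <= B) -> (forall g, ~ V g -> f g = 0) ->
  (forall g h, g \in s -> h \in s -> V g -> V h -> g = h) ->
  \sum_(h <- s) normR (f h) <= B.
Proof.
move=> us B0 fB f0 hV.
have [[g [gs Vg]]|nV] := pselect (exists g, g \in s /\ V g).
  rewrite (bigD1_seq g)//= big_seq_cond big1 ?addr0// => h /andP[hs hg].
  rewrite f0 ?normR0// => Vh; move/eqP: hg; apply.
  exact: hV.
rewrite big_seq big1// => h hs; rewrite f0 ?normR0// => Vh.
by apply: nV; exists h.
Qed.

Lemma Cc_section_bounded V f : open V -> Cc_on V f ->
  exists2 B : R, 0 <= B & forall g, normR (f g) <= B.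
Proof.
move=> oV /(Cc_onE _ oV)[cf _ [K [cK KV fK]]].
have [|B B0 hB] := @compact_normR_bounded K f cK; first by move=> g /KV; exact: cf.
exists B => // g; have [/hB//|/fK ->] := pselect (K g).
by rewrite normR0.
Qed.

Lemma Cc_rbounded f : Cc f -> rbounded f.
Proof.
move: f; suff : (@Cc R G) `<=` rbounded by [].
rewrite Cc_spanE; apply: lin_span_sub.
  by exists 0 => // s _ _; rewrite big1// => h _; rewrite normR0.
move=> c u v [V [oV rV uV]] [B B0 hB].
have [B' B'0 hB'] := Cc_section_bounded oV uV.
exists (normR c * B' + B) => [|s us hs]; first by rewrite addr_ge0 ?mulr_ge0 ?normR_ge0.
apply: (@le_trans _ _ (\sum_(h <- s) (normR c * normR (u h) + normR (v h)))).
  apply: ler_sum => h _; rewrite -normRM; exact: normRD.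
rewrite big_split /= -mulr_sumr lerD ?hB// ler_wpM2l ?normR_ge0//.
apply: (@sum_uniq_le1 s V) => //.
  by have [_ u0 _] := (Cc_onE u oV).1 uV.
by move=> g h gs hs' Vg Vh; apply: rV => //; exact: hs.
Qed.

Lemma Cc_rfinite f y : Cc f -> finite_set (rfiber y `&` [set g | f g != 0]).
Proof.
move: f; suff : (@Cc R G) `<=` [set f | finite_set (rfiber y `&` [set g | f g != 0])] by [].
rewrite Cc_spanE; apply: lin_span_sub.
  rewrite /= (_ : _ `&` _ = set0)//; apply/seteqP; split=> // g [_ /=].
  by rewrite eqxx.
move=> c u v [V [oV rV uV]] /= hv.
apply: (@sub_finite_set _ _ ((rfiber y `&` V) `|` (rfiber y `&` [set g | v g != 0]))).
  move=> g [gy /= h]; have [Vg|nVg] := pselect (V g); [by left|right; split => //=].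
  move: h; have [_ u0 _] := (Cc_onE u oV).1 uV.
  by rewrite -[(_ + _) g]/(c * u g + v g) u0// mulr0 add0r.
rewrite finite_setU; split => //.
have [[g [gy Vg]]|h] := pselect (exists g, (rfiber y `&` V) g).
  apply: (@sub_finite_set _ _ [set g]) => // h [hy Vh]; apply: rV => //.
  by rewrite hy gy.
rewrite (_ : _ `&` _ = set0)//; apply/seteqP; split=> // g gy.
by apply: h; exists g.
Qed.

Lemma Cc_sfinite f y : Cc f -> finite_set (sfiber y `&` [set g | f g != 0]).
Proof.
move=> /Cc_fstar/(@Cc_rfinite _ y) h.
apply: (sub_finite_set _ (finite_image (fun g => g^-1_G) h)) => g [gy fg].
exists g^-1_G; last by rewrite eg_invK.
split; first by rewrite /rfiber /mkset rng_inv.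
by rewrite /mkset /fstar eg_invK conjC_eq0.
Qed.

Lemma Cc_sbounded f : Cc f -> exists2 B : R, 0 <= B &
  forall s : seq G, uniq s -> (forall g h, g \in s -> h \in s -> src g = src h) ->
    \sum_(h <- s) normR (f h) <= B.
Proof.
move=> /Cc_fstar/Cc_rbounded[B B0 hB]; exists B => // s us hs.
have := hB [seq g^-1_G | g <- s]; rewrite big_map.
under eq_bigr do rewrite /fstar eg_invK normRJ.
apply; first by rewrite map_inj_uniq//; apply: can_inj (@eg_invK G).
by move=> _ _ /mapP[g gs ->] /mapP[h h_s ->]; rewrite !rng_inv; exact: hs.
Qed.

Lemma fsbig_linear (A : set G) c f e : finite_set (A `&` [set g | f g != 0]) ->
  finite_set (A `&` [set g | e g != 0]) ->
  \sum_(g \in A) (c * f g + e g) = c * (\sum_(g \in A) f g) + \sum_(g \in A) e g.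
Proof.
move=> ff fe.
pose S := (A `&` [set g | f g != 0]) `|` (A `&` [set g | e g != 0]).
have fS : finite_set S by rewrite finite_setU.
have SA : S `<=` A by move=> g [] [].
have f0 g : (A `\` S) g -> f g = 0.
  by move=> [Ag nS]; apply/eqP; apply: contrapT => fg; apply: nS; left; split => //; apply/negP.
have e0 g : (A `\` S) g -> e g = 0.
  by move=> [Ag nS]; apply/eqP; apply: contrapT => fg; apply: nS; right; split => //; apply/negP.
rewrite -(fsbig_widen _ _ _ SA f0) -(fsbig_widen _ _ _ SA e0).
rewrite -(fsbig_widen S A (fun g => c * f g + e g) SA); last first.
  by move=> g Sg; rewrite /= (f0 _ Sg) (e0 _ Sg) mulr0 addr0.
by rewrite !fsbig_finite// big_split /= mulr_sumr.
Qed.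

End fiber_bounds.

(** * Convolution of functions of compact support *)

Section conv_closure.
Variables (R : realType) (G : etaleGroupoid).
Local Notation C := (CC R).
Implicit Types (g h k : G) (U V K : set G) (f e : G -> C).

Lemma finite_setI_supp (A : set G) f (F : G -> C) :
  finite_set (A `&` [set g | f g != 0]) ->
  finite_set (A `&` [set g | f g * F g != 0]).
Proof.
apply: sub_finite_set => g [Ag /=]; rewrite mulf_eq0 negb_or => /andP[fg _].
by split.
Qed.

Lemma conv_linearl c f1 f2 e : Cc f1 -> Cc f2 ->
  conv (c *: f1 + f2) e = c *: conv f1 e + conv f2 e.
Proof.
move=> h1 h2; apply/funext => g.
transitivity (c * conv f1 e g + conv f2 e g) => //; rewrite /conv.
rewrite -fsbig_linear; [|exact/finite_setI_supp/Cc_rfinite..].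
apply: eq_fsbigr => h _; transitivity ((c * f1 h + f2 h) * e (h^-1_G *_G g)) => //.
by rewrite mulrDl mulrA.
Qed.

Lemma conv_linearr c f e1 e2 : Cc f ->
  conv f (c *: e1 + e2) = c *: conv f e1 + conv f e2.
Proof.
move=> hf; apply/funext => g.
transitivity (c * conv f e1 g + conv f e2 g) => //; rewrite /conv.
rewrite -fsbig_linear; [|exact/finite_setI_supp/Cc_rfinite..].
apply: eq_fsbigr => h _.
transitivity (f h * (c * e1 (h^-1_G *_G g) + e2 (h^-1_G *_G g))) => //.
by rewrite mulrDr mulrCA.
Qed.

Lemma near_section V g h : rsection V -> open V -> V h -> rng h = rng g ->
  (fun k => section_of V (rng k)) @ g --> h /\
  \forall k \near g, exists2 l, V l & rng l = rng k.
Proof.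
move=> rV oV Vh hg; have hg' : runit h = runit g by exact/runit_eq.
split.
  have := section_of_cvg rV oV Vh; rewrite hg' => /(@cvg_comp _ _ _ _ _ _ _ _ (@runit_continuous G g)).
  by [].
have oO := runit_open oV.
have h1 : nbhs (runit g) (@runit G @` V) by apply: open_nbhs_nbhs; split => //; exists h.
have h2 : \forall k \near g, (@runit G @` V) (runit k).
  exact: (@runit_continuous G g _ h1).
apply: filterS h2 => k [l Vl] /runit_eq lk.
by exists l.
Qed.

Definition setM U V : set G :=
  [set g | exists h k, [/\ U h, V k, src h = rng k & g = h *_G k]].

(** In the range fibre of g only the arrow h of V1 with r(h) = r(g) contributes, so the convolution
    at g is f1(h) f2(h^-1 g). Here h depends continuously on g, through the inverse of the range on
    V1. *)
Lemma conv_section V1 V2 f1 f2 : open V1 -> rsection V1 -> Cc_on V1 f1 ->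
  open V2 -> rsection V2 -> Cc_on V2 f2 -> Cc_section (conv f1 f2).
Proof.
move=> o1 r1 /(Cc_onE _ o1)[cf1 f10 [K1 [cK1 KV1 fK1]]].
move=> o2 r2 /(Cc_onE _ o2)[cf2 f20 [K2 [cK2 KV2 fK2]]].
have convE g h : V1 h -> rng h = rng g -> conv f1 f2 g = f1 h * f2 (h^-1_G *_G g).
  move=> Vh hg; rewrite /conv -(fsbig_widen [set h]); last 2 first.
  - by move=> _ ->.
  - move=> k [kg kh] /=; rewrite f10 ?mul0r// => Vk; apply: kh.
    by apply: r1 => //; rewrite hg.
  by rewrite fsbig_set1.
have conv0 g : conv f1 f2 g != 0 -> exists h k,
    [/\ V1 h /\ f1 h != 0, V2 k /\ f2 k != 0, src h = rng k & g = h *_G k].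
  have [[h [Vh hg]]|nh] := pselect (exists h, V1 h /\ rng h = rng g); last first.
    rewrite /conv fsbig1 ?eqxx// => k kg; rewrite f10 ?mul0r// => Vk.
    by apply: nh; exists k.
  rewrite (convE g h)// mulf_eq0 negb_or => /andP[fh fk].
  have c1 : src h^-1_G = rng g by rewrite src_inv.
  exists h, (h^-1_G *_G g); split=> //.
  - split=> //; apply: contrapT => /f20 e; by rewrite e eqxx in fk.
  - by rewrite rngM// rng_inv.
  - by rewrite eg_mulVKg.
pose s g := section_of V1 (rng g).
have near_s g h k : V1 h -> src h = rng k -> g = h *_G k ->
    [/\ s @ g --> h, (fun g => (s g)^-1_G *_G g) @ g --> k &
    \forall g' \near g, V1 (s g') /\ rng (s g') = rng g'].
  move=> Vh hk ghk; have hg : rng h = rng g by rewrite ghk rngM.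
  have [h1 h2] := near_section r1 o1 Vh hg.
  have h3 : \forall g' \near g, V1 (s g') /\ rng (s g') = rng g'.
    by apply: filterS h2 => g' [l Vl lg]; rewrite /s -lg section_ofE.
  split => //; have -> : k = h^-1_G *_G g by rewrite ghk eg_mulKg.
  apply: mul_cvg.
  - by rewrite src_inv.
  - apply: (@cvg_comp _ _ _ s (fun g : G => g^-1_G) _ _ _ h1); exact: eg_inv_continuous.
  - exact: cvg_id.
  - by apply: filterS h3 => g' [_ <-]; rewrite src_inv.
have oP : open (setM V1 V2).
  rewrite openE => g [h [k [Vh Vk hk ghk]]].
  have [h1 h2 h3] := near_s g h k Vh hk ghk.
  have h4 : \forall g' \near g, V2 ((s g')^-1_G *_G g').
    by apply: h2; apply: open_nbhs_nbhs.
  apply: filterS2 h3 h4 => g' [Vs sg] V2s.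
  exists (s g'), ((s g')^-1_G *_G g'); split => //.
    by rewrite rngM ?rng_inv// src_inv.
  by rewrite eg_mulVKg.
have rP : rsection (setM V1 V2).
  move=> _ _ [h [k [Vh Vk hk ->]]] [h' [k' [Vh' Vk' hk' ->]]].
  rewrite !rngM// => /(r1 _ _ Vh Vh') e; rewrite e in hk *.
  by congr (_ *_G _); apply: r2 => //; rewrite -hk -hk'.
exists (setM V1 V2); split => //; apply/(Cc_onE _ oP); split.
- move=> g [h [k [Vh Vk hk ghk]]]; have [h1 h2 h3] := near_s g h k Vh hk ghk.
  have hg : rng h = rng g by rewrite ghk rngM.
  rewrite /prop_for /continuous_at (convE g h)//.
  have -> : h^-1_G *_G g = k by rewrite ghk eg_mulKg.
  apply: (@cvg_trans _ ((fun g => f1 (s g) * f2 ((s g)^-1_G *_G g)) @ g)).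
    apply: near_eq_cvg; apply: filterS h3 => g' [Vs sg].
    by rewrite (convE g' (s g')).
  have h4 := @cvg_comp _ _ _ _ _ _ _ _ h1 (cf1 h Vh).
  have h5 := @cvg_comp _ _ _ _ _ _ _ _ h2 (cf2 k Vk).
  exact: (cvgM h4 h5).
- move=> g nP; apply/eqP; apply: contrapT => /negP/conv0[h [k [[Vh _] [Vk _] hk ghk]]].
  by apply: nP; exists h, k.
(* The arrows of K1 whose source lies in r(K2). This condition is closed because r(K2) is compact in
   the Hausdorff unit space, so K1' is compact; its image under h -> h k, with k in V2 and r(k) =
   s(h), carries the convolution. *)
pose K1' := K1 `&` ((@runit G \o (fun g : G => g^-1_G)) @^-1` (@runit G @` K2)).
have cK2' : compact (@runit G @` K2).
  by apply: continuous_compact => //; apply/continuous_subspaceT/runit_continuous.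
have clK2 : closed (@runit G @` K2).
  exact: compact_closed (@eg_units_hausdorff G) cK2'.
have cK1' : compact K1'.
  apply: compact_closedI => //; apply: closed_comp => // g _.
  by apply: continuous_comp; [exact: eg_inv_continuous|exact: runit_continuous].
pose m h := h *_G section_of V2 (src h).
have K1'P h : K1' h -> exists k, [/\ K1 h, K2 k, rng k = src h & section_of V2 (src h) = k].
  move=> [K1h [k K2k /= /runit_eq]]; rewrite rng_inv => kh; exists k; split => //.
  by rewrite -kh section_ofE//; exact: KV2.
exists (m @` K1'); split.
- apply: continuous_compact => //; apply/subspace_continuousP => h /K1'P[k [K1h K2k kh sk]].
  have mh : m h = h *_G k by rewrite /m sk.
  suff hm : m @ h --> h *_G k.
    rewrite -mh in hm; apply: cvg_trans hm.
    by apply: cvg_fmap2; exact: cvg_within.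
  apply: (@mul_cvg G _ _ _ id (fun h => section_of V2 (src h))).
  + by rewrite kh.
  + exact: cvg_id.
  + have kh' : rng k = rng h^-1_G by rewrite rng_inv.
    have [h1 _] := near_section r2 o2 (KV2 _ K2k) kh'.
    have -> : (fun x => section_of V2 (src x)) =
        (fun x => section_of V2 (rng x)) \o (fun x : G => x^-1_G).
      by apply/funext => x; rewrite /= rng_inv.
    apply: cvg_comp h1; exact: eg_inv_continuous.
  + have kh' : rng k = rng h^-1_G by rewrite rng_inv.
    have [_ h2] := near_section r2 o2 (KV2 _ K2k) kh'.
    have h3 : \forall x \near h, exists2 l, V2 l & rng l = rng x^-1_G.
      exact: (@eg_inv_continuous G h _ h2).
    by apply: filterS h3 => x [l Vl lx]; rewrite -rng_inv -lx section_ofE.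
- move=> _ [h /K1'P[k [K1h K2k kh sk]] <-]; exists h, k; split=> //.
  + exact: KV1.
  + exact: KV2.
  + by rewrite /m sk.
- move=> g nK; apply/eqP; apply: contrapT => /negP/conv0[h [k [[Vh fh] [Vk fk] hk ghk]]].
  apply: nK; exists h; last by rewrite /m hk section_ofE.
  split; first by apply: contrapT => /fK1 e; rewrite e eqxx in fh.
  exists k; first by apply: contrapT => /fK2 e; rewrite e eqxx in fk.
  by apply/runit_eq; rewrite /= rng_inv.
Qed.

Lemma Cc_conv f e : Cc f -> Cc e -> Cc (conv f e).
Proof.
move=> hf he; move: f hf e he.
have key f : Cc_section f -> forall e, Cc e -> Cc (conv f e).
  move=> fs; have hf := Cc_section_Cc fs.
  suff : (@Cc R G) `<=` [set e | Cc (conv f e)] by [].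
  rewrite {1}Cc_spanE; apply: lin_span_sub => [|c u v uS hv] /=.
    have -> : conv f (0 : G -> C) = 0; last exact: Cc0.
    by apply/funext => g; rewrite /conv fsbig1// => h _; rewrite mulr0.
  rewrite conv_linearr//; apply: CcD => //; apply: CcZ; apply: Cc_section_Cc.
  have [Va [oa ra fa]] := fs; have [Vb [ob rb wb]] := uS.
  exact: (conv_section oa ra fa ob rb wb).
suff : (@Cc R G) `<=` [set f | Cc f /\ forall e, Cc e -> Cc (conv f e)].
  by move=> h f /h[].
rewrite {1}Cc_spanE; apply: lin_span_sub => [|c u v uS [hv hv']] /=.
  split=> [|e he]; first exact: Cc0.
  have -> : conv (0 : G -> C) e = 0; last exact: Cc0.
  by apply/funext => g; rewrite /conv fsbig1// => h _; rewrite mul0r.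
have hu := Cc_section_Cc uS.
split=> [|e he]; first by apply: CcD => //; exact: CcZ.
rewrite conv_linearl//; apply: CcD; last exact: hv'.
by apply: CcZ; exact: key.
Qed.

End conv_closure.

(** * Induced and regular representations *)

Section groupoid_act.
Variables (R : realType) (G : etaleGroupoid) (W : Type).
Local Notation C := (CC R).
Implicit Types (g h k : G) (f e : G -> C) (F : G * W -> C).

Lemma fsbig_supportE (V : nmodType) (A : set G) f (F : G -> V) :
  finite_set (A `&` [set g | f g != 0]) -> (forall h, A h -> f h = 0 -> F h = 0) ->
  \sum_(h <- finite_support 0 A f) F h = \sum_(h \in A) F h.
Proof.
move=> fA F0.
have fA' : finite_set (A `&` f @^-1` [set~ 0]).
  by apply: sub_finite_set fA => g [Ag /= fg]; split => //; apply/eqP.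
rewrite -(fsbig_widen (A `&` f @^-1` [set~ 0]) A).
- apply/esym/fsbig_fwiden => //.
  + by move=> g Ag /=; rewrite in_finite_support//; exact: mem_set.
  + move=> g [/=]; rewrite in_finite_support// => /set_mem h [].
    exact: h.
- by move=> g [].
- move=> g [Ag h] /=; apply: F0 => //.
  by apply: contrapT => fg; apply: h.
Qed.

(** Left translation of the arrow: (g, w) goes to the sum of the f(h) (h g, w). The label w is
    passive, a vector of H0 for induced representations and trivial for regular ones. *)
Definition groupoid_act f (p : G * W) : seq (C * (G * W)) :=
  [seq (f h, (h *_G p.1, p.2)) | h <- finite_support 0 (sfiber (rng p.1)) f].

Lemma groupoid_act_sum (V : lmodType C) f g w (F : G * W -> V) : Cc f ->
  \sum_(p <- groupoid_act f (g, w)) p.1 *: F p.2 =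
  \sum_(h \in sfiber (rng g)) f h *: F (h *_G g, w).
Proof.
move=> hf; rewrite big_map /= fsbig_supportE//; first exact: Cc_sfinite.
by move=> h _ ->; rewrite scale0r.
Qed.

Lemma reindex_inv (V : nmodType) y (F : G -> V) :
  \sum_(h \in sfiber y) F h = \sum_(h \in rfiber y) F h^-1_G.
Proof.
apply: (reindex_fsbig (fun g : G => g^-1_G)); split.
- by move=> g /= gy; rewrite /sfiber /= src_inv.
- by move=> g h _ _ /(congr1 (@ginv _ (eg_ops G))); rewrite !ginvK.
- by move=> g /= gy; exists g^-1_G; rewrite ?eg_invK// /rfiber /= rng_inv.
Qed.

(** The adjoint and the inversion of arrows turn a sum over a source fibre into the formula that
    defines Ind rho. *)
Lemma groupoid_act_star F f g w : Cc f ->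
  fsum_eval F (groupoid_act (fstar f) (g, w)) =
  \sum_(h \in rfiber (rng g)) f h * F (h^-1_G *_G g, w).
Proof.
move=> hf; have hf' := Cc_fstar hf.
rewrite /fsum_eval big_map /= fsbig_supportE.
- rewrite reindex_inv; apply: eq_fsbigr => h _.
  by rewrite /fstar eg_invK conjCK.
- exact: Cc_sfinite.
- by move=> h _ ->; rewrite rmorph0 mul0r.
Qed.

Lemma groupoid_act_linear F c f e g w : Cc f -> Cc e ->
  fsum_eval F (groupoid_act (fstar (c *: f + e)) (g, w)) =
  c * fsum_eval F (groupoid_act (fstar f) (g, w)) +
  fsum_eval F (groupoid_act (fstar e) (g, w)).
Proof.
move=> hf he; have hfe : Cc (c *: f + e) by apply: CcD => //; exact: CcZ.
rewrite !groupoid_act_star//.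
rewrite -fsbig_linear; [|exact/finite_setI_supp/Cc_rfinite..].
apply: eq_fsbigr => h _.
transitivity ((c * f h + e h) * F (h^-1_G *_G g, w)) => //.
by rewrite mulrDl mulrA.
Qed.

(** Exchange of the double sum over k and h, followed by the substitution h = k l. *)
Lemma groupoid_act_mul F f e g w : Cc f -> Cc e ->
  fsum_eval F (groupoid_act (fstar (conv f e)) (g, w)) =
  fsum_eval (fun q => fsum_eval F (groupoid_act (fstar e) q))
    (groupoid_act (fstar f) (g, w)).
Proof.
move=> hf he; have hfe := Cc_conv hf he.
rewrite !groupoid_act_star//; set r := rng g.
pose S := rfiber r `&` [set k | f k != 0].
have fS : finite_set S by exact: Cc_rfinite.
(* A finite set of products h = k l that contains every h with a nonzero term, so that the sums may
   be exchanged. *)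
pose T := \bigcup_(k in S) ((fun l => k *_G l) @` (rfiber (src k) `&` [set l | e l != 0])).
have fT : finite_set T.
  by apply: bigcup_finite => // k _; apply: finite_image; exact: Cc_rfinite.
have ST h k : rfiber r h -> S k -> e (k^-1_G *_G h) != 0 -> T h.
  move=> hr Sk ekh; have [kr _] := Sk.
  exists k => //; exists (k^-1_G *_G h); last by rewrite eg_mulVKg// hr kr.
  split => //; rewrite /rfiber /mkset rngM ?rng_inv// src_inv.
  by rewrite kr hr.
have Tr : T `<=` rfiber r.
  by move=> _ [k [kr _] [l [kl _] <-]]; rewrite /rfiber /mkset rngM.
have SR (E : G -> C) : \sum_(k \in rfiber r) f k * E k = \sum_(k \in S) f k * E k.
  apply/esym/fsbig_widen => [k []//|k [kr nSk]] /=.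
  have -> : f k = 0; last exact: mul0r.
  by apply/eqP; apply: contrapT => fk; apply: nSk; split => //; apply/negP.
rewrite SR.
transitivity (\sum_(h \in T) \sum_(k \in S)
    f k * (e (k^-1_G *_G h) * F (h^-1_G *_G g, w))).
  rewrite -(fsbig_widen T (rfiber r)) //; last first.
    move=> h [hr nTh] /=; rewrite /conv fsbig1 ?mul0r// => k; rewrite hr => kr.
    have [->|fk] := eqVneq (f k) 0; first by rewrite mul0r.
    have [->|ek] := eqVneq (e (k^-1_G *_G h)) 0; first by rewrite mulr0.
    by case: nTh; apply: (ST h k).
  apply: eq_fsbigr => h /set_mem/Tr hr; rewrite /conv hr SR mulr_fsuml.
  by apply: eq_fsbigr => k _; rewrite mulrA.
rewrite exchange_fsbig//; apply: eq_fsbigr => k /set_mem Sk.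
have [kr fk] := Sk; rewrite -mulr_fsumr; congr (_ * _).
rewrite groupoid_act_star// (fsbig_widen T (rfiber r))//; last first.
  move=> h [hr nTh] /=; have [->|ek] := eqVneq (e (k^-1_G *_G h)) 0; first exact: mul0r.
  by case: nTh; apply: (ST h k).
have kg : rng k = rng g by exact: kr.
have c1 : src k^-1_G = rng g by rewrite src_inv.
have -> : rng (k^-1_G *_G g) = src k by rewrite rngM// rng_inv.
rewrite (reindex_fsbig (fun l => k *_G l) (rfiber (src k)) (rfiber r)).
  apply: eq_fsbigr => l /set_mem lk.
  have kl : src k = rng l by rewrite lk.
  by rewrite eg_mulKg// eg_invM// eg_mulA ?src_inv ?rng_inv.
split.
- by move=> l lk; rewrite /rfiber /mkset rngM.
- move=> l l' /set_mem lk /set_mem lk' /(congr1 (fun z => k^-1_G *_G z)).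
  by rewrite !eg_mulKg// ?lk ?lk'.
- move=> h hr; exists (k^-1_G *_G h); last by rewrite eg_mulVKg// hr.
  by rewrite /rfiber /mkset rngM ?rng_inv// src_inv kg hr.
Qed.

Variable K : psdKernel R (G * W).
(** Vectors over different ranges are orthogonal, and left translation by an arrow preserves inner
    products; together these make the involution of C_c(G) act as the adjoint. *)
Hypothesis K_supp : forall p q, rng p.1 <> rng q.1 -> K p q = 0.
Hypothesis K_inv : forall g h g' w w', src h = rng g -> rng h = rng g' ->
  K (h *_G g, w) (g', w') = K (g, w) (h^-1_G *_G g', w').

Lemma groupoid_act_adj f p q : Cc f ->
  ksec K (groupoid_act f p) q = fsum_eval (K p) (groupoid_act (fstar f) q).
Proof.
case: p q => [g w] [g' w'] hf; rewrite groupoid_act_star//.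
transitivity (\sum_(h \in sfiber (rng g)) f h * K (h *_G g, w) (g', w')).
  exact: (@groupoid_act_sum C f g w (fun p => K p (g', w'))).
pose A := sfiber (rng g) `&` rfiber (rng g').
rewrite -(fsbig_widen A (sfiber (rng g))) => [|h []//|]; last first.
  move=> h [hg nA] /=; rewrite K_supp ?mulr0// => /=.
  by rewrite rngM// => hg'; apply: nA.
rewrite -(fsbig_widen A (rfiber (rng g'))) => [|h []//|]; last first.
  move=> h [hg nA] /=; rewrite K_supp ?mulr0// => /=.
  rewrite rngM ?rng_inv ?src_inv// => hg'; apply: nA; split => //.
apply: eq_fsbigr => h /set_mem[hg hg'].
by rewrite K_inv.
Qed.

Definition kernel_mass (p : G * W) : R := knorm K [:: (1, p)].

Lemma kernel_mass_sq p : K p p = RtoC (kernel_mass p ^+ 2).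
Proof.
by rewrite -kform_norm /kform fsum_eval1 /ksec big_seq1 mul1r.
Qed.

Lemma kernel_mass_inv h g w : src h = rng g ->
  kernel_mass (h *_G g, w) = kernel_mass (g, w).
Proof.
move=> hg; apply/eqP; rewrite -(eqrXn2 (_ : 0 < 2)%N) ?knorm_ge0//.
apply/eqP/complexI; rewrite -!/(RtoC _) -!kernel_mass_sq.
by rewrite K_inv ?rngM// eg_mulKg.
Qed.

(** The weight is the norm of the vectors themselves. Left translation does not change it, so the
    l^1 bound required of the action is the bound of [Cc_sbounded] on source fibres. *)
Theorem groupoid_rep : exists (H : hilbertSpace R)
    (Pi : (G -> C) -> H -> H) (e : G * W -> H),
  [/\ @is_rep R (Cc_ops R G) H Pi,
      forall p q, hs_dot (e p) (e q) = K p q &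
      forall f g w, Cc f ->
        Pi f (e (g, w)) = \sum_(h \in sfiber (rng g)) f h *: e (h *_G g, w)].
Proof.
have [|||||||||H [Pi [e [h1 h2 h3 _]]]] := @kernel_rep R (Cc_ops R G) (G * W)%type K
    groupoid_act kernel_mass; last first.
- exists H, Pi, e; split; [exact: h1|exact: h2|].
  by move=> f g w hf; rewrite h3//; exact: groupoid_act_sum.
- move=> f hf; have [B B0 hB] := Cc_sbounded hf; exists B => // -[g w].
  rewrite big_map /= big_seq_cond.
  rewrite (eq_bigr (fun h => normR (f h) * kernel_mass (g, w))); last first.
    move=> h /andP[hs _]; rewrite kernel_mass_inv//.
    have := hs; rewrite in_finite_support; first by move=> /set_mem[].
    apply: sub_finite_set (@Cc_sfinite R G f (rng g) hf) => k [kg fk].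
    by split => //; apply/eqP.
  rewrite -big_seq_cond -mulr_suml ler_wpM2r ?knorm_ge0//.
  apply: hB; first exact: finite_support_uniq.
  have fin : finite_set (sfiber (rng g) `&` f @^-1` [set~ 0]).
    apply: sub_finite_set (@Cc_sfinite R G f (rng g) hf) => k [kg fk].
    by split => //; apply/eqP.
  move=> h k; rewrite !in_finite_support// => /set_mem[hg _] /set_mem[kg _].
  by rewrite hg kg.
- move=> p q; have := kform_CS K [:: (1, p)] [:: (1, q)].
  by rewrite /kform fsum_eval1 /ksec big_seq1 mul1r.
- by move=> p; exact: knorm_ge0.
- by move=> f1 f2 p [g w] hf he; exact: groupoid_act_mul.
- by move=> c f1 f2 p [g w] hf he; exact: groupoid_act_linear.
- by move=> f p q hf; exact: groupoid_act_adj.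
- by move=> f1 f2; exact: Cc_conv.
- by move=> c f1 f2 hf he; apply: CcD => //; exact: CcZ.
- by move=> f hf; split; [exact: Cc_fstar|exact: fstarK].
Qed.

End groupoid_act.

Section label_kernel.
Variables (R : realType) (X : Type) (L : choiceType) (lab : X -> L).
Local Notation C := (CC R).
Variable K : X -> X -> C.
Hypothesis KC : forall x y, K y x = (K x y)^*.
Hypothesis K_psd : forall s : seq (C * X),
  0 <= \sum_(q <- s) (q.1)^* * \sum_(p <- s) p.1 * K p.2 q.2.

(** The Hilbert space of this block-diagonal kernel is a direct sum over the labels. *)
Definition label_fun x y : C := if lab x == lab y then K x y else 0.

Lemma label_funC x y : label_fun y x = (label_fun x y)^*.
Proof. by rewrite /label_fun eq_sym; case: eqP => // _; rewrite rmorph0. Qed.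

(** Sorting the list by labels splits the form into one positive summand for each label that
    occurs. *)
Lemma label_fun_psd (s : seq (C * X)) :
  0 <= \sum_(q <- s) (q.1)^* * \sum_(p <- s) p.1 * label_fun p.2 q.2.
Proof.
pose s' := undup [seq lab p.2 | p <- s].
have -> : \sum_(q <- s) (q.1)^* * \sum_(p <- s) p.1 * label_fun p.2 q.2 =
   \sum_(l <- s') \sum_(q <- [seq q <- s | lab q.2 == l]) (q.1)^* *
     \sum_(p <- [seq p <- s | lab p.2 == l]) p.1 * K p.2 q.2.
  under [RHS]eq_bigr do rewrite big_filter big_mkcond.
  rewrite exchange_big /=.
  have aux (t : seq (C * X)) : {subset [seq lab p.2 | p <- t] <= s'} ->
     \sum_(q <- t) (q.1)^* * \sum_(p <- s) p.1 * label_fun p.2 q.2 =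
     \sum_(q <- t) \sum_(l <- s') (if lab q.2 == l then (q.1)^* *
     \sum_(p <- [seq p <- s | lab p.2 == l]) p.1 * K p.2 q.2 else 0).
    elim: t => [|q t ih] ts; first by rewrite !big_nil.
    rewrite !big_cons ih => [|l lt]; last by apply: ts; rewrite inE lt orbT.
    congr (_ + _); rewrite (bigD1_seq (lab q.2)) ?undup_uniq ?ts ?mem_head//=.
    rewrite eqxx [X in _ = _ + X]big1; last first.
      by move=> l lq; rewrite eq_sym (negPf lq).
    rewrite addr0 big_filter [in RHS]big_mkcond; congr (_ * _); apply: eq_bigr => p _.
    by rewrite /label_fun; case: ifP => // _; rewrite mulr0.
  by apply: aux => l; rewrite mem_undup.
by apply: sumr_ge0 => l _; exact: K_psd.
Qed.

Definition label_kernel : psdKernel R X := PsdKernel label_funC label_fun_psd.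

End label_kernel.

Lemma gram_psd (R : realType) (H : hilbertSpace R) (X : Type) (v : X -> H)
    (s : seq (CC R * X)) :
  0 <= \sum_(q <- s) (q.1)^* * \sum_(p <- s) p.1 * hs_dot (v p.2) (v q.2).
Proof.
have -> : \sum_(q <- s) (q.1)^* * \sum_(p <- s) p.1 * hs_dot (v p.2) (v q.2) =
    hs_dot (\sum_(p <- s) p.1 *: v p.2) (\sum_(q <- s) q.1 *: v q.2).
  rewrite hs_dot_sumr; apply: eq_bigr => q _; rewrite hs_dotZr; congr (_ * _).
  by rewrite hs_dot_suml; apply: eq_bigr => p _; rewrite hs_dotZl.
by rewrite hs_dot_normR (RtoC_le 0) sqr_ge0.
Qed.

Section representations.
Variables (R : realType) (G : etaleGroupoid).
Local Notation C := (CC R).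
Implicit Types (g h k : G) (x y : unit_space G).

Lemma fstar_delta g : fstar (delta R g) = delta R g^-1_G.
Proof.
apply/funext => h; rewrite /fstar /delta.
have -> : (h == g^-1_G) = (h^-1_G == g).
  by apply/eqP/eqP => [->|<-]; rewrite eg_invK.
by rewrite conjC_nat.
Qed.

Lemma conv_delta g h : src g = rng h ->
  conv (delta R g) (delta R h) = delta R (g *_G h).
Proof.
move=> gh; apply/funext => k; rewrite /conv.
have [kg|kg] := eqVneq (rng k) (rng g); last first.
  rewrite fsbig1 => [|l lk]; last first.
    rewrite /delta; case: eqP => [lg|_]; last by rewrite mul0r.
    by move: kg; rewrite -lk lg eqxx.
  rewrite /delta; case: eqP => // kgh.
  by move: kg; rewrite kgh rngM// eqxx.
rewrite -(fsbig_widen [set g]) => [|l ->|l [_ lg]] /=; last 2 first.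
  - by rewrite /rfiber /mkset kg.
  - by rewrite /delta; case: eqP => [/lg//|_]; rewrite mul0r.
rewrite fsbig_set1 /delta eqxx mul1r.
have -> // : (g^-1_G *_G k == h) = (k == g *_G h).
by apply/eqP/eqP => [<-|->]; [rewrite eg_mulVKg|rewrite eg_mulKg].
Qed.

(** * The kernel of an induced representation *)

Section induction.
Variables (x : unit_space G) (H0 : hilbertSpace R).
Variables (rho : (G -> C) -> H0 -> H0).
Hypothesis rho_rep : @is_rep R (group_alg_ops R x) H0 rho.

Lemma isotropy_unit : isotropy x (x : G).
Proof. by split; rewrite /rfiber /sfiber /mkset ?unit_rng ?unit_src. Qed.

Lemma isotropy_inv g : isotropy x g -> isotropy x g^-1_G.
Proof. by move=> [gr gs]; split; rewrite /rfiber /sfiber /mkset ?rng_inv ?src_inv. Qed.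

Lemma isotropyM g h : isotropy x g -> isotropy x h -> isotropy x (g *_G h).
Proof.
move=> [gr gs] [hr hs]; have gh : src g = rng h by rewrite gs hr.
by split; rewrite /rfiber /sfiber /mkset ?rngM ?srcM.
Qed.

Lemma isotropy_quo g h : src g = x -> src h = x -> rng g = rng h ->
  isotropy x (h^-1_G *_G g).
Proof.
move=> gx hx gh; have c : src h^-1_G = rng g by rewrite src_inv.
by split; rewrite /rfiber /sfiber /mkset ?rngM ?srcM ?rng_inv.
Qed.

Lemma group_alg_delta g : isotropy x g -> @so_dom R (group_alg_ops R x) (delta R g).
Proof.
move=> gx; have sub : [set h | delta R g h != 0] `<=` [set g].
  move=> h; rewrite /mkset /delta.
  by case: (h =P g) => [->|_] //; rewrite /= eqxx.
split; first exact: sub_finite_set sub _.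
by move=> h /sub ->.
Qed.

Lemma rho_delta_dot g h v w : isotropy x g -> isotropy x h ->
  hs_dot (rho (delta R g) v) (rho (delta R h) w) =
  hs_dot (rho (delta R (h^-1_G *_G g)) v) w.
Proof.
move=> hg hh; have hh' := isotropy_inv hh.
have e1 := rep_star rho_rep (rho (delta R g) v) w (group_alg_delta hh').
rewrite /= fstar_delta eg_invK in e1; rewrite -e1.
have e2 := rep_mul rho_rep v (group_alg_delta hh') (group_alg_delta hg).
rewrite /= conv_delta in e2; first by rewrite -e2.
by rewrite hg.1 hh'.2.
Qed.

(** The cosets of the isotropy group in G_x correspond to the ranges of their elements; one arrow is
    selected from each. *)
Let transversal (y : G) : G := get [set k | src k = x /\ rng k = y].

Let transversalP g : src g = x ->
  src (transversal (rng g)) = x /\ rng (transversal (rng g)) = rng g.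
Proof.
move=> gx; have : [set k | src k = x /\ rng k = rng g] (transversal (rng g)).
  by apply: getPex; exists g.
by [].
Qed.

(** The value at the selected arrow k over r(g) of the element of L that is supported on the coset
    of g and is w at g, namely rho(u_h) w with h = k^-1 g. By [ind_kernelE] the choice of k drops
    out. *)
Let ind_vec (p : G * H0) : H0 :=
  if src p.1 == (x : G) then rho (delta R ((transversal (rng p.1))^-1_G *_G p.1)) p.2
  else 0.

Let ind_gramC p q :
  hs_dot (ind_vec q) (ind_vec p) = (hs_dot (ind_vec p) (ind_vec q))^*.
Proof. exact: hs_dotC. Qed.

Definition ind_kernel : psdKernel R (G * H0) :=
  label_kernel (fun p : G * H0 => rng p.1) ind_gramC (gram_psd ind_vec).

Lemma ind_kernelE g g' w w' : src g = x -> src g' = x -> rng g = rng g' ->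
  ind_kernel (g, w) (g', w') = hs_dot (rho (delta R (g'^-1_G *_G g)) w) w'.
Proof.
move=> gx gx' gg'; rewrite /= /label_fun /= gg' eqxx /ind_vec /= gx gx' eqxx.
have [t1 t2] := transversalP gx'; rewrite gg'.
set t := transversal (rng g') in t1 t2 *.
have i1 : isotropy x (t^-1_G *_G g) by apply: isotropy_quo; rewrite ?gg'.
have i2 : isotropy x (t^-1_G *_G g') by exact: isotropy_quo.
rewrite rho_delta_dot//; congr (hs_dot (rho (delta R _) _) _).
have c1 : src t^-1_G = rng g' by rewrite src_inv.
rewrite eg_invM// eg_invK eg_mulA ?src_inv//; last by rewrite rngM ?rng_inv// c1.
by rewrite eg_mulVKg// gg'.
Qed.

Lemma ind_kernel0 g g' w w' : ~ [/\ src g = x, src g' = x & rng g = rng g'] ->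
  ind_kernel (g, w) (g', w') = 0.
Proof.
move=> h; rewrite /= /label_fun /=; case: eqP => // gg'.
rewrite /ind_vec /=; case: eqP => gx; last by rewrite hs_dot0l.
by case: eqP => gx'; [case: h|rewrite hs_dot0r].
Qed.

(** Apart from its link with L, Ind rho enters below only through these properties of the vectors
    e(g, w), for w placed at g. *)
Lemma induced_rep : exists (H : hilbertSpace R) (Pi : (G -> C) -> H -> H)
    (e : G * H0 -> H),
  [/\ @is_rep R (Cc_ops R G) H Pi,
      forall g g' w w', src g = x -> src g' = x -> rng g = rng g' ->
        hs_dot (e (g, w)) (e (g', w')) = hs_dot (rho (delta R (g'^-1_G *_G g)) w) w',
      forall g g' w w', rng g <> rng g' -> hs_dot (e (g, w)) (e (g', w')) = 0 &
      forall f g w, Cc f ->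
        Pi f (e (g, w)) = \sum_(h \in sfiber (rng g)) f h *: e (h *_G g, w)].
Proof.
have [||H [Pi [e [h1 h2 h3]]]] := @groupoid_rep R G H0 ind_kernel.
- by case=> g w [g' w'] /= gg'; apply: ind_kernel0 => -[].
- move=> g h g' w w' hg hg'.
  have c1 : src h^-1_G = rng g' by rewrite src_inv.
  have [[gx gx']|n] := pselect (src g = x /\ src g' = x).
    rewrite ind_kernelE ?srcM// ?rngM//.
    rewrite ind_kernelE ?srcM// ?rngM// ?rng_inv//.
    rewrite eg_invM// eg_invK eg_mulA//; first by rewrite src_inv.
  rewrite !ind_kernel0// => -[]; rewrite ?srcM// => gx gx' _; exact: n.
- exists H, Pi, e; split => // g g' w w' => [gx gx' gg'|gg']; rewrite h2.
    exact: ind_kernelE.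
  by apply: ind_kernel0 => -[].
Qed.

End induction.

End representations.

(** * Completions *)

Section opnorm.
Variables (R : realType) (H : hilbertSpace R).
Local Notation C := (CC R).

Lemma opnorm_le (T : H -> H) r :
  (forall xi, normR (T xi) <= r * normR xi) -> 0 <= r -> (opnorm T <= r%:E)%E.
Proof.
move=> hT r0; apply: ge_ereal_sup => _ [xi /= xi1 <-]; rewrite lee_fin.
by apply: le_trans (hT _) _; rewrite ler_piMr.
Qed.

Lemma le_opnorm (T : H -> H) r : linear T -> (opnorm T <= r%:E)%E ->
  forall xi, normR (T xi) <= r * normR xi.
Proof.
move=> linT hT xi.
have T0 : T 0 = 0.
  by have := linT 1 0 0; rewrite !scale1r addr0 => h; apply: (addrI (T 0)); rewrite addr0 -h.
have TZ c u : T (c *: u) = c *: T u.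
  by rewrite -[c *: u]addr0 linT T0 addr0.
have [x0|x0] := ltP 0 (normR xi); last first.
  have xi0 : xi = 0 by apply/normR_eq0/eqP; rewrite eq_le x0 normR_ge0.
  by rewrite xi0 T0 !normR0 mulr0.
rewrite -ler_pdivrMr// mulrC.
have nV : normR (RtoC (normR xi)^-1) = (normR xi)^-1.
  by rewrite normR_RtoC ger0_norm// invr_ge0 ltW.
rewrite -nV -normRZ -TZ -lee_fin; apply: le_trans hT.
apply: ereal_sup_ubound; exists (RtoC (normR xi)^-1 *: xi) => //=.
by rewrite normRZ nV mulVf// gt_eqF.
Qed.

End opnorm.

Section universal.
Variables (R : realType) (A : starOps R).
Local Notation C := (CC R).

Lemma universal_norm_le (a : A) r : 0 <= r -> (forall (H : hilbertSpace R) (pi : A -> H -> H) xi,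
  is_rep pi -> normR (pi a xi) <= r * normR xi) -> (universal_norm a <= r%:E)%E.
Proof.
move=> r0 h; apply: ge_ereal_sup => _ [H [pi [hpi ->]]].
by apply: opnorm_le => // xi; exact: h.
Qed.

Lemma univ_rep_le (M : completion (@universal_norm R A)) (H : hilbertSpace R)
    (pi : A -> H -> H) (a : A) xi : is_rep pi -> so_dom a ->
  normR (pi a xi) <= normR (cpl_in M a) * normR xi.
Proof.
move=> hpi ha; apply: le_opnorm; first exact: (rep_bounded hpi ha).1.
rewrite cpl_norm//; apply: ereal_sup_ubound.
by exists H, pi.
Qed.

End universal.

(** * Extension by continuity, and kernels of canonical surjections *)

Section completions.
Variables (R : realType) (A : starOps R).
Local Notation C := (CC R).
Hypothesis dom_linear : forall c (a b : A),
  so_dom a -> so_dom b -> so_dom (c *: a + b).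

Let dom_sub (a b : A) : so_dom a -> so_dom b -> so_dom (a - b).
Proof. by move=> ha hb; rewrite addrC -scaleN1r; exact: dom_linear. Qed.

Section one.
Variables (p : A -> \bar R) (M : completion p).

Lemma cpl_inB a b : so_dom a -> so_dom b ->
  cpl_in M (a - b) = cpl_in M a - cpl_in M b.
Proof. by move=> ha hb; rewrite addrC -scaleN1r cpl_linear// scaleN1r addrC. Qed.

Lemma cpl_approx (a : M) (e : R) : 0 < e ->
  exists2 f, so_dom f & normR (a - cpl_in M f) < e.
Proof.
move=> e0; have nb : nbhs a [set b | normR (a - b) < e].
  by apply/nbhs_normR; exists e.
move: nb; rewrite nbhsE => -[U [oU Ua] Ue].
have [b [Ub [f hf fb]]] := @cpl_dense _ _ _ M U (ex_intro _ a Ua) oU.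
by exists f => //; rewrite fb; exact: Ue.
Qed.

Lemma cpl_near_proper (a : M) : ProperFilter (cpl_near a).
Proof.
apply: filter_from_proper => [|U].
  apply: filter_from_filter; first by exists setT; exact: filterT.
  move=> U V hU hV; exists (U `&` V); first exact: filterI.
  by move=> f [hf [Uf Vf]]; split.
move=> /nbhs_normR[e e0 hU].
by have [f hf fe] := cpl_approx a e0; exists f; split => //; exact: hU.
Qed.

(** A B-Lipschitz map on the dense subalgebra has a limit at a, and the Lipschitz bound persists
    between a and f. Extensions by continuity are used below only through this estimate. *)
Lemma cpl_ext_dist (T : normedModType C) (j : A -> T) (B : R) (a : M) f :
  (forall F : set_system T, ProperFilter F -> cauchy F -> cvg F) ->
  0 <= B ->
  (forall f g, so_dom f -> so_dom g ->
     normR (j f - j g) <= B * normR (cpl_in M f - cpl_in M g)) ->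
  so_dom f -> normR (cpl_ext j a - j f) <= B * normR (a - cpl_in M f).
Proof.
move=> Tc B0 hj hf; have PF := cpl_near_proper a.
have B1 : 0 < B + 1 by lra.
have near_lt e : 0 < e -> \forall g \near cpl_near a, so_dom g /\ normR (a - cpl_in M g) < e.
  move=> e0; exists [set b | normR (a - b) < e].
    by apply/nbhs_normR; exists e.
  by move=> g [hg ge].
have cv : j @ cpl_near a --> cpl_ext j a.
  apply: Tc; apply/cauchy_normR => e e0.
  have e1 : 0 < e / 2 / (B + 1) by rewrite !divr_gt0.
  have h1 := near_lt _ e1.
  exists (j @` [set g | so_dom g /\ normR (a - cpl_in M g) < e / 2 / (B + 1)]).
    by apply: filterS h1 => g hg; exists g.
  move=> _ _ [g [hg ge] <-] [h [hh he] <-].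
  apply: le_lt_trans (hj _ _ hg hh) _.
  have h2 : normR (cpl_in M g - cpl_in M h) <= normR (a - cpl_in M g) + normR (a - cpl_in M h).
    exact: normR_tri.
  have : normR (cpl_in M g - cpl_in M h) < e / (B + 1).
    apply: le_lt_trans h2 _; rewrite mulrAC in ge he; move: ge he.
    by move: (e / (B + 1)) => z; lra.
  rewrite ltr_pdivlMr// => h3; apply: le_lt_trans h3.
  by rewrite mulrC ler_wpM2l ?normR_ge0// lerDl.
apply/ler_addgt0Pr => e e0.
have e1 : 0 < e / 2 / (B + 1) by rewrite !divr_gt0.
have /nearP_normR/(_ _ (divr_gt0 e0 (ltr0n _ 2))) h1 := cv.
have [g [hg1 [hg ge]]] := filter_ex (filterI h1 (near_lt _ e1)).
rewrite -(subrK (j g) (cpl_ext j a)) -addrA.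
apply: le_trans (normRD _ _) _; rewrite [leLHS]addrC.
have h2 : normR (cpl_in M g - cpl_in M f) <= normR (a - cpl_in M f) + normR (a - cpl_in M g).
  by rewrite [leRHS]addrC; exact: normR_tri.
have h3 := hj _ _ hg hf.
have h4 : B * normR (cpl_in M g - cpl_in M f) <= B * normR (a - cpl_in M f) + e / 2.
  apply: le_trans (ler_wpM2l B0 h2) _; rewrite mulrDr lerD2l.
  apply: le_trans (ler_wpM2l B0 (ltW ge)) _.
  by rewrite mulrCA ler_piMr ?divr_ge0 ?(ltW e0)// ler_pdivrMr// mul1r lerDl.
rewrite [X in _ <= _ + X](splitr e) addrA lerD ?(ltW hg1)//.
exact: le_trans h3 h4.
Qed.

End one.

Variables (p1 p2 : A -> \bar R) (M1 : completion p1) (M2 : completion p2).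
Hypothesis p21 : forall f, so_dom f -> (p2 f <= p1 f)%E.

Lemma cpl_in_le f : so_dom f -> normR (cpl_in M2 f) <= normR (cpl_in M1 f).
Proof. by move=> hf; rewrite -lee_fin !cpl_norm//; exact: p21. Qed.

Lemma cpl_surj_dist (a : M1) f : so_dom f ->
  normR (cpl_surj M1 M2 a - cpl_in M2 f) <= normR (a - cpl_in M1 f).
Proof.
move=> hf; rewrite -[leRHS]mul1r; apply: cpl_ext_dist => //.
  by move=> F FF cF; exact: cauchy_cvg.
move=> g h hg hh; rewrite mul1r -!cpl_inB//.
by apply: cpl_in_le; exact: dom_sub.
Qed.

(** This removes the limit from the definition of [cpl_surj]: the ideal properties of the kernel
    become estimates for elements of A. *)
Lemma cpl_surj_eq0 (a : M1) : cpl_surj M1 M2 a = 0 <->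
  forall e, 0 < e -> exists f, [/\ so_dom f, normR (a - cpl_in M1 f) <= e &
    normR (cpl_in M2 f) <= e].
Proof.
split=> [qa e e0|h].
  have [f hf fe] := cpl_approx a e0; exists f; split=> //; first exact: ltW.
  have := cpl_surj_dist a hf; rewrite qa sub0r normRN => /le_trans; apply.
  exact: ltW.
apply/normR_eq0/eqP; rewrite eq_le normR_ge0 andbT.
apply: (@le_mul_small _ _ 2) => // e e0 _.
have [f [hf h1 h2]] := h e e0.
rewrite -(subrK (cpl_in M2 f) (cpl_surj M1 M2 a)).
apply: le_trans (normRD _ _) _.
have := cpl_surj_dist a hf; lra.
Qed.

Hypothesis dom_mul : forall a b : A, so_dom a -> so_dom b -> so_dom (so_mul a b).
Hypothesis dom_star : forall a : A, so_dom a -> so_dom (so_star a).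

Lemma cpl_surj_star0 (a : M1) : cpl_surj M1 M2 a = 0 ->
  cpl_surj M1 M2 (cs_star a) = 0.
Proof.
move=> /cpl_surj_eq0 h; apply/cpl_surj_eq0 => e /h[f [hf h1 h2]].
exists (so_star f); split; first exact: dom_star.
- by rewrite cpl_star// -cs_starB normR_star.
- by rewrite cpl_star// normR_star.
Qed.

Lemma cpl_surj_mulr0 (a : M1) g : so_dom g -> cpl_surj M1 M2 a = 0 ->
  cpl_surj M1 M2 (cs_mul a (cpl_in M1 g)) = 0.
Proof.
move=> hg /cpl_surj_eq0 h; apply/cpl_surj_eq0 => e e0.
pose N := normR (cpl_in M1 g) + 1.
have N0 : 0 < N by have := normR_ge0 (cpl_in M1 g); rewrite /N; lra.
have [f [hf h1 h2]] := h _ (divr_gt0 e0 N0).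
exists (so_mul f g); split; first exact: dom_mul.
- rewrite cpl_mul// -cs_mulBl; apply: le_trans (normR_mul _ _) _.
  rewrite ler_pdivlMr// in h1; apply: le_trans h1.
  by rewrite ler_wpM2l ?normR_ge0// lerDl.
- rewrite cpl_mul//; apply: le_trans (normR_mul _ _) _.
  rewrite ler_pdivlMr// in h2; apply: le_trans h2.
  rewrite ler_wpM2l ?normR_ge0//; apply: le_trans (cpl_in_le hg) _.
  by rewrite lerDl.
Qed.

Lemma cpl_surj_mull0 (b a : M1) : cpl_surj M1 M2 a = 0 ->
  cpl_surj M1 M2 (cs_mul b a) = 0.
Proof.
move=> /cpl_surj_eq0 h; apply/cpl_surj_eq0 => e e0.
pose N := normR a + 1.
have N0 : 0 < N by have := normR_ge0 a; rewrite /N; lra.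
have e2 : 0 < e / 2 by rewrite divr_gt0.
have [g hg ge] := cpl_approx b (divr_gt0 e2 N0).
pose N' := normR (cpl_in M1 g) + 1.
have N'0 : 0 < N' by have := normR_ge0 (cpl_in M1 g); rewrite /N'; lra.
(* f is chosen after g, because its precision depends on the norm of g. *)
have [f [hf h1 h2]] := h _ (divr_gt0 e2 N'0).
rewrite ltr_pdivlMr// in ge; rewrite ler_pdivlMr// in h1; rewrite ler_pdivlMr// in h2.
exists (so_mul g f); split; first exact: dom_mul.
- rewrite cpl_mul//.
  have -> : cs_mul b a - cs_mul (cpl_in M1 g) (cpl_in M1 f) =
     cs_mul (b - cpl_in M1 g) a + cs_mul (cpl_in M1 g) (a - cpl_in M1 f).
    by rewrite cs_mulBl cs_mulBr addrA subrK.
  apply: le_trans (normRD _ _) _; rewrite (splitr e); apply: lerD.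
    apply: le_trans (normR_mul _ _) _; apply: le_trans (ltW ge).
    by rewrite ler_wpM2l ?normR_ge0// lerDl.
  apply: le_trans (normR_mul _ _) _; apply: le_trans h1.
  by rewrite mulrC ler_wpM2l ?normR_ge0// lerDl.
- rewrite cpl_mul//; apply: le_trans (normR_mul _ _) _.
  apply: (@le_trans _ _ (e / 2)); last lra.
  apply: le_trans h2; rewrite mulrC ler_wpM2l ?normR_ge0//.
  by apply: le_trans (cpl_in_le hg) _; rewrite lerDl.
Qed.

End completions.

(** * Restriction to an isotropy group *)

Lemma fsbig_morph (I : choiceType) (V W : nmodType) (phi : V -> W) (A : set I)
    (F : I -> V) : phi 0 = 0 -> (forall a b, phi (a + b) = phi a + phi b) ->
  finite_set (A `&` F @^-1` [set~ 0]) ->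
  phi (\sum_(h \in A) F h) = \sum_(h \in A) phi (F h).
Proof.
move=> phi0 phiD fS; set S := A `&` _ in fS.
have SA : S `<=` A by move=> g [].
have F0 h : (A `\` S) h -> F h = 0.
  by move=> [Ah nS]; apply: contrapT => Fh; apply: nS.
rewrite -(fsbig_widen S A F SA F0) -(fsbig_widen S A _ SA); last first.
  by move=> h /F0 /= ->.
by rewrite !fsbig_finite//; exact: big_morph.
Qed.

Section restriction.
Variables (R : realType) (G : etaleGroupoid) (x : unit_space G).
Local Notation C := (CC R).
Implicit Types (g h k : G) (f : G -> C).
Local Notation dom := (@so_dom R (group_alg_ops R x)).

Lemma group_alg_linear c (a b : G -> C) : dom a -> dom b -> dom (c *: a + b).
Proof.
move=> [fa ha] [fb hb].
have sub : [set g | (c *: a + b) g != 0] `<=` [set g | a g != 0] `|` [set g | b g != 0].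
  move=> g /= h; have [ag|ag] := eqVneq (a g) 0; last by left.
  right; apply: contra_neq h => bg.
  by rewrite -[LHS]/(c * a g + b g) ag bg mulr0 addr0.
split; first by apply: sub_finite_set sub _; rewrite finite_setU.
by move=> g /sub[/ha|/hb].
Qed.

Lemma group_alg0 : dom (0 : G -> C).
Proof.
have e : [set g | (0 : G -> C) g != 0] = set0.
  by apply/seteqP; split=> // g; rewrite /mkset eqxx.
by split; rewrite e.
Qed.

Lemma group_alg_sum (V : lmodType C) (j : (G -> C) -> V) a :
  (forall c (a b : G -> C), dom a -> dom b -> j (c *: a + b) = c *: j a + j b) ->
  dom a -> j a = \sum_(g \in isotropy x) a g *: j (delta R g).
Proof.
move=> jlin ha; have [fa sa] := ha.
have j0 : j 0 = 0.
  have := jlin 1 0 0 group_alg0 group_alg0; rewrite !scale1r addr0 => h.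
  by apply: (addrI (j 0)); rewrite addr0 -h.
pose S := [set g | a g != 0].
have key (s : seq G) : uniq s -> (forall g, g \in s -> isotropy x g) ->
    dom (fun g => if g \in s then a g else 0) /\
    j (fun g => if g \in s then a g else 0) = \sum_(g <- s) a g *: j (delta R g).
  elim: s => [_ _|g s ih /andP[gs us] hs].
    by rewrite big_nil; split; [exact: group_alg0|exact: j0].
  have [h hsi|d1 e1] := ih us; first by apply: hs; rewrite inE hsi orbT.
  have dg : dom (delta R g) by apply: group_alg_delta; apply: hs; exact: mem_head.
  have -> : (fun h => if h \in g :: s then a h else 0) =
      a g *: delta R g + (fun h => if h \in s then a h else 0).
    apply/funext => h; transitivity (a g * delta R g h + (if h \in s then a h else 0)) => //.
    rewrite inE /delta; have [->|hg] := eqVneq h g.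
      by rewrite (negPf gs) mulr1 addr0.
    by rewrite mulr0 add0r.
  split; first exact: (group_alg_linear (a g) dg d1).
  by rewrite jlin// e1 big_cons.
have -> : \sum_(g \in isotropy x) a g *: j (delta R g) =
    \sum_(g \in S) a g *: j (delta R g).
  apply/esym/fsbig_widen => // g [_ ng] /=.
  have -> : a g = 0; last by rewrite scale0r.
  by apply/eqP; apply: contrapT => /negP.
rewrite fsbig_finite//.
have [||_ <-] := key (finmap.enum_fset (fset_set S)); first exact: finmap.fset_uniq.
  by move=> g; move=> gS; apply: sa; apply: set_mem; rewrite -(in_fset_set fa); exact: gS.
congr j; apply/funext => g; rewrite (_ : (g \in _) = (g \in S)); last exact: (in_fset_set fa).
by case: ifPn => // /negP h; apply/eqP; apply: contrapT => /negP ag; apply: h; exact: mem_set.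
Qed.

Definition iso_restrict f : G -> C := fun g => if g \in isotropy x then f g else 0.

Lemma iso_restrict_dom f : Cc f -> dom (iso_restrict f).
Proof.
move=> hf; have sub : [set g | iso_restrict f g != 0] `<=` isotropy x `&` [set g | f g != 0].
  by move=> g; rewrite /mkset /iso_restrict; case: ifPn => [/set_mem|]; rewrite ?eqxx.
split; last by move=> g /sub[].
apply: sub_finite_set (@Cc_rfinite R G f x hf).
by move=> g /sub[[gr _] fg].
Qed.

Lemma iso_restrict_sum (V : lmodType C) (j : (G -> C) -> V) f :
  (forall c (a b : G -> C), dom a -> dom b -> j (c *: a + b) = c *: j a + j b) ->
  Cc f -> j (iso_restrict f) = \sum_(g \in isotropy x) f g *: j (delta R g).
Proof.
move=> jlin hf; rewrite (group_alg_sum jlin (iso_restrict_dom hf)).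
by apply: eq_fsbigr => g gx; rewrite /iso_restrict gx.
Qed.

Lemma iso_restrictB f e : iso_restrict (f - e) = iso_restrict f - iso_restrict e.
Proof.
apply/funext => g; transitivity (iso_restrict f g - iso_restrict e g) => //.
by rewrite /iso_restrict; case: ifP => // _; rewrite subr0.
Qed.

Lemma CcB f e : Cc f -> Cc e -> Cc (f - e).
Proof. by move=> hf he; apply: CcD => //; rewrite -scaleN1r; exact: CcZ. Qed.

Section induced.
Variables (H0 : hilbertSpace R) (rho : (G -> C) -> H0 -> H0).
Hypothesis rho_rep : @is_rep R (group_alg_ops R x) H0 rho.
Variables (H : hilbertSpace R) (Pi : (G -> C) -> H -> H) (e : G * H0 -> H).
Hypothesis e_dot : forall g g' w w', src g = x -> src g' = x -> rng g = rng g' ->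
  hs_dot (e (g, w)) (e (g', w')) = hs_dot (rho (delta R (g'^-1_G *_G g)) w) w'.
Hypothesis e_dot0 : forall g g' w w', rng g <> rng g' ->
  hs_dot (e (g, w)) (e (g', w')) = 0.
Hypothesis Pi_e : forall f g w, Cc f ->
  Pi f (e (g, w)) = \sum_(h \in sfiber (rng g)) f h *: e (h *_G g, w).

(** rho(delta_x) is a selfadjoint idempotent; it need not be the identity, since rho may be
    degenerate. *)
Lemma rep_delta_unit v : normR (rho (delta R (x : G)) v) <= normR v.
Proof.
have d := @group_alg_delta R G x (x : G) (isotropy_unit x).
have e1 : hs_dot (rho (delta R (x : G)) v) (rho (delta R (x : G)) v) =
    hs_dot (rho (delta R (x : G)) v) v.
  rewrite (rho_delta_dot rho_rep v v (isotropy_unit x) (isotropy_unit x)).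
  by rewrite eg_mulVg unit_src.
have := hs_CS (rho (delta R (x : G)) v) v.
rewrite -e1 normR_hs_dot// expr2.
set n := normR (rho _ v); have [n0|n0] := ltP 0 n; first by rewrite ler_pM2l.
by move=> _; apply: le_trans n0 (normR_ge0 _).
Qed.

Lemma normR_induced_vec g v : src g = x -> normR (e (g, v)) <= normR v.
Proof.
move=> gx; have := e_dot v v gx gx erefl; rewrite eg_mulVg gx => e1.
have h1 : normR (e (g, v)) ^+ 2 <= normR v ^+ 2.
  have -> : normR (e (g, v)) ^+ 2 = normR (hs_dot (rho (delta R (x : G)) v) v).
    by rewrite -e1 normR_hs_dot.
  apply: le_trans (hs_CS _ _) _; rewrite expr2 ler_wpM2r ?normR_ge0//.
  exact: rep_delta_unit.
by rewrite ler_pXn2r ?nnegrE ?normR_ge0 in h1.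
Qed.

(** The label w is a bare index of the kernel, so linearity has to be recovered: the difference of
    both sides is orthogonal to every e(g, u), hence to itself. *)
Lemma induced_vec_linear g c v w : src g = x ->
  e (g, c *: v + w) = c *: e (g, v) + e (g, w).
Proof.
move=> gx; have d := @group_alg_delta R G x (x : G) (isotropy_unit x).
have [linr _] := rep_bounded rho_rep d.
have key u : hs_dot (e (g, c *: v + w) - (c *: e (g, v) + e (g, w))) (e (g, u)) = 0.
  rewrite hs_dotBl hs_dotDl hs_dotZl !e_dot// eg_mulVg gx linr.
  by rewrite hs_dotDl hs_dotZl subrr.
apply/eqP; rewrite -subr_eq0; apply/eqP.
have : hs_dot (e (g, c *: v + w) - (c *: e (g, v) + e (g, w)))
  (e (g, c *: v + w) - (c *: e (g, v) + e (g, w))) = 0.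
  by rewrite hs_dotBr hs_dotDr hs_dotZr !key mulr0 addr0 subrr.
by rewrite hs_dot_norm => /eqP; rewrite sqrf_eq0 normr_eq0 => /eqP.
Qed.

Lemma induced_dot f g w z : Cc f ->
  hs_dot (Pi f (e (g, w))) z = \sum_(h \in sfiber (rng g)) f h * hs_dot (e (h *_G g, w)) z.
Proof.
move=> hf; rewrite Pi_e//.
rewrite (fsbig_morph (phi := fun u => hs_dot u z)); last first.
- apply: sub_finite_set (@Cc_sfinite R G f (rng g) hf) => h [hg /= fh].
  split => //=; apply/eqP => f0; apply: fh; by rewrite f0 scale0r.
- by move=> a b; exact: hs_dotDl.
- exact: hs_dot0l.
by apply: eq_fsbigr => h _; rewrite hs_dotZl.
Qed.

(** Arrows of G_x with another range than x give vectors orthogonal to those over x, so only the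
    isotropy group remains. Thus the compression of Ind rho to the vectors at x is rho composed with
    restriction. *)
Lemma induced_unit_dot f v w : Cc f ->
  hs_dot (Pi f (e (x : G, v))) (e (x : G, w)) = hs_dot (rho (iso_restrict f) v) w.
Proof.
move=> hf; rewrite induced_dot// unit_rng.
have jlin c a b : dom a -> dom b -> rho (c *: a + b) v = c *: rho a v + rho b v.
  by move=> ha hb; exact: (rep_linear rho_rep).
rewrite (@iso_restrict_sum H0 (fun a => rho a v))//.
rewrite (fsbig_morph (phi := fun u => hs_dot u w)); last first.
- apply: sub_finite_set (@Cc_sfinite R G f x hf) => h [[_ hx] /= fh].
  split => //=; apply/eqP => f0; apply: fh; by rewrite f0 scale0r.
- by move=> a b; exact: hs_dotDl.
- exact: hs_dot0l.
rewrite -[LHS](fsbig_widen (isotropy x) (sfiber x)).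
- apply: eq_fsbigr => h /set_mem[hr hs]; rewrite hs_dotZl.
  have hx : h *_G x = h by rewrite -hs eg_mul_src.
  by rewrite hx e_dot ?unit_src ?unit_rng// inv_unit -hr eg_mul_rng.
- by move=> h [].
- move=> h [hs nh] /=; rewrite e_dot0 ?mulr0// rngM ?unit_rng// => hr.
  by apply: nh; split.
Qed.

End induced.
End restriction.

(** * Restriction is contractive; the reduced norm is below the universal one *)

Section norms.
Variables (R : realType) (G : etaleGroupoid).
Local Notation C := (CC R).
Implicit Types (g h k : G) (f : G -> C).

(** Up to vectors of no larger norm, rho(f|x) is a compression of the induced representation, whose
    norm at f is at most that of C*(G). *)
Lemma iso_restrict_norm (A : fullCstar R G) (x : unit_space G)
    (B : groupCstar R x) f : Cc f ->
  normR (cpl_in B (iso_restrict x f)) <= normR (cpl_in A f).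
Proof.
move=> hf; rewrite -lee_fin cpl_norm; last exact: iso_restrict_dom.
apply: universal_norm_le; first exact: normR_ge0.
move=> H0 rho v hrho.
have [H [Pi [e [hPi e1 e2 e3]]]] := induced_rep hrho.
set w := rho _ v; have := induced_unit_dot hrho e1 e2 e3 v w hf.
rewrite -/w => h1.
have h2 : normR w ^+ 2 <= normR (cpl_in A f) * normR v * normR w.
  rewrite -(normR_hs_dot w).
  rewrite -h1; apply: le_trans (hs_CS _ _) _.
  apply: ler_pM; rewrite ?normR_ge0//; last first.
    by apply: (normR_induced_vec hrho e1); rewrite unit_src.
  apply: le_trans (univ_rep_le A _ hPi hf) _.
  rewrite ler_wpM2l ?normR_ge0//.
  by apply: (normR_induced_vec hrho e1); rewrite unit_src.
have [w0|w0] := ltP 0 (normR w); first by rewrite expr2 ler_pM2r in h2.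
by apply: le_trans w0 _; rewrite mulr_ge0 ?normR_ge0.
Qed.

Section regular.
Variable y : unit_space G.

(** With the arrow itself as label this becomes the kernel of the orthonormal basis of l^2(G_y), the
    vectors at other arrows being zero. *)
Let reg_fun (p q : G * unit) : C := (src p.1 == (y : G))%:R * (src q.1 == (y : G))%:R.

Let reg_funC p q : reg_fun q p = (reg_fun p q)^*.
Proof. by rewrite /reg_fun rmorphM /= !conjC_nat mulrC. Qed.

Let reg_psd (s : seq (C * (G * unit))) :
  0 <= \sum_(q <- s) (q.1)^* * \sum_(p <- s) p.1 * reg_fun p.2 q.2.
Proof.
pose z : C := \sum_(p <- s) p.1 * (src p.2.1 == (y : G))%:R.
have -> : \sum_(q <- s) (q.1)^* * \sum_(p <- s) p.1 * reg_fun p.2 q.2 = z^* * z.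
  rewrite {1}/z rmorph_sum /= mulr_suml; apply: eq_bigr => q _.
  rewrite rmorphM /= conjC_nat -mulrA; congr (_ * _).
  rewrite mulr_sumr; apply: eq_bigr => p _.
  by rewrite /reg_fun mulrA mulrC.
by rewrite mulrC mulCJ (RtoC_le 0) sqr_ge0.
Qed.

Let reg_kernel : psdKernel R (G * unit) :=
  label_kernel (fun p : G * unit => p.1) reg_funC reg_psd.

Lemma regular_repr : exists (H : hilbertSpace R) (Pi : (G -> C) -> H -> H) (e : G -> H),
  [/\ @is_rep R (Cc_ops R G) H Pi,
      forall g h, src g = y -> hs_dot (e g) (e h) = (g == h)%:R &
      forall f g, Cc f ->
        Pi f (e g) = \sum_(p <- groupoid_act f (g, tt)) p.1 *: e p.2.1].
Proof.
have [||H [Pi [e [h1 h2 h3]]]] := @groupoid_rep R G unit reg_kernel.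
- move=> p q pq; rewrite /= /label_fun; case: eqP => // e.
  by case: pq; rewrite e.
- move=> g h g' [] [] hg hg'; rewrite /= /label_fun /reg_fun /=.
  have c1 : src h^-1_G = rng g' by rewrite src_inv.
  rewrite !srcM//; congr (if _ then _ else _).
  by apply/eqP/eqP => [<-|->]; [rewrite eg_mulKg|rewrite eg_mulVKg].
- exists H, Pi, (fun g => e (g, tt)); split => // [g h gy|f g hf].
    rewrite h2 /= /label_fun /reg_fun /= gy eqxx mul1r.
    case: eqP => [<-|//]; by rewrite gy eqxx.
  rewrite h3//; have := @groupoid_act_sum R G unit H f g tt (fun p => e (p.1, tt)) hf.
  by move=> /= ->.
Qed.

End regular.

(** Lets the reduced norm be read in a Hilbert space. The list may contain an arrow several times,
    so the coefficients are first collected in [eta]. *)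
Lemma fin_l2norm_sum (y : unit_space G) (H : hilbertSpace R) (e : G -> H)
    (s : seq (C * G)) :
  (forall g h, src g = y -> hs_dot (e g) (e h) = (g == h)%:R) ->
  (forall p, p \in s -> src p.2 = y) ->
  fin_l2norm (\sum_(p <- s) p.1 *: delta R p.2) = normR (\sum_(p <- s) p.1 *: e p.2).
Proof.
move=> edot sy; set eta := \sum_(p <- s) p.1 *: delta R p.2.
set z := \sum_(p <- s) p.1 *: e p.2.
have etaE k : eta k = \sum_(p <- s) p.1 * (k == p.2)%:R.
  rewrite /eta; elim: (s) => [|p t ih]; first by rewrite !big_nil.
  by rewrite !big_cons -ih.
have zdot k : src k = y -> hs_dot z (e k) = eta k.
  move=> ky; rewrite hs_dot_suml etaE !big_seq; apply: eq_bigr => p ps.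
  by rewrite hs_dotZl edot ?sy// eq_sym.
pose T := undup [seq p.2 | p <- s].
have etaT k : k \notin T -> eta k = 0.
  rewrite mem_undup etaE => kT; rewrite big_seq big1// => p ps.
  case: eqP => [kp|_]; last by rewrite mulr0.
  by move: kT; rewrite kp map_f.
have sumT : \sum_(g \in [set: G]) normR (eta g) ^+ 2 = \sum_(g <- T) normR (eta g) ^+ 2.
  rewrite -(fsbig_widen [set` T] [set: G]) => [|//|g [_ gT]] /=; last first.
    rewrite etaT ?normR0 ?expr0n//; apply/negP => gT'; exact: gT.
  by rewrite [RHS]fsbig_seq ?undup_uniq.
rewrite /fin_l2norm sumT.
suff -> : \sum_(g <- T) normR (eta g) ^+ 2 = normR z ^+ 2.
  by rewrite sqrtr_sqr ger0_norm ?normR_ge0.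
apply: complexI; rewrite -!/(RtoC _) -hs_dot_normR {2}/z hs_dot_sumr.
rewrite [in LHS](_ : RtoC _ = \sum_(g <- T) eta g * (eta g)^*); last first.
  by rewrite /RtoC rmorph_sum /=; apply: eq_bigr => g _; rewrite mulCJ.
under eq_bigr do rewrite {2}etaE rmorph_sum /= mulr_sumr.
rewrite exchange_big /= [LHS]big_seq [RHS]big_seq; apply: eq_bigr => p ps.
rewrite hs_dotZr zdot ?sy//.
rewrite (bigD1_seq p.2) ?undup_uniq ?mem_undup ?map_f//= eqxx mulr1 big1.
  by rewrite addr0 mulrC.
by move=> k /negPf ->; rewrite mulr0 rmorph0 mulr0.
Qed.

Lemma reduced_norm_le (A : fullCstar R G) f : Cc f ->
  (reduced_norm (f : Cc_ops R G) <= (normR (cpl_in A f))%:E)%E.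
Proof.
move=> hf; apply: ge_ereal_sup => _ [y [xi [fxi sxi xi1 ->]]]; rewrite lee_fin.
have [H [Pi [e [hPi edot Pie]]]] := regular_repr y.
pose S := [set g | xi g != 0].
pose s : seq G := finmap.enum_fset (fset_set S).
have sP g : g \in s -> src g = y.
  by move=> gs; apply: sxi; apply: set_mem; rewrite -(in_fset_set fxi); exact: gs.
have us : uniq s by exact: finmap.fset_uniq.
pose u := \sum_(g <- s) xi g *: e g.
have xiE : xi = \sum_(p <- [seq (xi g, g) | g <- s]) p.1 *: delta R p.2.
  apply/funext => k; rewrite big_map /=.
  have -> : (\sum_(g <- s) xi g *: delta R g) k = \sum_(g <- s) xi g * (k == g)%:R.
    by elim: (s) => [|p t ih]; [rewrite !big_nil|rewrite !big_cons -ih].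
  have [ks|ks] := boolP (k \in s).
    rewrite (bigD1_seq k)//= eqxx mulr1 big1 ?addr0// => g /negPf.
    by rewrite eq_sym => ->; rewrite mulr0.
  rewrite big_seq big1 => [|g gs]; last first.
    case: eqP => [kg|_]; last by rewrite mulr0.
    by move: ks; rewrite kg gs.
  apply/eqP; apply: contrapT => /negP xk; move/negP: ks; apply.
  have := in_fset_set fxi k; rewrite (mem_set (xk : S k)) => hk; exact: hk.
have u1 : normR u <= 1.
  have := @fin_l2norm_sum y H e [seq (xi g, g) | g <- s] edot.
  rewrite -xiE big_map /= => <- // p /mapP[g gs ->]; exact: sP.
pose s2 := [seq (xi g * p.1, p.2.1) | g <- s, p <- groupoid_act f (g, tt)].
have regE : regular_rep y f xi = \sum_(p <- s2) p.1 *: delta R p.2.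
  rewrite big_allpairs_dep /=.
  have -> : regular_rep y f xi = \sum_(g <- s) xi g *:
      \sum_(h \in sfiber (rng g)) f h *: delta R (h *_G g).
    rewrite /regular_rep -(fsbig_widen S (sfiber y)) //; last first.
      move=> g [gy /= nS]; have -> : xi g = 0; last by rewrite scale0r.
      by apply/eqP; apply: contrapT => /negP.
    by rewrite fsbig_finite.
  apply: eq_bigr => g _.
  rewrite -(@groupoid_act_sum R G unit (G -> C) f g tt (fun p => delta R p.1) hf).
  by rewrite scaler_sumr; apply: eq_bigr => p _; rewrite scalerA.
have PiE : Pi f u = \sum_(p <- s2) p.1 *: e p.2.
  rewrite big_allpairs_dep /= /u.
  have [linPi _] := rep_bounded hPi hf.
  have Pi0 : Pi f 0 = 0.
    by have := linPi 1 0 0; rewrite !scale1r addr0 => h; apply: (addrI (Pi f 0)); rewrite addr0 -h.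
  elim: (s) => [|g t ih]; first by rewrite !big_nil.
  rewrite !big_cons linPi ih Pie// scaler_sumr; congr (_ + _).
  by apply: eq_bigr => p _; rewrite scalerA.
rewrite regE (@fin_l2norm_sum y H e s2 edot) -?PiE.
  apply: le_trans (univ_rep_le A u hPi hf) _.
  by rewrite ler_piMr ?normR_ge0.
move=> p /allpairsPdep[g [q [gs qs ->]]] /=.
move: qs => /mapP[h hs ->] /=.
have fin : finite_set (sfiber (rng g) `&` f @^-1` [set~ 0]).
  apply: sub_finite_set (@Cc_sfinite R G f (rng g) hf) => k [kg fk].
  by split => //; apply/eqP.
move: hs; rewrite in_finite_support// => /set_mem[hg _].
by rewrite srcM//; exact: sP.
Qed.

End norms.

(** * The exotic norm *)

Lemma rep_cpl (R : realType) (A : starOps R) (p : A -> \bar R) (M : completion p)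
    (H : hilbertSpace R) (rho : M -> H -> H) :
  @is_rep R (cstar_ops M) H rho -> @is_rep R A H (fun a => rho (cpl_in M a)).
Proof.
move=> h; split=> [a ha|c a b xi ha hb|a b xi ha hb|a xi eta ha].
- exact: (rep_bounded h).
- by rewrite cpl_linear// (rep_linear h).
- by rewrite cpl_mul// (rep_mul h).
- by rewrite cpl_star// (rep_star h).
Qed.

Section exotic.
Variables (R : realType) (G : etaleGroupoid).
Variables (A : fullCstar R G) (Ar : reducedCstar R G) (x : unit_space G).
Variable (B : groupCstar R x).
Local Notation C := (CC R).
Implicit Types (g h k : G) (f : G -> C).

Lemma Cc_linear c f e : Cc f -> Cc e -> Cc (c *: f + e).
Proof. by move=> hf he; apply: CcD => //; exact: CcZ. Qed.

Let group_alg_linear' c (a b : group_alg_ops R x) :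
  so_dom a -> so_dom b -> so_dom (c *: a + b).
Proof. exact: group_alg_linear. Qed.

Lemma reduced_universal f : so_dom (f : Cc_ops R G) ->
  (reduced_norm (f : Cc_ops R G) <= universal_norm (f : Cc_ops R G))%E.
Proof. by move=> hf; rewrite -(cpl_norm A hf); exact: reduced_norm_le. Qed.

Lemma exotic_universal a : so_dom a ->
  (exotic_norm A Ar B a <= universal_norm (a : group_alg_ops R x))%E.
Proof.
move=> ha; rewrite -(cpl_norm B ha); apply: ge_ereal_sup => _ [H [rho [hrho _ ->]]].
apply: opnorm_le; last exact: normR_ge0.
by move=> xi; exact: (univ_rep_le B xi (rep_cpl hrho) ha).
Qed.

Section vectors.
Variables (H : hilbertSpace R) (rho : B -> H -> H).
Hypothesis hrho : @is_rep R (cstar_ops B) H rho.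

(* The vector of Ind rho that is supported on the isotropy group and equals v at x. *)
Definition coset_vec (v : H) g : H :=
  if g \in isotropy x then rho (cs_star (cpl_in B (delta R g))) v else 0.

Lemma cpl_star_delta g : isotropy x g ->
  cs_star (cpl_in B (delta R g)) = cpl_in B (delta R g^-1_G).
Proof.
by move=> gx; have := cpl_star B (group_alg_delta R gx); rewrite /= fstar_delta => ->.
Qed.

Lemma isotropyMl g h : sfiber x g -> isotropy x h ->
  isotropy x (g *_G h) <-> isotropy x g.
Proof.
move=> gx hx; split=> [gh|gx']; last exact: isotropyM.
have c : src g = rng h by rewrite hx.1.
by split => //; rewrite /rfiber /mkset -(rngM c) gh.1.
Qed.

Lemma rho0 b : rho b 0 = 0.
Proof.
have [linr _] := rep_bounded hrho (a := b) I.
by have := linr 1 0 0; rewrite !scale1r addr0 => h; apply: (addrI (rho b 0)); rewrite addr0 -h.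
Qed.

Lemma coset_vec_ind v : ind_space rho (coset_vec v).
Proof.
split=> [g h gx hx|].
  rewrite /coset_vec; case: ifPn => [/set_mem gh|ngh]; last first.
    rewrite ifF ?rho0//; apply/negP => /set_mem gx'.
    by move/negP: ngh; apply; apply: mem_set; apply/isotropyMl.
  have gx' := (isotropyMl gx hx).1 gh.
  rewrite mem_set// !cpl_star_delta//.
  have c : src g = rng h by rewrite gx hx.1.
  have hi := isotropy_inv hx; have gi := isotropy_inv gx'.
  have e := rep_mul (rep_cpl hrho) v (group_alg_delta R hi) (group_alg_delta R gi).
  by rewrite /= conv_delta ?src_inv ?rng_inv// in e; rewrite eg_invM.
pose M : R := normR v ^+ 2.
have bound g : isotropy x g -> normR (coset_vec v g) <= normR v.
  move=> gx; rewrite /coset_vec mem_set// cpl_star_delta//.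
  have gi := isotropy_inv gx.
  have := hs_dot_normR (rho (cpl_in B (delta R g^-1_G)) v).
  rewrite (rho_delta_dot (rep_cpl hrho) v v gi gi) eg_mulVg src_inv gx.1 => h1.
  have : normR (rho (cpl_in B (delta R g^-1_G)) v) ^+ 2 <= normR v ^+ 2.
    have -> : normR (rho (cpl_in B (delta R g^-1_G)) v) ^+ 2 =
        normR (hs_dot (rho (cpl_in B (delta R (x : G))) v) v).
      by rewrite h1 normR_RtoC ger0_norm ?sqr_ge0.
    apply: le_trans (hs_CS _ _) _; rewrite expr2 ler_wpM2r ?normR_ge0//.
    exact: (rep_delta_unit (rep_cpl hrho)).
  by rewrite ler_pXn2r ?nnegrE ?normR_ge0.
apply: (@le_lt_trans _ _ M%:E); last exact: ltry.
(* Of all cosets only the isotropy group carries nonzero values, so the sum over cosets is at most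
   |v|^2. *)
pose c0 : set G := isotropy x.
have c0c : cosets x c0.
  exists (x : G); first by rewrite /sfiber /mkset unit_src.
  apply/seteqP; split=> [_ [h hx <-]|h hx].
    by apply: isotropyM => //; exact: isotropy_unit.
  by exists h => //; rewrite -hx.1 eg_mul_rng.
apply: (@le_trans _ _ (\esum_(c in cosets x) if c \in [set c0] then M%:E else 0%E)).
  apply: le_esum => c [g gx cg]; apply: ge_ereal_sup => _ [k ck <-].
  have [kx|nkx] := pselect (isotropy x k); last first.
    have -> : coset_vec v k = 0.
      by rewrite /coset_vec ifF//; apply/negP => /set_mem.
    rewrite normR0 expr0n /=; case: ifP => // _; rewrite lee_fin sqr_ge0//.
  have -> : c = c0.
    move: ck; rewrite -cg => -[h hx kgh].
    have gx' : isotropy x g by apply/(isotropyMl gx hx); rewrite kgh.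
    apply/seteqP; split=> [_ [l lx <-]|l lx]; first exact: isotropyM.
    exists (g^-1_G *_G l); last by rewrite eg_mulVKg// gx'.1 lx.1.
    by apply: isotropyM => //; exact: isotropy_inv.
  rewrite mem_set// lee_fin ler_pXn2r ?nnegrE ?normR_ge0//.
  exact: bound.
rewrite -esum_mkcondr (_ : _ `&` _ = [set c0]).
  by rewrite esum_set1// lee_fin sqr_ge0.
by apply/seteqP; split=> [c []//|_ ->].
Qed.

(** The terms off the isotropy group vanish, and for h in it the vector has the value rho(u_h) v at
    h^-1. *)
Lemma coset_vec_ind_Cc v f : Cc f ->
  ind_Cc (coset_vec v) x f = rho (cpl_in B (iso_restrict x f)) v.
Proof.
move=> hf.
rewrite (@iso_restrict_sum R G x H (fun a => rho (cpl_in B a) v))//; last first.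
  by move=> c a b ha hb; exact: (rep_linear (rep_cpl hrho)).
rewrite /ind_Cc unit_rng -[LHS](fsbig_widen (isotropy x) (rfiber x)).
- apply: eq_fsbigr => h /set_mem hx.
  have -> : h^-1_G *_G x = h^-1_G.
    by rewrite -{1}hx.1 -src_inv eg_mul_src.
  have hi := isotropy_inv hx.
  by rewrite /coset_vec mem_set// cpl_star_delta// eg_invK.
- by move=> h [].
- move=> h [hr nh] /=; rewrite /coset_vec ifF ?scaler0//; apply/negP => /set_mem.
  have -> : h^-1_G *_G x = h^-1_G.
    by rewrite -[X in _ *_G X]hr -src_inv eg_mul_src.
  by move=> /isotropy_inv; rewrite eg_invK.
Qed.

End vectors.

(** The value at x of Ind rho applied to [coset_vec v] is a |v|-Lipschitz function of f, and its
    extension vanishes at a. *)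
Lemma exotic_restrict_le (a : A) f : cpl_surj A Ar a = 0 -> Cc f ->
  (exotic_norm A Ar B (iso_restrict x f) <= (normR (a - cpl_in A f))%:E)%E.
Proof.
move=> qa hf; apply: ge_ereal_sup => _ [H [rho [hrho fac ->]]].
apply: opnorm_le => [v|]; last exact: normR_ge0.
have e0 := fac a qa _ (coset_vec_ind hrho v) (x : G) (unit_src x).
rewrite -(coset_vec_ind_Cc hrho)// -[X in normR X]subr0 -e0 -normRN opprB mulrC.
apply: cpl_ext_dist => //.
- by move=> F FF cF; exact: cauchy_cvg.
- exact: normR_ge0.
- move=> f1 f2 h1 h2; rewrite !coset_vec_ind_Cc//.
  have d1 := iso_restrict_dom x h1; have d2 := iso_restrict_dom x h2.
  have d12 := iso_restrict_dom x (CcB h1 h2).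
  have rB : rho (cpl_in B (iso_restrict x f1)) v - rho (cpl_in B (iso_restrict x f2)) v =
      rho (cpl_in B (iso_restrict x (f1 - f2))) v.
    rewrite iso_restrictB (cpl_inB B d1 d2).
    rewrite -[in RHS]scaleN1r [in RHS]addrC (rep_linear hrho)//.
    by rewrite scaleN1r addrC.
  rewrite rB mulrC; apply: le_trans (univ_rep_le B v (rep_cpl hrho) d12) _.
  rewrite ler_wpM2r ?normR_ge0//; apply: le_trans (iso_restrict_norm A B (CcB h1 h2)) _.
  by rewrite (cpl_inB A h1 h2).
Qed.

(** The restriction of a is constructed as the limit b of the restrictions of some f_n -> a. It is
    killed in the exotic completion, hence phi(b) = 0, and phi(f|x) = phi(f|x - b) is bounded by |a
    - f| because restriction is contractive. *)
Lemma state_restrict_le (Be : exoticCstar A Ar B) (phi : B -> C) (a : A) f :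
  is_state phi -> state_factors (cpl_surj B Be) phi ->
  cpl_surj A Ar a = 0 -> Cc f ->
  normR (phi (cpl_in B (iso_restrict x f))) <= normR (a - cpl_in A f).
Proof.
move=> sphi fac qa hf.
have /choice[F hF] n : exists f, Cc f /\ normR (a - cpl_in A f) < n.+1%:R^-1.
  have [|f' hf' fe] := cpl_approx a (_ : 0 < n.+1%:R^-1); first by rewrite invr_gt0.
  by exists f'.
pose r f := cpl_in B (iso_restrict x f).
have rdist f1 f2 : Cc f1 -> Cc f2 ->
    normR (r f1 - r f2) <= normR (cpl_in A f1 - cpl_in A f2).
  move=> h1 h2; have d1 := iso_restrict_dom x h1; have d2 := iso_restrict_dom x h2.
  rewrite /r -(cpl_inB B d1 d2) -iso_restrictB.
  apply: le_trans (iso_restrict_norm A B (CcB h1 h2)) _.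
  by rewrite (cpl_inB A h1 h2).
have /cvg_ex[b hb] : cvg ((fun n => r (F n)) @ \oo).
  apply: cauchy_cvg; apply/cauchy_normR => e e0.
  have [N _ hN] := near_invn_lt (divr_gt0 e0 (ltr0n R 2)).
  have h : \forall n \near \oo, (N <= n)%N by exists N.
  exists [set r (F n) | n in [set n | (N <= n)%N]].
    by apply: filterS h => n Nn; exists n.
  move=> _ _ [n /= Nn <-] [m /= Nm <-].
  apply: le_lt_trans (rdist _ _ (hF n).1 (hF m).1) _.
  apply: le_lt_trans (normR_tri a _ _) _.
  have := hN n Nn; have := hN m Nm; have := (hF n).2; have := (hF m).2 => /=.
  move: (n.+1%:R^-1) (m.+1%:R^-1) => u v; lra.
have near_b e : 0 < e -> exists n, normR (b - r (F n)) < e /\ n.+1%:R^-1 < e.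
  move=> e0; have /nearP_normR/(_ _ e0) h := hb.
  exact: filter_ex (filterI h (near_invn_lt e0)).
have qb : cpl_surj B Be b = 0.
  apply/(cpl_surj_eq0 group_alg_linear' Be exotic_universal) => e e0.
  have [n [h1 h2]] := near_b e e0; have [hn1 hn2] := hF n.
  exists (iso_restrict x (F n)); split; [exact: iso_restrict_dom|exact: ltW|].
  rewrite -lee_fin cpl_norm; last exact: iso_restrict_dom.
  apply: le_trans (exotic_restrict_le qa hn1) _; rewrite lee_fin.
  by apply: ltW; exact: lt_trans h2.
rewrite -[phi _]subr0 -(fac b qb) -(stateB sphi).
apply: le_trans (state_le sphi _) _; rewrite -/(r f).
apply/ler_addgt0Pr => e e0.
have e2 : 0 < e / 2 by rewrite divr_gt0.
have [n [h1 h2]] := near_b _ e2; have [hn1 hn2] := hF n.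
have -> : r f - b = (r f - r (F n)) - (b - r (F n)).
  by rewrite opprB addrA subrK.
apply: le_trans (normRB _ _) _.
have h3 := rdist _ _ hf hn1.
have h4 := normR_tri a (cpl_in A f) (cpl_in A (F n)).
apply: le_trans (lerD h3 (ltW h1)) _.
apply: le_trans (lerD h4 (lexx _)) _; rewrite -addrA lerD2l.
by rewrite [leRHS](splitr e) lerD2r; apply: ltW; exact: lt_trans h2.
Qed.

End exotic.

Lemma pythagoras (R : realType) (H : hilbertSpace R) (I : eqType) (s : seq I)
    (z : I -> H) : uniq s ->
  (forall i j, i \in s -> j \in s -> i != j -> hs_dot (z i) (z j) = 0) ->
  normR (\sum_(i <- s) z i) ^+ 2 = \sum_(i <- s) normR (z i) ^+ 2.
Proof.
move=> us z0; apply: complexI; rewrite -!/(RtoC _) -hs_dot_normR hs_dot_suml.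
rewrite [RHS]rmorph_sum /=; rewrite [LHS]big_seq [RHS]big_seq; apply: eq_bigr => i si.
rewrite hs_dot_sumr (bigD1_seq i)//= -[RHS]/(RtoC _) -hs_dot_normR.
by rewrite big_seq_cond big1 ?addr0// => j /andP[js ji]; apply: z0; rewrite // eq_sym.
Qed.

(** * The function space L and the kernel model *)

Section induced.
Variables (R : realType) (G : etaleGroupoid) (x : unit_space G) (B : groupCstar R x).
Local Notation C := (CC R).
Implicit Types (g h k : G) (f : G -> C).
Variables (H0 : hilbertSpace R) (rho : B -> H0 -> H0).
Hypothesis hrho : @is_rep R (cstar_ops B) H0 rho.
Let rho_rep := rep_cpl hrho.
Variables (H : hilbertSpace R) (Pi : (G -> C) -> H -> H) (e : G * H0 -> H).
Hypothesis Pi_rep : @is_rep R (Cc_ops R G) H Pi.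
Hypothesis e_dot : forall g g' w w', src g = x -> src g' = x -> rng g = rng g' ->
  hs_dot (e (g, w)) (e (g', w')) =
  hs_dot (rho (cpl_in B (delta R (g'^-1_G *_G g))) w) w'.
Hypothesis e_dot0 : forall g g' w w', rng g <> rng g' ->
  hs_dot (e (g, w)) (e (g', w')) = 0.
Hypothesis Pi_e : forall f g w, Cc f ->
  Pi f (e (g, w)) = \sum_(h \in sfiber (rng g)) f h *: e (h *_G g, w).

(** On the coset of t the function xi acts as the vector e(t, xi t): this is how elements of L enter
    the kernel model. *)
Lemma ind_space_dot xi w k t : ind_space rho xi -> src k = x -> src t = x ->
  rng k = rng t -> hs_dot (xi k) w = hs_dot (e (t, xi t)) (e (k, w)).
Proof.
move=> [hxi _] kx tx kt.
have ix : isotropy x (t^-1_G *_G k) by exact: isotropy_quo.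
rewrite -{1}(@eg_mulVKg _ t k)// hxi// hs_dotC.
rewrite (hs_dotC (e (k, w))) e_dot//; congr (_^*).
have := rep_star hrho (a := cpl_in B (delta R (t^-1_G *_G k))) w (xi t) I => <-.
by [].
Qed.

(* The left-hand side is |<zeta, Pi(f^* ) e(g, w)>|, where zeta collects one vector
   e(t, xi t) for each of the finitely many cosets met by the support of f. *)
Lemma ind_Cc_dot_le xi g f w : ind_space rho xi -> src g = x -> Cc f ->
  normR (hs_dot (ind_Cc xi g f) w) <=
  Num.sqrt (fine (\esum_(c in cosets x)
       ereal_sup [set (normR (xi g) ^+ 2)%:E | g in c])%E) * normR (Pi (fstar f) (e (g, w))).
Proof.
move=> hxi gx hf; set L := fine _.
(* One arrow of G_x over each range, that is, a representative of each coset. *)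
pose t (y : G) := xget point [set k | src k = x /\ rng k = y].
have tP k : src k = x -> src (t (rng k)) = x /\ rng (t (rng k)) = rng k.
  by move=> kx; rewrite /t; case: xgetP => [l -> []//|/(_ k)]; case.
have hf' := Cc_fstar hf; have fS := @Cc_sfinite R G _ (rng g) hf'.
pose s : seq G := finite_support 0 (sfiber (rng g)) (fstar f).
have sumE (V : nmodType) (F : G -> V) : (forall h, fstar f h = 0 -> F h = 0) ->
    \sum_(h \in sfiber (rng g)) F h = \sum_(h <- s) F h.
  by move=> F0; rewrite fsbig_supportE// => h _; exact: F0.
have sS k : k \in s -> src k = rng g.
  rewrite in_finite_support => [/set_mem[]//|].
  by apply: sub_finite_set fS => h [hx /eqP].
pose Y := undup [seq rng k | k <- s].
pose z y := e (t y, xi (t y)).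
have Yt y : y \in Y -> src (t y) = x /\ rng (t y) = y.
  rewrite mem_undup => /mapP[k /sS ks ->].
  have kgx : src (k *_G g) = x by rewrite srcM.
  by have := tP _ kgx; rewrite rngM.
have zdot y k v : y \in Y -> rng k <> y -> hs_dot (z y) (e (k, v)) = 0.
  by move=> /Yt[_ yt] ky; apply: e_dot0; rewrite yt => /esym.
set zeta := \sum_(y <- Y) z y.
have -> : hs_dot (ind_Cc xi g f) w = hs_dot zeta (Pi (fstar f) (e (g, w))).
  have -> : ind_Cc xi g f = \sum_(h <- s) (fstar f h)^* *: xi (h *_G g).
    rewrite -sumE => [|h ->]; last by rewrite conjC0 scale0r.
    rewrite reindex_inv; apply: eq_fsbigr => h _.
    by rewrite /fstar eg_invK conjCK.
  rewrite Pi_e// sumE => [|h ->]; last by rewrite scale0r.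
  rewrite hs_dot_suml hs_dot_sumr big_seq [RHS]big_seq; apply: eq_bigr => k ks.
  have kg := sS k ks; have rkg : rng (k *_G g) = rng k by rewrite rngM.
  have kgx : src (k *_G g) = x by rewrite srcM.
  have kY : rng k \in Y by rewrite mem_undup map_f.
  rewrite hs_dotZl hs_dotZr; congr (_ * _).
  have [ty ry] := Yt _ kY.
  rewrite (@ind_space_dot xi w (k *_G g) (t (rng k)) hxi kgx ty); last by rewrite ry rkg.
  rewrite /zeta hs_dot_suml (bigD1_seq (rng k)) ?undup_uniq//= big_seq_cond big1 ?addr0//.
  by move=> y /andP[yY yk]; apply: zdot => //; rewrite rkg; apply/eqP; rewrite eq_sym.
apply: le_trans (hs_CS _ _) _; rewrite ler_wpM2r ?normR_ge0//.
rewrite -[leLHS]ger0_norm ?normR_ge0// -sqrtr_sqr; apply: ler_wsqrtr.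
rewrite pythagoras ?undup_uniq//; last first.
  move=> y y' yY y'Y yy'; apply: zdot => //; have [_ ->] := Yt _ y'Y.
  by apply/eqP; rewrite eq_sym.
have finL : (\esum_(c in cosets x) ereal_sup [set (normR (xi g) ^+ 2)%:E | g in c] < +oo)%E.
  by case: hxi.
(* The cosets of the representatives are distinct, so the sum of the |xi(t y)|^2 is at most the sum
   over all cosets. *)
pose c y : set G := [set t y *_G h | h in isotropy x].
have ct y : y \in Y -> c y (t y).
  move=> /Yt[ty _]; exists (x : G); first exact: isotropy_unit.
  by rewrite -ty eg_mul_src.
have cinj : {in Y &, injective c}.
  move=> y y' yY y'Y cc; have : c y' (t y) by rewrite -cc; exact: ct.
  move=> -[h hx]; have [ty ry] := Yt _ yY; have [ty' ry'] := Yt _ y'Y.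
  by move=> /(congr1 (@rng G)); rewrite rngM ?ry ?ry'// ty' hx.1.
have sup_ge y : y \in Y ->
    ((normR (xi (t y)) ^+ 2)%:E <= ereal_sup [set (normR (xi g) ^+ 2)%:E | g in c y])%E.
  by move=> yY; apply: ereal_sup_ubound; exists (t y) => //; exact: ct.
have sup0 d : cosets x d -> (0 <= ereal_sup [set (normR (xi g) ^+ 2)%:E | g in d])%E.
  move=> [k kx <-]; apply: le_trans (_ : ((normR (xi (k *_G x)) ^+ 2)%:E <= _)%E).
    by rewrite lee_fin sqr_ge0.
  by apply: ereal_sup_ubound; exists (k *_G x) => //; exists (x : G) => //; exact: isotropy_unit.
have Lsum : (\sum_(y <- Y) (normR (xi (t y)) ^+ 2)%:E <=
    \esum_(c in cosets x) ereal_sup [set (normR (xi g) ^+ 2)%:E | g in c])%E.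
  apply: esum_ge; exists [set` [seq c y | y <- Y]].
    split; first exact: finite_seq.
    by move=> d /= /mapP[y yY ->]; exists (t y) => //; case: (Yt _ yY).
  rewrite -fsbig_seq; last by rewrite map_inj_in_uniq ?undup_uniq.
  by rewrite big_map big_seq [leRHS]big_seq; apply: lee_sum => y yY; exact: sup_ge.
have L0 : (0 <= \esum_(c in cosets x) ereal_sup [set (normR (xi g) ^+ 2)%:E | g in c])%E.
  by apply: esum_ge0.
apply: le_trans (_ : \sum_(y <- Y) normR (xi (t y)) ^+ 2 <= L).
  rewrite big_seq [leRHS]big_seq; apply: ler_sum => y /Yt[ty ry].
  rewrite ler_pXn2r ?nnegrE ?normR_ge0//.
  exact: (normR_induced_vec rho_rep e_dot).
by rewrite -lee_fin /L fineK ?ge0_fin_numE// -sumEFin.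
Qed.

End induced.

(** A bump on a section isolates an arrow in its range fibre; taken at g^-1 and followed by the
    involution, it isolates g in its source fibre. *)
Lemma Cc_delta_bump (R : realType) (G : etaleGroupoid) (g : G) :
  exists2 e : G -> CC R, Cc e & forall h, src h = src g -> e h = (h == g)%:R.
Proof.
have [V [K [e [[oV _] [rV Vg] [cK KV] e1 [cV e0]]]]] :=
  @rsection_bump R G setT g^-1_G openT I.
exists (fstar e) => [|h hg].
  apply/Cc_fstar/Cc_section_Cc; exists V; split => //; apply/Cc_onE => //.
  by split=> [//|k nV|]; [apply: e0 => /KV|exists K].
rewrite /fstar; have [->|hg'] := eqVneq h g.
  by rewrite (nbhs_singleton e1) conjC1.
rewrite e0 ?conjC0// => /KV Vh; move/eqP: hg'; apply.
by rewrite -[h]eg_invK -[g]eg_invK (rV _ _ Vh Vg)// !rng_inv.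
Qed.

Section induced.
Variables (R : realType) (G : etaleGroupoid) (A : fullCstar R G) (Ar : reducedCstar R G).
Variables (x : unit_space G) (B : groupCstar R x).
Local Notation C := (CC R).
Implicit Types (g h k : G) (f : G -> C).
Variables (H0 : hilbertSpace R) (rho : B -> H0 -> H0).
Hypothesis hrho : @is_rep R (cstar_ops B) H0 rho.
Let rho_rep := rep_cpl hrho.
Variables (H : hilbertSpace R) (Pi : (G -> C) -> H -> H) (e : G * H0 -> H).
Hypothesis Pi_rep : @is_rep R (Cc_ops R G) H Pi.
Hypothesis e_dot : forall g g' w w', src g = x -> src g' = x -> rng g = rng g' ->
  hs_dot (e (g, w)) (e (g', w')) =
  hs_dot (rho (cpl_in B (delta R (g'^-1_G *_G g))) w) w'.
Hypothesis e_dot0 : forall g g' w w', rng g <> rng g' ->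
  hs_dot (e (g, w)) (e (g', w')) = 0.
Hypothesis Pi_e : forall f g w, Cc f ->
  Pi f (e (g, w)) = \sum_(h \in sfiber (rng g)) f h *: e (h *_G g, w).

Lemma ind_CcB (xi : G -> H0) g f1 f2 : Cc f1 -> Cc f2 ->
  ind_Cc xi g (f1 - f2) = ind_Cc xi g f1 - ind_Cc xi g f2.
Proof.
move=> h1 h2; have dotE f w : Cc f -> hs_dot (ind_Cc xi g f) w =
    \sum_(h \in rfiber (rng g)) f h * hs_dot (xi (h^-1_G *_G g)) w.
  move=> hf; rewrite /ind_Cc (fsbig_morph (phi := fun u => hs_dot u w)).
  - by apply: eq_fsbigr => h _; rewrite hs_dotZl.
  - by rewrite hs_dot0l.
  - by move=> a b; rewrite hs_dotDl.
  - apply: sub_finite_set (@Cc_rfinite R G f (rng g) hf) => h [hr fh].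
    by split=> //; apply/eqP => f0; apply: fh; rewrite f0 scale0r.
apply/eqP; rewrite -subr_eq0; apply/eqP; apply: hs_dot_eq0 => w.
rewrite !hs_dotBl !dotE//; last exact: CcB.
rewrite [X in X - _](_ : _ = \sum_(h \in rfiber (rng g))
  ((-1) * (f2 h * hs_dot (xi (h^-1_G *_G g)) w) + f1 h * hs_dot (xi (h^-1_G *_G g)) w)).
  rewrite fsbig_linear; [|exact/finite_setI_supp/Cc_rfinite..].
  by rewrite mulN1r [X in X - _]addrC subrr.
apply: eq_fsbigr => h _.
transitivity ((f1 h - f2 h) * hs_dot (xi (h^-1_G *_G g)) w) => //.
by rewrite mulrBl mulN1r addrC.
Qed.

(** This makes the limit in [ind_rep] exist. The difference u is tested against u itself. *)
Lemma ind_Cc_lipschitz xi g f1 f2 : ind_space rho xi -> src g = x -> Cc f1 -> Cc f2 ->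
  normR (ind_Cc xi g f1 - ind_Cc xi g f2) <=
  Num.sqrt (fine (\esum_(c in cosets x)
       ereal_sup [set (normR (xi g) ^+ 2)%:E | g in c])%E) *
  normR (cpl_in A f1 - cpl_in A f2).
Proof.
move=> hxi gx h1 h2; rewrite -ind_CcB//; have h12 := CcB h1 h2.
set u := ind_Cc _ _ _; set L := Num.sqrt _.
have hu : normR u ^+ 2 <= L * normR (cpl_in A f1 - cpl_in A f2) * normR u.
  rewrite -(normR_hs_dot u).
  apply: le_trans (ind_Cc_dot_le hrho e_dot e_dot0 Pi_e u hxi gx h12) _.
  rewrite -mulrA ler_wpM2l ?sqrtr_ge0//.
  apply: le_trans (univ_rep_le A _ Pi_rep (Cc_fstar h12)) _.
  have -> : normR (cpl_in A (fstar (f1 - f2))) = normR (cpl_in A f1 - cpl_in A f2).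
    by have := cpl_star A h12 => /= ->; rewrite normR_star (cpl_inB A h1 h2).
  by rewrite ler_wpM2l ?normR_ge0// (normR_induced_vec rho_rep e_dot).
have [u0|u0] := ltP 0 (normR u); first by rewrite expr2 ler_pM2r in hu.
by apply: le_trans u0 _; rewrite mulr_ge0 ?normR_ge0 ?sqrtr_ge0.
Qed.

(** M may depend on g, w and d, and the term in d leaves room to replace w by a nearby vector. The
    hypothesis is used at the adjoint of a, because [ind_Cc_dot_le] moves f to the other side of the
    inner product. *)
Lemma ind_factors_of_small :
  (forall a, cpl_surj A Ar a = 0 -> forall g w (d : R), src g = x -> 0 < d ->
    exists2 M : R, 0 <= M & forall f, Cc f ->
      normR (Pi f (e (g, w))) <= M * normR (a - cpl_in A f) + d * normR (cpl_in A f)) ->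
  ind_factors A Ar rho.
Proof.
move=> small a qa xi hxi g gx; set u := ind_rep a xi g.
pose L := Num.sqrt (fine (\esum_(c in cosets x)
       ereal_sup [set (normR (xi g) ^+ 2)%:E | g in c])%E).
have L0 : 0 <= L by exact: sqrtr_ge0.
have qa' : cpl_surj A Ar (cs_star a) = 0.
  apply: (cpl_surj_star0 _ _ _ qa).
  - by move=> c f1 f2; exact: Cc_linear.
  - exact: (reduced_universal A).
  - by move=> f; exact: Cc_fstar.
have dist f : Cc f -> normR (u - ind_Cc xi g f) <= L * normR (a - cpl_in A f).
  move=> hf; apply: cpl_ext_dist => //.
    by move=> F FF cF; exact: cauchy_cvg.
  by move=> f1 f2 h1 h2; exact: ind_Cc_lipschitz.
have key (d : R) : 0 < d -> normR u ^+ 2 <= L * (d * (normR a + 2)).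
  move=> d0; have [M M0 hM] := small _ qa' g u d gx d0.
  (* Precision for f: t <= 1 keeps |f| below |a| + 1, and the other bound makes t (|u| + M) at most
     d; together the error is d (|a| + 2). *)
  pose t := Num.min 1 (d / (normR u + M + 1)).
  have D0 : 0 < normR u + M + 1 by have := normR_ge0 u; lra.
  have t0 : 0 < t by rewrite lt_min ltr01 divr_gt0.
  have t1 : t <= 1 by rewrite ge_min lexx.
  have tD : t * (normR u + M) <= d.
    apply: le_trans (_ : t * (normR u + M + 1) <= _); first by rewrite ler_wpM2l ?(ltW t0)//; lra.
    by rewrite -ler_pdivlMr// ge_min lexx orbT.
  have [f hf ft] := cpl_approx a t0.
  have hf' := Cc_fstar hf.
  have sE : cpl_in A (fstar f) = cs_star (cpl_in A f) by exact: (cpl_star A hf).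
  have e1 : normR (cs_star a - cpl_in A (fstar f)) = normR (a - cpl_in A f).
    by rewrite sE -cs_starB normR_star.
  have nf : normR (cpl_in A f) <= normR a + 1.
    have := normR_dist a (cpl_in A f); rewrite distrC => h.
    have := ler_norm (normR (cpl_in A f) - normR a); move: h; move: (`|_|) => w.
    move: ft t1; move: (normR (a - _)) (normR (cpl_in A f)) (normR a) => p q r; lra.
  have nf' : normR (cpl_in A (fstar f)) = normR (cpl_in A f) by rewrite sE normR_star.
  have h1 := hM _ hf'; rewrite e1 nf' in h1.
  have h2 : normR u ^+ 2 <= normR (u - ind_Cc xi g f) * normR u + normR (hs_dot (ind_Cc xi g f) u).
    have -> : normR u ^+ 2 = normR (hs_dot (u - ind_Cc xi g f) u + hs_dot (ind_Cc xi g f) u).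
      by rewrite -hs_dotDl subrK normR_hs_dot.
    by apply: le_trans (normRD _ _) _; rewrite lerD2r; exact: hs_CS.
  apply: le_trans h2 _.
  have h3 := ind_Cc_dot_le hrho e_dot e_dot0 Pi_e u hxi gx hf.
  rewrite -/L in h3.
  apply: le_trans (lerD (ler_wpM2r (normR_ge0 u) (dist f hf)) h3) _.
  rewrite -mulrA -mulrDr ler_wpM2l//.
  apply: le_trans (_ : t * normR u + (M * t + d * (normR a + 1)) <= _).
    apply: lerD; first by rewrite ler_wpM2r ?normR_ge0// (ltW ft).
    apply: le_trans h1 _; apply: lerD; first by rewrite ler_wpM2l// (ltW ft).
    by rewrite ler_wpM2l// ltW.
  have := tD; rewrite mulrDr; move: (t * normR u) (normR a) => p q.
  by rewrite (mulrC M); move: (t * M) => r; lra.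
apply: normR_eq0; apply/eqP; rewrite -sqrf_eq0 eq_le sqr_ge0 andbT.
apply: (@le_mul_small _ _ (L * (normR a + 2))) => [|d d0 _].
  by rewrite mulr_ge0// addr_ge0// normR_ge0.
by rewrite mulrCA; exact: key.
Qed.

End induced.

(** * The unit of the group algebra and the cyclic GNS vector *)

Section gns_group.
Variables (R : realType) (G : etaleGroupoid) (x : unit_space G) (B : groupCstar R x).
Local Notation C := (CC R).
Local Notation one := (cpl_in B (delta R (x : G))).

Lemma group_unit_r (b : B) : cs_mul b one = b.
Proof.
have dx := @group_alg_delta R G x (x : G) (isotropy_unit x).
have e0 (f : G -> C) : @so_dom R (group_alg_ops R x) f ->
    cs_mul (cpl_in B f) one = cpl_in B f.
  move=> hf; transitivity (\sum_(g \in isotropy x) f g *: cs_mul (cpl_in B (delta R g)) one).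
    apply: (group_alg_sum (j := fun a => cs_mul (cpl_in B a) one)) => // c a1 a2 h1 h2.
    by rewrite (cpl_linear B)// cs_mul_linearl.
  rewrite (@group_alg_sum R G x B (cpl_in B) f _ hf); last first.
    by move=> c a1 a2 h1 h2; exact: (cpl_linear B).
  apply: eq_fsbigr => g /set_mem gx; congr (_ *: _).
  have c : src g = rng x by rewrite gx.2 unit_rng.
  have gxg : g *_G x = g by rewrite -[X in _ *_G X]gx.2 eg_mul_src.
  by have := cpl_mul B (group_alg_delta R gx) dx; rewrite /= conv_delta// gxg => <-.
apply/eqP; rewrite -subr_eq0; apply/eqP/normR_eq0/eqP.
rewrite eq_le normR_ge0 andbT.
apply: (@le_mul_small _ _ (normR one + 1)) => [|d d0 _].
  by rewrite addr_ge0 ?normR_ge0.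
have [f hf fd] := cpl_approx b d0.
have -> : cs_mul b one - b = cs_mul (b - cpl_in B f) one - (b - cpl_in B f).
  by rewrite cs_mulBl e0// opprB addrA subrK.
apply: le_trans (normRB _ _) _; rewrite mulrDr mulr1.
apply: lerD; last exact: ltW.
by apply: le_trans (normR_mul _ _) _; rewrite ler_wpM2r ?normR_ge0// ltW.
Qed.

Lemma group_unit_star : cs_star one = one.
Proof. by rewrite cpl_star_delta ?inv_unit//; exact: isotropy_unit. Qed.

Lemma group_unit_l (b : B) : cs_mul one b = b.
Proof.
rewrite -[RHS]cs_starK -[in RHS](group_unit_r (cs_star b)).
by rewrite cs_starM cs_starK group_unit_star.
Qed.

Lemma group_unit_norm : normR one <= 1.
Proof.
have h := normR_starM one; rewrite group_unit_star group_unit_r in h.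
rewrite leNgt; apply/negP => h1; have := ltr_pM2r (lt_trans ltr01 h1) 1 (normR one).
by rewrite mul1r -expr2 -h ltxx h1.
Qed.

Lemma gns_cyclic (phi : B -> C) : is_state phi ->
  exists (H0 : hilbertSpace R) (rho : B -> H0 -> H0) (v : H0),
  [/\ @is_rep R (cstar_ops B) H0 rho, forall b, hs_dot (rho b v) v = phi b,
      normR v <= 1 &
      forall w (d : R), 0 < d -> exists2 f, so_dom f & normR (w - rho (cpl_in B f) v) <= d].
Proof.
move=> sphi; have [H0 [rho [e [hrho edot rhoe edense]]]] := gns sphi.
have e1 b : rho b (e one) = e b by rewrite rhoe group_unit_r.
have elin c a b : e (c *: a + b) = c *: e a + e b.
  by rewrite -(e1 a) -(e1 b) -(rep_linear hrho)// e1.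
have eB a b : e (a - b) = e a - e b.
  have -> : a - b = (-1) *: b + a by rewrite scaleN1r [LHS]addrC.
  by rewrite elin scaleN1r [LHS]addrC.
have enorm a : normR (e a) <= normR a.
  rewrite -(@ler_pXn2r _ 2)// ?nnegrE ?normR_ge0//.
  rewrite -(normR_hs_dot (e a)).
  by rewrite edot; apply: le_trans (state_le sphi _) _; rewrite normR_starM.
exists H0, rho, (e one); split=> //.
- by move=> b; rewrite e1 edot group_unit_star group_unit_l.
- exact: le_trans (enorm _) group_unit_norm.
- move=> w d d0; have d2 : 0 < d / 2 by rewrite divr_gt0.
  have [s hs] := edense w _ d2.
  have sE : \sum_(p <- s) p.1 *: e p.2 = e (\sum_(p <- s) p.1 *: p.2).
    elim: (s) => [|p t ih]; first by rewrite !big_nil; have := eB 0 0; rewrite !subrr.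
    by rewrite !big_cons elin ih.
  have [f hf ft] := cpl_approx (\sum_(p <- s) p.1 *: p.2) d2.
  exists f => //; rewrite e1.
  have -> : w - e (cpl_in B f) =
      (w - \sum_(p <- s) p.1 *: e p.2) + e (\sum_(p <- s) p.1 *: p.2 - cpl_in B f).
    by rewrite eB sE addrA subrK.
  rewrite [leRHS](splitr d); apply: le_trans (normRD _ _) _.
  by apply: lerD => //; apply: le_trans (enorm _) _; exact: ltW.
Qed.

End gns_group.

Section state_size.
Variables (R : realType) (G : etaleGroupoid) (x : unit_space G) (B : groupCstar R x).
Local Notation C := (CC R).
Implicit Types (g h k : G) (f : G -> C).
Variable phi : B -> C.

(** The quantity beta_x(f), expressed by phi alone: no GNS space has to be chosen, and its square is
    the integrand in the formula for the state of C*(G) at f^* f. *)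
Definition state_size f : R :=
  Num.sqrt (complex.Re (phi (cpl_in B (iso_restrict x (conv (fstar f) f))))).

Section induced.
Variables (H0 : hilbertSpace R) (rho : B -> H0 -> H0) (v : H0).
Hypothesis hrho : @is_rep R (cstar_ops B) H0 rho.
Let rho_rep := rep_cpl hrho.
Hypothesis rho_dot : forall b, hs_dot (rho b v) v = phi b.
Hypothesis v_le1 : normR v <= 1.
Variables (H : hilbertSpace R) (Pi : (G -> C) -> H -> H) (e : G * H0 -> H).
Hypothesis Pi_rep : @is_rep R (Cc_ops R G) H Pi.
Hypothesis e_dot : forall g g' w w', src g = x -> src g' = x -> rng g = rng g' ->
  hs_dot (e (g, w)) (e (g', w')) =
  hs_dot (rho (cpl_in B (delta R (g'^-1_G *_G g))) w) w'.
Hypothesis e_dot0 : forall g g' w w', rng g <> rng g' ->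
  hs_dot (e (g, w)) (e (g', w')) = 0.
Hypothesis Pi_e : forall f g w, Cc f ->
  Pi f (e (g, w)) = \sum_(h \in sfiber (rng g)) f h *: e (h *_G g, w).

Lemma state_sizeE f : Cc f -> state_size f = normR (Pi f (e (x : G, v))).
Proof.
move=> hf; have hf' := Cc_fstar hf; have hff := Cc_conv hf' hf.
set u := Pi f _; rewrite /state_size -rho_dot.
have <- : hs_dot u u = hs_dot (rho (cpl_in B (iso_restrict x (conv (fstar f) f))) v) v.
  rewrite -(induced_unit_dot rho_rep e_dot e_dot0 Pi_e v v hff).
  rewrite (rep_mul Pi_rep _ hf' hf) -/u.
  by have := rep_star Pi_rep u (e (x : G, v)) hf'; rewrite /= fstarK => ->.
by rewrite hs_dot_normR /= sqrtr_sqr ger0_norm ?normR_ge0.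
Qed.

Lemma normR_rep_induced f (s : R) : Cc f ->
  (forall t : seq G, uniq t -> (forall g, g \in t -> src g = x) ->
    \sum_(g <- t) normR (f g) <= s) ->
  normR (Pi f (e (x : G, v))) <= s.
Proof.
move=> hf hs; rewrite Pi_e// unit_rng.
pose t : seq G := finite_support 0 (sfiber (x : G)) f.
have tS g : g \in t -> src g = x.
  rewrite in_finite_support => [/set_mem[]//|].
  by apply: sub_finite_set (@Cc_sfinite R G f x hf) => h [hx /eqP].
rewrite -(@fsbig_supportE R G H _ f); last by move=> h _ ->; rewrite scale0r.
  apply: le_trans (normR_sum _ _ _) _.
  apply: le_trans (hs t (finite_support_uniq _ _ _) tS).
  rewrite big_seq [leRHS]big_seq; apply: ler_sum => g /tS gx.
  have gxg : g *_G x = g by rewrite -[X in _ *_G X]gx eg_mul_src.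
  rewrite normRZ gxg -[leRHS]mulr1 ler_wpM2l ?normR_ge0//.
  exact: le_trans (normR_induced_vec rho_rep e_dot _ gx) v_le1.
exact: Cc_sfinite.
Qed.

Lemma rep_CcB f1 f2 u : Cc f1 -> Cc f2 -> Pi (f1 - f2) u = Pi f1 u - Pi f2 u.
Proof.
move=> h1 h2; rewrite addrC -[X in Pi (X + _)]scaleN1r (rep_linear Pi_rep)//.
by rewrite scaleN1r addrC.
Qed.

(** The difference is orthogonal to all vectors over the same range, hence to itself. With v cyclic
    this approximates each e(g, w) by combinations of the e(k, v). *)
Lemma induced_vec_delta g k w : src g = x -> isotropy x k ->
  e (g, rho (cpl_in B (delta R k)) w) = e (g *_G k, w).
Proof.
move=> gx kx; have gk : src g = rng k by rewrite gx kx.1.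
have gkx : src (g *_G k) = x by rewrite srcM// kx.2.
have gkr : rng (g *_G k) = rng g by rewrite rngM.
set u := e (g, _); set u' := e (_, w).
have key g' w' : src g' = x -> rng g = rng g' -> hs_dot (u - u') (e (g', w')) = 0.
  move=> g'x gg'; rewrite hs_dotBl !e_dot// ?gkr//.
  have ig : isotropy x (g'^-1_G *_G g) by exact: isotropy_quo.
  have := rep_mul rho_rep w (group_alg_delta R ig) (group_alg_delta R kx).
  rewrite /= conv_delta; last by rewrite ig.2 kx.1.
  have -> : g'^-1_G *_G g *_G k = g'^-1_G *_G (g *_G k).
    by rewrite eg_mulA// src_inv.
  by move=> ->; rewrite subrr.
apply/eqP; rewrite -subr_eq0; apply/eqP/normR_eq0/eqP.
rewrite -sqrf_eq0; apply/eqP/complexI; rewrite -/(RtoC _) -hs_dot_normR.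
by rewrite hs_dotBr !key// subrr.
Qed.

End induced.
End state_size.

Section reduced.
Variables (R : realType) (G : etaleGroupoid) (A : fullCstar R G) (Ar : reducedCstar R G).
Implicit Types (f : G -> CC R) (a b : A).

Lemma reduced_surj_mulr0 a f : Cc f -> cpl_surj A Ar a = 0 ->
  cpl_surj A Ar (cs_mul a (cpl_in A f)) = 0.
Proof.
exact: (@cpl_surj_mulr0 R (Cc_ops R G) (@Cc_linear R G) _ _ A Ar
  (reduced_universal A) (@Cc_conv R G) a f).
Qed.

Lemma reduced_surj_mull0 b a : cpl_surj A Ar a = 0 -> cpl_surj A Ar (cs_mul b a) = 0.
Proof.
exact: (@cpl_surj_mull0 R (Cc_ops R G) (@Cc_linear R G) _ _ A Ar
  (reduced_universal A) (@Cc_conv R G) b a).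
Qed.

End reduced.

Section pointwise.
Variables (R : realType) (G : etaleGroupoid) (A : fullCstar R G) (Ar : reducedCstar R G).
Variables (x : unit_space G) (B : groupCstar R x).
Local Notation C := (CC R).
Implicit Types (g h k : G) (f : G -> C).
Variable phi : B -> C.
Hypothesis phi_state : is_state phi.

Lemma state_size_tri f1 f2 (s : R) : Cc f1 -> Cc f2 ->
  (forall t : seq G, uniq t -> (forall g, g \in t -> src g = x) ->
    \sum_(g <- t) normR (f1 g - f2 g) <= s) ->
  state_size phi f1 <= state_size phi f2 + s.
Proof.
move=> h1 h2 hs.
have [H0 [rho [v [hrho rdot v1 _]]]] := gns_cyclic phi_state.
have [H [Pi [e [hPi e1 e2 e3]]]] := induced_rep (rep_cpl hrho).
have E := state_sizeE hrho rdot hPi e1 e2 e3; rewrite (E _ h1) (E _ h2).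
set u := e _; have -> : Pi f1 u = Pi f2 u + Pi (f1 - f2) u.
  by rewrite (rep_CcB hPi u h1 h2) [RHS]addrC subrK.
apply: le_trans (normRD _ _) _; rewrite lerD2l.
exact: (normR_rep_induced hrho v1 e1 e3 (CcB h1 h2) hs).
Qed.

Lemma state_factors_of_size (Be : exoticCstar A Ar B) :
  (forall a, cpl_surj A Ar a = 0 -> forall f, Cc f ->
    state_size phi f <= normR (a - cpl_in A f)) ->
  state_factors (cpl_surj B Be) phi.
Proof.
move=> hsize.
have [H0 [rho [v [hrho rdot v1 vdense]]]] := gns_cyclic phi_state.
have [H [Pi [e [hPi e1 e2 e3]]]] := induced_rep (rep_cpl hrho).
have sizeE := state_sizeE hrho rdot hPi e1 e2 e3.
have elin := induced_vec_linear (rep_cpl hrho) e1.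
have PiL f : Cc f -> linear (Pi f) by move=> hf; exact: (rep_bounded hPi hf).1.
have fac : ind_factors A Ar rho.
  apply: (ind_factors_of_small hrho hPi e1 e2 e3) => a qa g w d gx d0.
  (* A linear space with constants M that are not uniform, so the bound does not pass to its
     closure; the approximation of w is paid for by the term in d. *)
  pose S := [set u : H | exists2 M : R, 0 <= M &
    forall f, Cc f -> normR (Pi f u) <= M * normR (a - cpl_in A f)].
  have Slin c u u' : S u -> S u' -> S (c *: u + u').
    move=> [M M0 hM] [M' M'0 hM']; exists (normR c * M + M').
      by rewrite addr_ge0// mulr_ge0// normR_ge0.
    move=> f hf; rewrite (PiL f hf); apply: le_trans (normRD _ _) _.
    rewrite mulrDl normRZ -mulrA; apply: lerD; last exact: hM'.
    by rewrite ler_wpM2l ?normR_ge0// hM.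
  have S0 : S 0.
    exists 0 => // f hf; have := PiL f hf 1 0 0; rewrite !scale1r addr0 => h.
    have -> : Pi f 0 = 0 by apply: (addrI (Pi f 0)); rewrite addr0 -h.
    by rewrite normR0 mul0r.
  have Sv k : src k = x -> S (e (k, v)).
    move=> kx; have [b hb bE] := @Cc_delta_bump R G k.
    exists (normR (cpl_in A b)); first exact: normR_ge0.
    move=> f hf; have -> : e (k, v) = Pi b (e (x : G, v)).
      rewrite e3// unit_rng (fsbigE [:: k])//=; last 2 first.
      - by move=> l /=; rewrite mem_seq1 => /eqP ->.
      - by move=> l lx; rewrite mem_seq1 => /negPf lk; rewrite bE ?lx// lk scale0r.
      rewrite big_cons big_nil mem_set// addr0 bE// eqxx scale1r.
      by rewrite -[X in _ *_G X]kx eg_mul_src.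
    (* The convolution of f and b is compared with a b, which again lies in the ideal; this costs
       the factor |b|. *)
    rewrite -(rep_mul hPi _ hf hb) -sizeE; last exact: Cc_conv.
    have hqa := reduced_surj_mulr0 hb qa.
    apply: le_trans (hsize _ hqa _ (Cc_conv hf hb)) _.
    by have := cpl_mul A hf hb => /= ->; rewrite -cs_mulBl mulrC; exact: normR_mul.
  have Sdom f0 : @so_dom R (group_alg_ops R x) f0 -> S (e (g, rho (cpl_in B f0) v)).
    move=> h0; rewrite (@group_alg_sum R G x H (fun f0 => e (g, rho (cpl_in B f0) v)) _ _ h0).
      have f0fin : finite_set (isotropy x `&` [set g | f0 g != 0]).
        by apply: sub_finite_set h0.1 => k [].
      rewrite -(@fsbig_supportE R G H _ f0)//; last by move=> k _ ->; rewrite scale0r.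
      rewrite big_seq; apply: big_ind => [|u u' hu hu'|k]; first exact: S0.
        by rewrite -[u]scale1r; exact: Slin.
      rewrite in_finite_support; last by apply: sub_finite_set f0fin => l [lx /eqP].
      move=> /set_mem[kx _].
      rewrite -[_ *: _]addr0; apply: Slin => //.
      rewrite (induced_vec_delta hrho e1 _ gx kx).
      by apply: Sv; rewrite srcM ?gx ?kx.1// kx.2.
    move=> c a1 a2 ha1 ha2.
    by rewrite (rep_linear (rep_cpl hrho) _ _ ha1 ha2) elin.
  have [f0 hf0 f0d] := vdense w d d0; have [M M0 hM] := Sdom _ hf0.
  exists M => // f hf; set w' := rho _ v in f0d hM.
  have -> : e (g, w) = 1 *: e (g, w - w') + e (g, w').
    by rewrite -elin// scale1r subrK.
  rewrite (PiL f hf) scale1r addrC; apply: le_trans (normRD _ _) _.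
  apply: lerD; first exact: hM.
  apply: le_trans (univ_rep_le A _ hPi hf) _; rewrite mulrC ler_wpM2r ?normR_ge0//.
  exact: le_trans (normR_induced_vec (rep_cpl hrho) e1 _ gx) f0d.
have bound (h : G -> C) : @so_dom R (group_alg_ops R x) h ->
    normR (phi (cpl_in B h)) <= normR (cpl_in Be h).
  move=> hh; rewrite -rdot; apply: le_trans (hs_CS _ _) _.
  have h1 : normR (rho (cpl_in B h) v) <= normR (cpl_in Be h) * normR v.
    apply: le_opnorm; first exact: (rep_bounded hrho (a := cpl_in B h) I).1.
    rewrite (cpl_norm Be hh); apply: ereal_sup_ubound.
    by exists H0, rho; split.
  apply: le_trans (_ : normR (cpl_in Be h) * normR v * normR v <= _).
    by rewrite ler_wpM2r ?normR_ge0.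
  rewrite -mulrA ler_piMr ?normR_ge0//.
  by rewrite mulr_ile1 ?normR_ge0.
move=> b qb; apply: normR_eq0; apply/eqP; rewrite eq_le normR_ge0 andbT.
apply: (@le_mul_small _ _ 2) => // d d0 _.
have /(cpl_surj_eq0 _ Be (@exotic_universal R G A Ar x B))/(_ _ d0)[] := qb.
  by move=> c f1 f2; exact: group_alg_linear.
move=> h [hh bh eh].
have -> : phi b = phi (b - cpl_in B h) + phi (cpl_in B h) by rewrite -stateD// subrK.
apply: le_trans (normRD _ _) _; rewrite mulr_natr mulr2n; apply: lerD.
  exact: le_trans (state_le phi_state _) bh.
exact: le_trans (bound _ hh) eh.
Qed.

End pointwise.

(** * A countable approximation of C_c *)

Lemma complex_grid (R : realType) (z : CC R) (m : nat) : exists a b : int,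
  normR (z - RtoC m.+1%:R^-1 * Complex a%:~R b%:~R) <= 2 * m.+1%:R^-1.
Proof.
have m0 : 0 < m.+1%:R :> R by [].
have approx (t : R) : `|t - m.+1%:R^-1 * (Num.floor (t * m.+1%:R))%:~R| <= m.+1%:R^-1.
  have /andP[h1 h2] := Num.Theory.floor_itv (t * m.+1%:R).
  rewrite -[X in `|X - _|](mulfK (lt0r_neq0 m0)) [X in `|X - _|]mulrC -mulrBr normrM.
  rewrite gtr0_norm ?invr_gt0// ler_piMr ?invr_ge0// ger0_norm ?subr_ge0//.
  by move: h2; rewrite intrD; move: (_%:~R) => u; lra.
case: z => a b; exists (Num.floor (a * m.+1%:R)), (Num.floor (b * m.+1%:R)).
apply: le_trans (normR_le_ReIm _) _.
rewrite /= !mul0r subr0 addr0 [leRHS]mulr_natl mulr2n.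
by apply: lerD; exact: approx.
Qed.

Section countable.
Variables (R : realType) (G : etaleGroupoid).
Local Notation C := (CC R).
Implicit Types (g h : G) (f w : G -> C).

(** One half of an I-norm distance: differences are summed over range fibres only. *)
Definition rdist_le f w (s : R) := forall t : seq G, uniq t ->
  (forall g h, g \in t -> h \in t -> rng g = rng h) ->
  \sum_(g <- t) normR (f g - w g) <= s.

Variable U : nat -> set G.
Hypothesis U_open : forall n, open (U n).
Hypothesis U_basis : forall g (N : set G), nbhs g N -> exists n, U n g /\ U n `<=` N.

(* A function compatible with the data d is supported in the union of the basic
   sets listed in d and on each of them is close to the listed grid point. *)
Definition near_data (m : nat) (d : seq (nat * (int * int))) w :=
  (forall p, p \in d -> forall g, U p.1 g ->
    normR (w g - RtoC m.+1%:R^-1 * Complex p.2.1%:~R p.2.2%:~R) <= 3 * m.+1%:R^-1) /\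
  (forall g, (forall p, p \in d -> ~ U p.1 g) -> w g = 0).

(** A class of functions given by countable data, not a single function. Such classes replace a
    countable dense subset; for the data produced below it only matters that their members are close
    to f. *)
Fixpoint near_sum m (ds : seq (seq (nat * (int * int)))) f : Prop :=
  if ds is d :: ds' then
    exists w v, [/\ near_data m d w, near_sum m ds' v & f = w + v]
  else f = 0.

(** The basic sets are taken inside the section V, so a range fibre meets their union at most once,
    and a uniform bound on the difference bounds the fibre sums. *)
Lemma section_near_data w m : Cc_section w -> exists d, near_data m d w /\
  forall w', near_data m d w' -> rdist_le w w' (6 * m.+1%:R^-1).
Proof.
move=> [V [oV rV /(Cc_onE _ oV)[cw w0 [K [cK KV wK]]]]].
set u : R := m.+1%:R^-1; have u0 : 0 < u by rewrite /u invr_gt0.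
pose q (p : int * int) : C := RtoC u * Complex p.1%:~R p.2%:~R.
(* 3 u is the grid error 2 u plus the oscillation u of w; two functions with the same data then
   differ by at most 6 u. *)
pose D := [set n | U n `<=` V /\ exists p, forall g, U n g -> normR (w g - q p) <= 3 * u].
have KD : K `<=` cover D U.
  move=> g Kg; have Vg := KV _ Kg.
  have [a [b hab]] := complex_grid (w g) m.
  have /nearP_normR/(_ _ u0) h1 := cw _ Vg.
  have h2 : nbhs g V by apply: open_nbhs_nbhs.
  have [n [Ung hn]] := U_basis (filterI h1 h2).
  exists n => //; split; first by move=> h /hn[].
  exists (a, b) => h /hn[+ _] => /= hh.
  have -> : w h - q (a, b) = (w g - q (a, b)) - (w g - w h).
    by rewrite opprB [RHS]addrC addrA subrK.
  apply: le_trans (normRB _ _) _; rewrite -/u in hab; move: hab hh; rewrite /q /=.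
  move: (normR (w g - w h)) (normR _) => s t; lra.
move: cK; rewrite compact_cover => /(_ _ D U (fun n _ => U_open n) KD)[D' D'D KD'].
have /choice[p hp] n : exists p, D n -> forall g, U n g -> normR (w g - q p) <= 3 * u.
  have [[_ [p hp]]|nD] := pselect (D n); first by exists p.
  by exists (0, 0).
have D'P n : n \in finmap.enum_fset D' -> D n by move=> /D'D /set_mem.
pose W := [set g | exists2 n, n \in finmap.enum_fset D' & U n g].
have {}KD' : K `<=` W by move=> g /KD'[n nD' ng]; exists n.
exists [seq (n, p n) | n <- finmap.enum_fset D']; split.
  split=> [_ /mapP[n nD' ->] g /= ng|g hg]; first exact: (hp n (D'P n nD')).
  apply: wK => /KD'[n nD' ng]; apply: (hg (n, p n)) => //.
  by apply: map_f; exact: nD'.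
move=> w' [h1 h2] t ut rt.
apply: (@sum_uniq_le1 R G t W (fun g => w g - w' g)) => //.
- by rewrite mulr_ge0// ltW.
- move=> g; have [[n nD' ng]|ng] := pselect (W g); last first.
    rewrite wK => [|/KD' //]; rewrite h2 ?subr0 ?normR0 ?mulr_ge0 ?(ltW u0)//.
    by move=> _ /mapP[n nD' ->] /= ug; apply: ng; exists n.
  have a1 := hp n (D'P n nD') g ng.
  have a2 : normR (w' g - q (p n)) <= 3 * u.
    by apply: (h1 (n, p n)) => //; apply: map_f; exact: nD'.
  have -> : w g - w' g = (w g - q (p n)) - (w' g - q (p n)).
    by rewrite opprB addrA subrK.
  apply: le_trans (normRB _ _) _; move: a1 a2.
  by move: (normR _) (normR _) => s s'; lra.
- move=> g ng; rewrite wK => [|/KD' //]; rewrite h2 ?subr0//.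
  by move=> _ /mapP[n nD' ->] /= ug; apply: ng; exists n.
- move=> g h gt ht [n nD' ng] [n' n'D' n'h]; apply: rV; last exact: rt.
    by have [+ _] := D'P n nD'; apply.
  by have [+ _] := D'P n' n'D'; apply.
Qed.

Lemma rdist_leD f f' w w' s s' : rdist_le f f' s -> rdist_le w w' s' ->
  rdist_le (f + w) (f' + w') (s + s').
Proof.
move=> h h' t ut rt; apply: le_trans (lerD (h t ut rt) (h' t ut rt)).
rewrite -big_split /=; apply: ler_sum => g _; apply: le_trans (normRD _ _).
have -> // : (f + w) g - (f' + w') g = (f g - f' g) + (w g - w' g).
by rewrite [(f + w) g]/(f g + w g) [(f' + w') g]/(f' g + w' g) opprD addrACA.
Qed.

(** n is the number of summands in a decomposition of f into functions on sections. It is fixed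
    before the precision m, so the error tends to 0 as m grows. *)
Lemma Cc_near_sum f : Cc f -> exists n : nat, forall m, exists ds,
  near_sum m ds f /\
  forall f', near_sum m ds f' -> rdist_le f f' (n%:R * (6 * m.+1%:R^-1)).
Proof.
move: f; suff : (@Cc R G) `<=` [set f | exists n : nat, forall m, exists ds,
    near_sum m ds f /\
    forall f', near_sum m ds f' -> rdist_le f f' (n%:R * (6 * m.+1%:R^-1))] by [].
rewrite Cc_spanE; apply: lin_span_sub.
  exists 0%N => m; exists [::]; split => // f' /= -> t _ _.
  by rewrite mul0r big1// => g _; rewrite subrr normR0.
move=> c u v [V [oV rV uV]] [n hn]; exists n.+1 => m.
have hcu : Cc_section (c *: u).
  exists V; split=> //; move: uV => /(Cc_onE _ oV)[cu u0 [K [cK KV uK]]].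
  apply/(Cc_onE _ oV); split.
  - by move=> g Vg; exact: (cvgM (cvg_cst c) (cu g Vg)).
  - by move=> g nV; rewrite -[LHS]/(c * u g) u0// mulr0.
  - by exists K; split=> // g nK; rewrite -[LHS]/(c * u g) uK// mulr0.
have [d [hd1 hd2]] := section_near_data m hcu.
have [ds [hds1 hds2]] := hn m.
exists (d :: ds); split; first by exists (c *: u), v.
move=> _ [w [v' [hw hv' ->]]]; rewrite -nat1r mulrDl mul1r.
by apply: rdist_leD; [exact: hd2|exact: hds2].
Qed.

End countable.

Lemma countable_approx (R : realType) (G : etaleGroupoid) : @second_countable G ->
  exists P : nat -> set (G -> CC R), forall f, Cc f -> forall s : R, 0 < s ->
  exists k, P k f /\ forall f', P k f' -> forall t : seq G, uniq t ->
    (forall g h, g \in t -> h \in t -> src g = src h) ->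
    \sum_(g <- t) normR (f g - f' g) <= s.
Proof.
move=> [Bs /countable_injP[i iinj] [Oopen Obasis]].
pose U n : set G := \bigcup_(V in [set V | Bs V /\ i V = n]) V.
have UE V : Bs V -> U (i V) = V.
  move=> OV; apply/seteqP; split=> [g [V' [OV' ii] V'g]|g Vg]; last by exists V.
  by rewrite -(iinj _ _ _ _ ii) ?inE.
have Uopen n : open (U n) by apply: bigcup_open => V [OV _]; exact: Oopen.
have Ubasis g (N : set G) : nbhs g N -> exists n, U n g /\ U n `<=` N.
  by move=> /(Obasis g)[V [OV Vg] VN]; exists (i V); rewrite UE.
(* [fstar] exchanges the range fibres of [near_sum] with the source fibres wanted here; numbers that
   encode no data give empty classes. *)
pose P k : set (G -> CC R) := fun f =>
  if unpickle k is Some p then near_sum U p.1 p.2 (fstar f) else False.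
exists P => f hf s s0.
have [n hn] := Cc_near_sum Uopen Ubasis (Cc_fstar hf).
have s' : 0 < s / (n%:R * 6 + 1) by rewrite divr_gt0// ltr_wpDl// mulr_ge0.
have [m hm] := filter_ex (near_invn_lt s').
have [ds [h1 h2]] := hn m.
exists (pickle (m, ds)); rewrite /P pickleK; split=> //= f' hf' t ut st.
have ut' : uniq [seq g^-1_G | g <- t].
  by rewrite map_inj_uniq// => g h /(congr1 (@ginv _ (eg_ops G))); rewrite !ginvK.
have := h2 _ hf' _ ut'; rewrite big_map => h.
apply: le_trans (_ : n%:R * (6 * m.+1%:R^-1) <= _).
  rewrite (eq_bigr (fun g => normR (fstar f g^-1_G - fstar f' g^-1_G))).
    apply: h => _ _ /mapP[g gt ->] /mapP[h ht ->]; rewrite !rng_inv; exact: st.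
  by move=> g _; rewrite /fstar !eg_invK -rmorphB normRJ.
rewrite mulrA; move: hm; rewrite ltr_pdivlMr ?ltr_wpDl ?mulr_ge0// => hm.
have u0 : 0 < m.+1%:R^-1 :> R by rewrite invr_gt0.
by rewrite mulrC; move: hm u0; move: (m.+1%:R^-1) => u; lra.
Qed.

Section pointwise.
Variables (R : realType) (G : etaleGroupoid) (A : fullCstar R G).
Variables (x : unit_space G) (B : groupCstar R x).
Implicit Types (f : G -> CC R).
Variable phi : B -> CC R.
Hypothesis phi_state : is_state phi.

Lemma state_size_le_norm f1 f2 : Cc f1 -> Cc f2 ->
  state_size phi f1 <= state_size phi f2 + normR (cpl_in A f1 - cpl_in A f2).
Proof.
move=> h1 h2.
have [H0 [rho [v [hrho rdot v1 _]]]] := gns_cyclic phi_state.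
have [H [Pi [e [hPi e1 e2 e3]]]] := induced_rep (rep_cpl hrho).
have E := state_sizeE hrho rdot hPi e1 e2 e3; rewrite (E _ h1) (E _ h2).
set u := e _; have -> : Pi f1 u = Pi f2 u + Pi (f1 - f2) u.
  by rewrite (rep_CcB hPi u h1 h2) [RHS]addrC subrK.
apply: le_trans (normRD _ _) _; rewrite lerD2l.
apply: le_trans (univ_rep_le A _ hPi (CcB h1 h2)) _.
rewrite (cpl_inB A h1 h2) ler_piMr ?normR_ge0//.
apply: le_trans (normR_induced_vec (rep_cpl hrho) e1 _ _) v1.
by rewrite unit_src.
Qed.

Lemma state_restrict_norm f : Cc f ->
  normR (phi (cpl_in B (iso_restrict x f))) <= normR (cpl_in A f).
Proof.
by move=> hf; apply: le_trans (state_le phi_state _) _; exact: iso_restrict_norm.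
Qed.

Lemma state_size_sqr f : Cc f ->
  state_size phi f ^+ 2 = complex.Re (phi (cpl_in B (iso_restrict x (conv (fstar f) f)))).
Proof.
move=> hf; rewrite /state_size sqr_sqrtr//.
have [H0 [rho [v [hrho rdot v1 _]]]] := gns_cyclic phi_state.
have [H [Pi [e [hPi e1 e2 e3]]]] := induced_rep (rep_cpl hrho).
have hf' := Cc_fstar hf.
rewrite -rdot -(induced_unit_dot (rep_cpl hrho) e1 e2 e3 v v (Cc_conv hf' hf)).
rewrite (rep_mul hPi _ hf' hf).
have := rep_star hPi (Pi f (e (x : G, v))) (e (x : G, v)) hf'; rewrite /= fstarK => ->.
by rewrite hs_dot_normR /= sqr_ge0.
Qed.

End pointwise.

Lemma field_sumE (R : realType) (G : etaleGroupoid)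
    (B : forall x : unit_space G, groupCstar R x) (phix : forall x, B x -> CC R) f x :
  is_state (phix x) -> Cc f ->
  field_sum phix f x = phix x (cpl_in (B x) (iso_restrict x f)).
Proof.
move=> sphi hf.
rewrite (@iso_restrict_sum R G x (CC R)^o (fun a => phix x (cpl_in (B x) a)) f _ hf)//.
move=> c a b ha hb; rewrite (cpl_linear (B x))// (state_linear sphi).
by [].
Qed.

(** * Integrals of functions measurable for the completion *)

Section completed.
Context d (T : measurableType d) (R : realType).
Variable mu : {measure set T -> \bar R}.

(** The sets that differ from a measurable set by part of a null set form a sigma-algebra. In S the
    lower set is M minus N, which makes the condition symmetric under complements; it becomes an
    inner approximation afterwards. *)
Lemma completed_measurable_approx (E : set T) :
  (<<s completed_algebra_gen mu>>) E ->
  exists M N, [/\ measurable M, measurable N, mu N = 0%E, M `<=` E & E `<=` M `|` N].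
Proof.
pose S := [set E : set T | exists M N,
  [/\ measurable M, measurable N, mu N = 0%E, M `\` N `<=` E & E `<=` M `|` N]].
suff /(_ E) h : <<s completed_algebra_gen mu>> `<=` S.
  move=> /h[M [N [mM mN N0 ME EM]]]; exists (M `\` N), N; split => //.
    exact: measurableD.
  move=> x /EM[Mx|Nx]; last by right.
  by have [Nx|nN] := pselect (N x); [right|left].
apply: smallest_sub; last first.
  move=> _ [M mM [N [N' [mN' N'0 NN']]] <-]; exists M, N'; split => //.
    by move=> x [Mx _]; left.
  exact: setUS.
split.
- by exists set0, set0; split; rewrite ?measure0// => x [].
- move=> F [M [N [mM mN N0 MF FM]]]; exists (~` M), N; split => //.
  + exact: measurableC.
  + by move=> x [nM nN]; split=> // /FM[].
  + move=> x [_ nF]; have [Nx|nN] := pselect (N x); first by right.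
    by left => Mx; apply: nF; apply: MF.
- move=> F /choice[M /choice[N MN]].
  exists (\bigcup_n M n), (\bigcup_n N n); split.
  + by apply: bigcupT_measurable => n; case: (MN n).
  + by apply: bigcupT_measurable => n; case: (MN n).
  + apply/(negligibleP mu); first by apply: bigcupT_measurable => n; case: (MN n).
    apply: negligible_bigcup => n; exists (N n); case: (MN n) => _ mN N0 _ _.
    by split.
  + move=> x [[n _ Mx] nN]; exists n => //; have [_ _ _ + _] := MN n; apply.
    by split=> // Nx; apply: nN; exists n.
  + move=> x [n _ Fx]; have [_ _ _ _ /(_ _ Fx)] := MN n.
    by case=> [h|h]; [left|right]; exists n.
Qed.

End completed.

Section probability.
Import HBNNSimple.
Context d (T : measurableType d) (R : realType).
Variable mu : probability T R.

(* Neither of the next two integrands has to be measurable: the integral of a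
   nonnegative function is a supremum over the simple functions below it. *)
Lemma integral_ae_le_cst (F : T -> R) (M : R) : 0 <= M -> (forall x, 0 <= F x) ->
  {ae mu, forall x, F x <= M} -> (\int[mu]_x (F x)%:E <= M%:E)%E.
Proof.
move=> M0 F0 FM; rewrite ge0_integralTE => [|x]; last by rewrite lee_fin.
apply: ge_ereal_sup => _ [h hF <-]; rewrite -integralT_nnsfun.
apply: (@le_trans _ _ (\int[mu]_x (cst M%:E x))%E); last first.
  rewrite integral_cst// -[leRHS]mule1; apply: lee_wpmul2l; first by rewrite lee_fin.
  exact: probability_le1.
apply: ae_ge0_le_integral => //.
- by move=> x _; rewrite lee_fin; exact: fun_ge0.
- exact/measurable_EFinP.
- apply: filterS FM => x FMx _; rewrite lee_fin; apply: le_trans FMx.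
  by rewrite -lee_fin; exact: hF.
Qed.

Lemma markov_on (F : T -> R) (M : set T) (s : R) : measurable M -> 0 <= s ->
  (forall x, 0 <= F x) -> (forall x, M x -> s <= F x) ->
  (s%:E * mu M <= \int[mu]_x (F x)%:E)%E.
Proof.
move=> mM s0 F0 sF; rewrite ge0_integralTE => [|x]; last by rewrite lee_fin.
apply: ereal_sup_ubound; exists (scale_nnsfun (indic_nnsfun R mM) s0).
  move=> x; rewrite lee_fin /= /mindic indicE; have [/set_mem Mx|_] := boolP (x \in M).
    by rewrite mulr1; exact: sF.
  by rewrite mulr0.
transitivity (sintegral mu (cst s \* indic_nnsfun R mM)%R) => //.
by rewrite sintegralrM /= -[X in sintegral _ X]/(\1_M) sintegral_indic.
Qed.

(** By Markov's inequality the set where F n >= s has measure at most r n / s. As F n is measurable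
    only for the completion, this is applied to a measurable subset for each n, and the remainders
    lie in a null set. *)
Lemma markov_negligible (F : nat -> T -> R) (r : nat -> R) (s : R) : 0 < s ->
  (forall n, measurable_fun setT (F n : g_sigma_algebraType (completed_algebra_gen mu) -> R)) ->
  (forall n x, 0 <= F n x) -> (forall n, \int[mu]_x (F n x)%:E <= (r n)%:E)%E ->
  (forall e, 0 < e -> exists n, r n < e) ->
  mu.-negligible [set x | forall n, s <= F n x].
Proof.
move=> s0 mF F0 intF r0.
have /choice[M /choice[N MN]] n : exists M N,
    [/\ measurable M, measurable N, mu N = 0%E, M `<=` [set x | s <= F n x] &
        [set x | s <= F n x] `<=` M `|` N].
  apply: completed_measurable_approx.
  have := mF n measurableT `[s, +oo[%classic (measurable_itv _); rewrite setTI.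
  congr (_ _); apply/seteqP; split=> x /=; rewrite in_itv /= andbT//.
pose M' := \bigcap_n M n.
have mM' : measurable M' by apply: bigcapT_measurable => n; case: (MN n).
have M'0 : mu.-negligible M'.
  apply/(negligibleP mu) => //; apply/eqP; rewrite eq_le measure_ge0 andbT.
  apply/lee_addgt0Pr => e e0; rewrite add0e.
  have [n rn] := r0 _ (mulr_gt0 e0 s0); have [mM _ _ MF _] := MN n.
  apply: (@le_trans _ _ (mu (M n))).
    by apply: le_measure; rewrite ?inE// => x; apply.
  have := markov_on mM (ltW s0) (F0 n) MF; move=> /le_trans/(_ (intF n)) h.
  rewrite -(@lee_pmul2l _ s%:E) ?lte_fin//.
  by apply: le_trans h _; rewrite -EFinM lee_fin mulrC ltW.
have N0 : mu.-negligible (\bigcup_n N n).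
  apply: negligible_bigcup => n; exists (N n); case: (MN n) => _ mN N0 _ _.
  by split.
apply: negligibleS (negligibleU M'0 N0) => x hx.
have [|nN] := pselect ((\bigcup_n N n) x); [by right|left => n _].
have [_ _ _ _ /(_ _ (hx n))[]//] := MN n.
by move=> Nx; exfalso; apply: nN; exists n.
Qed.

(** The integrals of the positive and of the negative part both lie in [0, M], so their difference
    is at most M in absolute value. *)
Lemma Rintegral_ae_le_cst (F : T -> R) (M : R) : 0 <= M ->
  {ae mu, forall x, `|F x| <= M} -> `|Rintegral mu setT F| <= M.
Proof.
move=> M0 FM; have part (H : T -> R) : (forall x, H x <= `|F x|) ->
    exists2 r : R, (\int[mu]_x (Num.max (H x) 0)%:E)%E = r%:E & 0 <= r <= M.
  move=> HF; set I := integral _ _ _.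
  have I0 : (0 <= I)%E.
    by apply: integral_ge0 => x _; rewrite lee_fin le_max lexx orbT.
  have IM : (I <= M%:E)%E.
    apply: integral_ae_le_cst => // [x|]; first by rewrite le_max lexx orbT.
    by apply: filterS FM => x Fx; rewrite ge_max M0 andbT (le_trans (HF x)).
  exists (fine I); first by rewrite fineK// ge0_fin_numE//; exact: le_lt_trans IM (ltry _).
  have fI : I \is a fin_num by rewrite ge0_fin_numE//; exact: le_lt_trans IM (ltry _).
  by rewrite -!lee_fin fineK// I0.
have [a aE a0] := part F (fun x => ler_norm (F x)).
have [|b bE b0] := part (fun x => - F x).
  by move=> x; rewrite -normrN; exact: ler_norm.
rewrite /Rintegral integralE.
have -> : (\int[mu]_x ((fun x => (F x)%:E)^\+ x))%E = a%:E.
  by rewrite -aE; apply: eq_integral => x _; rewrite funeposE EFin_max.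
have -> : (\int[mu]_x ((fun x => (F x)%:E)^\- x))%E = b%:E.
  by rewrite -bE; apply: eq_integral => x _; rewrite funenegE EFin_max EFinN.
by rewrite /= ler_norml; move: a0 b0; lra.
Qed.

End probability.

(** * Almost every isotropy group *)

Section field.
Variables (R : realType) (G : etaleGroupoid) (A : fullCstar R G) (Ar : reducedCstar R G).
Variables (B : forall x : unit_space G, groupCstar R x).
Variables (Be : forall x : unit_space G, exoticCstar A Ar (B x)).
Variables (phi : A -> CC R) (phi_state : is_state phi).
Variables (mu : probability (borel_units G) R) (phix : forall x, B x -> CC R).
Arguments phix : clear implicits.
Hypothesis phi_pair : associated_pair phi mu phix.
Implicit Types (f : G -> CC R).

Lemma field_state x : is_state (phix x).
Proof. by have [_ [h _] _] := phi_pair; exact: h. Qed.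

(* Where the bound fails by 2d, the size of f_n is at least d for all f_n close to c,
   while the integrals of the squares of these sizes tend to phi(c^* c) = 0. *)
Lemma ae_state_size_le f (c : A) : state_factors (cpl_surj A Ar) phi ->
  Cc f -> cpl_surj A Ar c = 0 ->
  {ae mu, forall x, state_size (phix x) f <= normR (c - cpl_in A f)}.
Proof.
move=> fac hf qc; set t := normR _.
have [_ [_ meas] phiE] := phi_pair.
have bad (d : R) : 0 < d -> mu.-negligible [set x | t + 2 * d < state_size (phix x) f].
  move=> d0; have /choice[F hF] n : exists f', Cc f' /\
      normR (c - cpl_in A f') < Num.min d n.+1%:R^-1.
    have m0 : 0 < Num.min d n.+1%:R^-1
      by rewrite lt_min; apply/andP; split; [exact: d0|rewrite invr_gt0].
    have [f' hf' fe] := cpl_approx c m0; exists f'; split; [exact: hf'|exact: fe].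
  pose E n x := complex.Re (field_sum phix (conv (fstar (F n)) (F n)) x).
  have CF n : Cc (F n) by case: (hF n).
  have CFF n : Cc (conv (fstar (F n)) (F n)) by apply: Cc_conv => //; exact: Cc_fstar.
  have EE n x : E n x = state_size (phix x) (F n) ^+ 2.
    by rewrite /E (field_sumE (field_state x) (CFF n)) (state_size_sqr (field_state x) (CF n)).
  have E0 n x : 0 <= E n x by rewrite EE sqr_ge0.
  (* The two factors bound |f_n| and |c - f_n| in phi(f_n^* (f_n - c)), which equals phi(f_n^*
     f_n). *)
  pose r n := (normR c + d) * n.+1%:R^-1.
  have c0 : 0 < normR c + d by have := normR_ge0 c; lra.
  have intE n : (\int[mu]_x (E n x)%:E <= (r n)%:E)%E.
    (* [Rintegral] gives 0 to an infinite integral, so finiteness has to be known before it is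
       compared with the integral. *)
    have finE : (\int[mu]_x (E n x)%:E)%E \is a fin_num.
      rewrite ge0_fin_numE; last by apply: integral_ge0 => x _; rewrite lee_fin.
      apply: (@le_lt_trans _ _ (normR (cpl_in A (conv (fstar (F n)) (F n))))%:E).
        apply: integral_ae_le_cst => //; first exact: normR_ge0.
        apply: aeW => x; apply: le_trans (state_restrict_norm A (field_state x) (CFF n)).
        rewrite -(field_sumE (field_state x) (CFF n)).
        exact: le_trans (ler_norm _) (normRe_le _).
      exact: ltry.
    rewrite -(fineK finE) lee_fin -[fine _]/(Rintegral mu setT (E n)).
    have -> : Rintegral mu setT (E n) = complex.Re (phi (cpl_in A (conv (fstar (F n)) (F n)))).
      by rewrite (phiE _ (CFF n)).
    have e1 : cpl_in A (conv (fstar (F n)) (F n)) =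
        cs_mul (cs_star (cpl_in A (F n))) (cpl_in A (F n)).
      have := cpl_mul A (Cc_fstar (CF n)) (CF n); rewrite /= => ->.
      by have := cpl_star A (CF n); rewrite /= => ->.
    have e2 : phi (cs_mul (cs_star (cpl_in A (F n))) c) = 0.
      by apply: fac; exact: reduced_surj_mull0.
    have e3 : phi (cs_mul (cs_star (cpl_in A (F n))) (cpl_in A (F n))) =
        - phi (cs_mul (cs_star (cpl_in A (F n))) (c - cpl_in A (F n))).
      by rewrite cs_mulBr (stateB phi_state) e2 sub0r opprK.
    rewrite e1 e3; apply: le_trans (ler_norm _) _; apply: le_trans (normRe_le _) _.
    rewrite normRN; apply: le_trans (state_le phi_state _) _.
    apply: le_trans (normR_mul _ _) _; rewrite normR_star.
    have [_] := hF n; rewrite lt_min => /andP[Fd Fn].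
    apply: ler_pM; [exact: normR_ge0|exact: normR_ge0| |exact: ltW].
    have -> : cpl_in A (F n) = c - (c - cpl_in A (F n)) by rewrite opprB addrC subrK.
    by apply: le_trans (normRB _ _) _; rewrite lerD2l ltW.
  have negl := @markov_negligible _ _ _ mu E r (d ^+ 2).
  apply: negligibleS (negl _ _ _ _ _).
  - move=> x /= hx n; rewrite EE ler_pXn2r ?nnegrE ?(ltW d0)//; last exact: sqrtr_ge0.
    have h1 := state_size_le_norm A (field_state x) hf (CF n).
    have h2 := normR_tri c (cpl_in A f) (cpl_in A (F n)).
    have [_] := hF n; rewrite lt_min => /andP[Fd _]; rewrite -/t in h2.
    move: hx h1 h2 Fd; move: (state_size (phix x) f) (state_size (phix x) (F n)).
    move: (normR (cpl_in A f - _)) (normR (c - cpl_in A (F n))) => a b u v.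
    by lra.
  - by rewrite exprn_gt0.
  - by move=> n; have [] := meas _ (CFF n).
  - exact: E0.
  - exact: intE.
  - move=> e e0; have [n hn] := filter_ex (near_invn_lt (divr_gt0 e0 c0)).
    by exists n; rewrite /r mulrC -ltr_pdivlMr.
have : mu.-negligible (\bigcup_n [set x | t + 2 * n.+1%:R^-1 < state_size (phix x) f]).
  by apply: negligible_bigcup => n; apply: bad; rewrite invr_gt0.
apply: negligibleS => x /= /negP; rewrite -ltNge => tx.
have d0 : 0 < (state_size (phix x) f - t) / 2 by rewrite divr_gt0// subr_gt0.
have [n hn] := filter_ex (near_invn_lt d0).
by exists n => //=; move: hn; move: (n.+1%:R^-1) => u; lra.
Qed.

(** For each code (k, q) at most one pair (f, c) is selected, and only its null set is discarded. An
    arbitrary pair (f, a) with this code then has the bound q for some f' in the class of f, and q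
    exceeds |a - f| by less than e / 2. *)
Lemma ae_state_factors : @second_countable G -> state_factors (cpl_surj A Ar) phi ->
  {ae mu, forall x, state_factors (cpl_surj (B x) (Be x)) (phix x)}.
Proof.
move=> /(@countable_approx R)[P hP] fac.
have FF : Filter (nbhs (almost_everywhere mu)) by exact: ae_filter_ringOfSetsType.
pose good i (x : unit_space G) := forall k (q : rat), unpickle i = Some (k, q) ->
  forall f c, Cc f -> P k f -> cpl_surj A Ar c = 0 -> normR (c - cpl_in A f) < ratr q ->
  exists f', [/\ Cc f', P k f' & state_size (phix x) f' <= ratr q].
have : {ae mu, forall x, forall i, good i x}.
  apply: ae_foralln => i.
  have [[[[k q] [f c]] [/= ei hf Pf [qc cf]]]|none] :=
    pselect (exists p : (nat * rat) * ((G -> CC R) * A),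
      [/\ unpickle i = Some p.1, Cc p.2.1, P p.1.1 p.2.1 &
        cpl_surj A Ar p.2.2 = 0 /\ normR (p.2.2 - cpl_in A p.2.1) < ratr p.1.2]).
    have aef := ae_state_size_le fac hf qc.
    apply: filterS aef => x hx k' q'; rewrite ei => -[<- <-] _ _ _ _ _ _.
    by exists f; split => //; exact: le_trans hx (ltW cf).
  apply: aeW => x k q ei f c hf Pf qc cf; exfalso; apply: none.
  by exists ((k, q), (f, c)).
apply: filterS => x hx; apply: (state_factors_of_size (field_state x)) => a qa f hf.
apply/ler_addgt0Pr => e e0; have e2 : 0 < e / 2 by rewrite divr_gt0.
have [k [Pf hk]] := hP f hf _ e2.
have te : normR (a - cpl_in A f) < normR (a - cpl_in A f) + e / 2 by rewrite ltrDl.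
have [q] := rat_in_itvoo te; rewrite in_itv /= => /andP[q1 q2].
have [f' [hf' Pf' hf'q]] := hx (pickle (k, q)) k q (pickleK _) f a hf Pf qa q1.
have h1 : state_size (phix x) f <= state_size (phix x) f' + e / 2.
  apply: (state_size_tri (field_state x) hf hf') => t ut tx.
  by apply: hk => // g h /tx -> /tx ->.
rewrite (splitr e) addrA; apply: le_trans h1 _; rewrite lerD2r.
exact: le_trans hf'q (ltW q2).
Qed.

Lemma state_factors_ae :
  {ae mu, forall x, state_factors (cpl_surj (B x) (Be x)) (phix x)} ->
  state_factors (cpl_surj A Ar) phi.
Proof.
move=> hae a qa; have [_ _ phiE] := phi_pair.
have FF : Filter (nbhs (almost_everywhere mu)) by exact: ae_filter_ringOfSetsType.
apply: normR_eq0; apply/eqP; rewrite eq_le normR_ge0 andbT.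
(* One e for phi(a - f), and one each for the real and the imaginary part of phi(f). *)
apply: (@le_mul_small _ _ 3) => // e e0 _.
have [f hf fe] := cpl_approx a e0.
have bound x : state_factors (cpl_surj (B x) (Be x)) (phix x) ->
    normR (field_sum phix f x : CC R) <= e.
  move=> facx; rewrite (field_sumE (field_state x) hf).
  exact: le_trans (state_restrict_le (field_state x) facx qa hf) (ltW fe).
have -> : phi a = phi (a - cpl_in A f) + phi (cpl_in A f) by rewrite -stateD// subrK.
apply: le_trans (normRD _ _) _.
have h1 := le_trans (state_le phi_state (a - cpl_in A f)) (ltW fe).
have h2 : normR (phi (cpl_in A f)) <= e + e.
  rewrite (phiE _ hf); apply: le_trans (normR_le_ReIm _) _; apply: lerD.
    apply: Rintegral_ae_le_cst; first exact: ltW.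
    by apply: filterS hae => x /bound; apply: le_trans; exact: normRe_le.
  apply: Rintegral_ae_le_cst; first exact: ltW.
  by apply: filterS hae => x /bound; apply: le_trans; exact: normIm_le.
by apply: le_trans (lerD h1 h2) _; lra.
Qed.

End field.

Theorem proposition3p1 (R : realType) (G : etaleGroupoid)
    (G_second_countable : @second_countable G)
    (A : fullCstar R G) (Ar : reducedCstar R G)
    (B : forall x : unit_space G, groupCstar R x)
    (Be : forall x : unit_space G, exoticCstar A Ar (B x))
    (phi : A -> CC R) (phi_state : is_state phi)
    (phi_centralizer : forall f, C0_units f -> centralizer phi (C0_in A f))
    (mu : probability (borel_units G) R) (phix : forall x, B x -> CC R)
    (phi_pair : associated_pair phi mu phix) :
  state_factors (cpl_surj A Ar) phi <->
  {ae mu, forall x, state_factors (cpl_surj (B x) (Be x)) (phix x)}.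
Proof.
split; last exact: state_factors_ae.
exact: ae_state_factors.
Qed.
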